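(* Fix integers $k\ge 2$ and $l\ge 2$. Let $\lambda$ and $\mu$ be Young diagrams of the same size, both with no more than $k$ rows, and with $\mu$ $l$-regular. Let $\rho=(k-1,k-2,\dots,1,0)$. Then $$d_{\lambda,\mu}(v)=n_{\lambda+\rho,\,\mu+\rho}(v),$$ where $d_{\lambda,\mu}(v)$ is the coefficient of $\lambda$ in the element $G(\mu)$ of the lower global crystal basis (for $U_v(\widehat{\mathfrak{sl}}_l)$ acting on Fock space), and $n_{\lambda+\rho,\mu+\rho}(v)$ is the affine Kazhdan-Lusztig polynomial for the affine Weyl group of $\mathfrak{sl}_k$ acting at level $l$.
   Context: **Crystal basis side.** Young diagrams $\lambda=(\lambda_1\ge\lambda_2\ge\cdots)$ are identified with their sets of nodes $(i,j)$, $1\le j\le\lambda_i$. The $l$-residue of a node $(i,j)$ is $j-i$ reduced mod $l$ to $\{0,\dots,l-1\}$. A diagram is $l$-regular if it has at most $l-1$ non-empty rows of any given length. An indent $r$-node of $\lambda$ is a node of $l$-residue $r$ not in $\lambda$ whose addition to $\lambda$ gives a Young diagram (the node in the first empty row is allowed); a removable $r$-node is a node of $\lambda$ of $l$-residue $r$ whose removal gives a Young diagram. The Fock space $\mathcal F$ is the $\mathbb Q(v)$-vector space with basis all Young diagrams (including the empty diagram $\emptyset$). For $0\le i\le l-1$ the operator $f_i$ on $\mathcal F$ is $f_i\lambda=\sum_\nu v^{N(\lambda,\nu)}\nu$, the sum over all $\nu$ obtained from $\lambda$ by adding one node of $l$-residue $i$; if that node is in row $a$, then $N(\lambda,\nu)$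 is the number of indent $i$-nodes of $\lambda$ in rows $<a$ minus the number of removable $i$-nodes of $\lambda$ in rows $<a$. (These give the action on $\mathcal F$ of the subalgebra $U^-\subset U_v(\widehat{\mathfrak{sl}}_l)$ generated by the $f_i$.) Let $M=U^-\emptyset\subseteq\mathcal F$ be the $\mathbb Q(v)$-span of all $f_{i_1}\cdots f_{i_m}\emptyset$. There is a well-defined $\mathbb Q$-linear involution of $M$, $\overline{p(v)f_{i_1}\cdots f_{i_m}\emptyset}=p(v^{-1})f_{i_1}\cdots f_{i_m}\emptyset$; elements fixed by it are called self-dual. Put $[m]=(v^m-v^{-m})/(v-v^{-1})$, $[m]!=[m]\cdots[1]$, $f_i^{(m)}=f_i^m/[m]!$, and let $M_{\mathbb Q}$ be the $\mathbb Q[v,v^{-1}]$-span of all products of divided powers $f_i^{(m)}$ applied to $\emptyset$. Let $L\subset\mathcal F$ be the span of all Young diagrams over the ring of rational functions in $\mathbb Q(v)$ without pole at $v=0$. By a theorem of Kashiwara, $M_{\mathbb Q}$ has a unique $\mathbb Q[v,v^{-1}]$-basis $\{G(\mu)\}$ indexed by $l$-regular Young diagrams such that $G(\mu)\equiv\mu \pmod{vL}$ and $G(\mu)$ is self-dual (the lower global crystal basis). Define $d_{\lambda,\mu}(v)$ by $G(\mu)=\sum_\lambda d_{\lambda,\mu}(v)\lambda$. **Kazhdan-Lusztig side.** Let $\mathcal W$ be the affine Weyl group of $\mathfrak{sl}_k$ acting at level $l$ on $\mathbb R^k$: the group generated by the reflections in the hyperplanes $x_i-x_j=ml$, $1\le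 i<j\le k$, $m\in\mathbb Z$. For such a hyperplane (with $i<j$) the positive side is $x_i-x_j>ml$. Alcoves are the connected components of the complement of the union of these hyperplanes; $\mathcal A^+$ is the set of alcoves contained in $\{x_1\ge\cdots\ge x_k\}$, and $A^+=\{x_1>\cdots>x_k,\ x_1-x_k<l\}$. Let $\mathcal S$ be the set of reflections in the walls of $A^+$, so $(\mathcal W,\mathcal S)$ is a Coxeter system; $\mathcal S_0\subset\mathcal S$ those fixing the origin and $W\cong S_k$ the subgroup they generate. The Hecke algebra $\mathcal H$ over $\mathbb Z[v,v^{-1}]$ has generators $H_s$ ($s\in\mathcal S$) satisfying the braid relations and $H_s^2=1+(v^{-1}-v)H_s$, with standard basis $H_x$, $x\in\mathcal W$, and involution $\bar v=v^{-1}$, $\overline{H_x}=(H_{x^{-1}})^{-1}$. Let $\mathcal H_f\subset\mathcal H$ be the subalgebra generated by $H_s$, $s\in\mathcal S_0$, acting on $\mathbb Z[v,v^{-1}]$ by $H_s\mapsto -v$, and let $\mathcal N=\mathbb Z[v,v^{-1}]\otimes_{\mathcal H_f}\mathcal H$, a right $\mathcal H$-module with basis $N_x=1\otimes H_x$, $x\in\mathcal W^f$, where $\mathcal W^f$ is the set of minimal length representatives of the cosets $Wx$. The involution of $\mathcal N$ is $\overline{a\otimes b}=\bar a\otimes\bar b$. It is known that $\mathcal N$ has a unique basis $\{\underline N_x:x\in\mathcal W^f\}$ of self-dual elements with $\underline N_x\in N_x+\sum_{y<x}v\mathbb Z[v]N_y$ ($<$ the Bruhat order); write $\underline N_x=\sum_y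 n_{y,x}N_y$ (so $n_{x,x}=1$ and $n_{y,x}=0$ unless $y\le x$). The map $x\mapsto xA^+$ is a bijection $\mathcal W^f\to\mathcal A^+$; if $y,x$ correspond to alcoves $B,A$, put $n_{B,A}=n_{y,x}$. For $x\in\mathbb Z^k$ with $x_1>\cdots>x_k$, let $a^+(x)\in\mathcal A^+$ be the unique alcove whose closure contains $x$ and which lies on the positive side of every reflection hyperplane containing $x$ (if $x$ lies in an open alcove, $a^+(x)$ is that alcove). For two such points $x,y$, put $n_{y,x}=n_{a^+(y),a^+(x)}$ if $y$ is in the $\mathcal W$-orbit of $x$, and $n_{y,x}=0$ otherwise. *)

(* Defs.v *)
From HB Require Import structures.
From mathcomp Require Import all_boot all_order all_algebra.
From mathcomp Require Import all_classical all_reals all_analysis.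
From mathcomp.multinomials Require Import freeg.

Set Implicit Arguments.
Unset Strict Implicit.
Unset Printing Implicit Defensive.

Import Order.TTheory GRing.Theory Num.Theory.
Import numFieldNormedType.Exports.

Local Open Scope classical_set_scope.
Local Open Scope ring_scope.

Section LinearCombinations.
Context {A : pzRingType} {M : lmodType A} {I : choiceType}.
Implicit Types (S : set A) (D : set I) (b : I -> M) (c : I -> A).

(* [m] is the finite combination of the [b i], [i] in [D], with coefficients
   [c i] in [S]. *)
Definition combination S D b c (m : M) : Prop :=
  [/\ finite_set [set i | c i <> 0],
      [set i | c i <> 0] `<=` D,
      (forall i, S (c i)) &
      m = \sum_(i \in D) c i *: b i].

Definition span_over S D b : set M :=
  [set m | exists c, combination S D b c m].

(* [S] is (the underlying set of) a subring of [A] and [X] an [S]-submodule of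
   [M]; [S = setT], [X = setT] is the case of a basis of the [A]-module [M]. *)
Definition is_basis S D b (X : set M) : Prop :=
  span_over S D b = X /\
  (forall c, combination S D b c 0 -> forall i, c i = 0).

(* Meaningful when [b] is a basis of [M] indexed by [D]. *)
Definition coordinates D b (m : M) : I -> A :=
  xget (fun=> 0) [set c | combination setT D b c m].

End LinearCombinations.

Section RationalFunctions.

Definition Qv : fieldType := {fraction {poly rat}}.

Definition ofQX : {rmorphism {poly rat} -> Qv} := @FracField.tofrac {poly rat}.
Definition ofZX : {rmorphism {poly int} -> Qv} := ofQX \o map_poly intr.

Definition v : Qv := ofQX 'X.

Definition laurentQ : set Qv :=
  [set x | exists p : {poly rat}, exists n : nat, x = ofQX p / v ^+ n].

Definition regular_at0 : set Qv :=
  [set x | exists p q : {poly rat}, q.[0] != 0 /\ x = ofQX p / ofQX q].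

(* p(v) |-> p(v^-1) on polynomials, then on quotients of polynomials *)
Definition eval_inv (p : {poly rat}) : Qv :=
  (map_poly (ofQX \o polyC) p).[v^-1].

Definition barQ (x : Qv) : Qv :=
  eval_inv (frac (repr x)).1 / eval_inv (frac (repr x)).2.

Lemma ofQX_eq0 p : (ofQX p == 0) = (p == 0).
Proof. exact: tofrac_eq0. Qed.

Lemma v_neq0 : v != 0.
Proof. by rewrite ofQX_eq0 polyX_eq0. Qed.

Lemma eval_invM p q : eval_inv (p * q) = eval_inv p * eval_inv q.
Proof. by rewrite /eval_inv rmorphM hornerM. Qed.

Lemma eval_inv_eq0 p : (eval_inv p == 0) = (p == 0).
Proof.
apply/idP/eqP => [/eqP p0|->]; last by rewrite /eval_inv rmorph0 horner0.
apply/eqP; apply: contraT => pn0.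
suff : ofQX (\poly_(i < size p) p`_(size p - i.+1)) == 0.
  rewrite ofQX_eq0 => /eqP /polyP /(_ 0%N).
  rewrite coef_poly size_poly_gt0 pn0 coef0 subn1 => /eqP.
  by rewrite -lead_coefE lead_coef_eq0 (negPf pn0).
suff -> : ofQX (\poly_(i < size p) p`_(size p - i.+1)) =
          v ^+ (size p).-1 * eval_inv p by rewrite p0 mulr0.
rewrite poly_def rmorph_sum /= /eval_inv.
rewrite (@horner_coef_wide _ (size p)) ?size_poly // mulr_sumr.
rewrite (reindex_inj rev_ord_inj) /=; apply: eq_bigr => i _.
have lti := ltn_ord i.
rewrite (subnSK lti) (subKn (ltnW lti)) coef_map /=.
rewrite -mul_polyC rmorphM rmorphXn /= -/v mulrCA.
congr (_ * _); move: (nat_of_ord i) lti => {i} j.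
case: (seq.size p) => // n ltj.
by rewrite subSS exprVn -expfB_cond ?(negPf v_neq0) ?add0n.
Qed.

Lemma fracE (x : Qv) : x = ofQX (frac (repr x)).1 / ofQX (frac (repr x)).2.
Proof.
set y := repr x; have y2 : (frac y).2 != 0 by apply: denom_ratioP.
apply/(canRL (mulfK _)); first by rewrite ofQX_eq0.
rewrite -{1}[x]reprK -/y /ofQX /=; unlock FracField.tofrac.
rewrite -[LHS]FracField.pi_mul /FracField.mulf !numden_Ratio ?oner_eq0 //.
apply/eqmodP; rewrite /= FracField.equivfE.
by rewrite !numden_Ratio ?mulr1 ?oner_eq0 // mulrC.
Qed.

Lemma barQ_frac p q : q != 0 ->
  barQ (ofQX p / ofQX q) = eval_inv p / eval_inv q.
Proof.
move=> q0; rewrite /barQ; have := fracE (ofQX p / ofQX q); set x := repr _.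
have x2 : (frac x).2 != 0 by apply: denom_ratioP.
move=> /eqP; rewrite eqr_div ?ofQX_eq0 // => /eqP; rewrite -!rmorphM => /eqP.
rewrite -subr_eq0 -rmorphB ofQX_eq0 subr_eq0 => /eqP e.
apply/eqP; rewrite eqr_div ?eval_inv_eq0 // -!eval_invM.
by rewrite e.
Qed.

Definition is_laurentZ (x : Qv) : bool :=
  `[< exists p : {poly int}, exists n : nat, x = ofZX p / v ^+ n >].

Definition laurentZ : {pred Qv} := is_laurentZ.

Lemma laurentZ_subring : subring_closed laurentZ.
Proof.
split=> [|x y /asboolP[p [n ->]] /asboolP[q [m ->]]
         |x y /asboolP[p [n ->]] /asboolP[q [m ->]]]; apply/asboolP.
- by exists 1, 0%N; rewrite rmorph1 expr0 divr1.
- exists (p * 'X^m - q * 'X^n), (n + m)%N.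
  have vE i : v ^+ i = ofZX 'X^i by rewrite /ofZX /= map_polyXn rmorphXn.
  rewrite rmorphB !rmorphM -!vE.
  have h i : v ^+ i != 0 by rewrite expf_neq0 ?v_neq0.
  apply/(canRL (mulfK (h _))); rewrite mulrBl exprD.
  by rewrite mulrA divfK // [_ ^+ n * _]mulrC mulrA divfK.
- by exists (p * q), (n + m)%N; rewrite rmorphM exprD invfM mulrACA.
Qed.

HB.instance Definition _ :=
  GRing.isSubringClosed.Build Qv is_laurentZ laurentZ_subring.

Lemma vX_laurentZ n : v ^+ n \in laurentZ.
Proof.
apply/asboolP; exists 'X^n, 0%N.
by rewrite expr0 divr1 /ofZX /= map_polyXn rmorphXn.
Qed.

Lemma vXV_laurentZ n : v ^- n \in laurentZ.
Proof. by apply/asboolP; exists 1, n; rewrite rmorph1 div1r. Qed.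

Lemma eval_invX n : eval_inv 'X^n = v ^- n.
Proof. by rewrite /eval_inv map_polyXn hornerXn exprVn. Qed.

Lemma barQ_laurentZ x : x \in laurentZ -> barQ x \in laurentZ.
Proof.
move=> /asboolP[p [n ->]]; rewrite -[v ^+ n]rmorphXn barQ_frac; last first.
  by rewrite expf_neq0 // polyX_eq0.
rewrite eval_invX invrK /eval_inv horner_coef mulr_suml rpred_sum // => i _.
rewrite coef_map /= -mulrA [in X in _ * X]exprVn coef_map /=.
rewrite !rpredM ?vX_laurentZ ?vXV_laurentZ //; apply/asboolP; exists (p`_i)%:P, 0%N.
by rewrite expr0 divr1 /ofZX /= map_polyC.
Qed.

End RationalFunctions.

(* The ring Z[v, v^-1] *)
Record laurent := Laurent { laurent_val :> Qv; _ : laurent_val \in laurentZ }.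

HB.instance Definition _ := [isSub for laurent_val].
HB.instance Definition _ := [Choice of laurent by <:].
HB.instance Definition _ := [SubChoice_isSubComNzRing of laurent by <:].

Definition vL : laurent := Laurent (vX_laurentZ 1).
Definition vLV : laurent := Laurent (vXV_laurentZ 1).

Definition barL (a : laurent) : laurent := Laurent (barQ_laurentZ (valP a)).

(* v Z[v] *)
Definition vZv : set laurent :=
  [set a | exists p : {poly int}, val a = v * ofZX p].

(* A diagram is the list of its non-empty rows; rows, columns and nodes are
   numbered from 0, so that the residue of the node (i, j) is still j - i. *)
Definition is_young (s : seq nat) : bool := sorted geq s && (0%N \notin s).

Record young := Young { rows :> seq nat; _ : is_young rows }.

HB.instance Definition _ := [isSub for rows].
HB.instance Definition _ := [Choice of young by <:].

Definition empty_diagram : young := @Young [::] isT.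

Definition row_len (lam : young) (i : nat) : nat := nth 0%N lam i.

Definition l_regular (l : nat) (lam : young) : Prop :=
  forall m : nat, (0 < m)%N -> (count_mem m lam <= l.-1)%N.

Section FockSpace.
Variable l : nat.
Implicit Types (r : 'I_l) (lam : young).

Definition has_residue r (i j : nat) : bool :=
  ((j%:Z - i%:Z) %% l)%Z == r%:Z.

(* There is an indent (resp. removable) [r]-node of [lam] in row [a]; the list
   of row lengths obtained by removing a node may end with a 0. *)
Definition indent r lam (a : nat) : bool :=
  [&& (a <= size lam)%N, has_residue r a (row_len lam a)
    & is_young (incr_nth lam a)].

Definition removable r lam (a : nat) : bool :=
  [&& (a < size lam)%N, has_residue r a (row_len lam a).-1
    & sorted geq (set_nth 0%N lam a (row_len lam a).-1)].

(* By [indent], the default value of [insubd] is never used below. *)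
Definition add_node lam (a : nat) : young := insubd lam (incr_nth lam a).

Definition N_exponent r lam (a : nat) : int :=
  (\sum_(b < a) indent r lam b)%:Z - (\sum_(b < a) removable r lam b)%:Z.

Definition fock : lmodType Qv := {freeg young / Qv}.

Definition diagram lam : fock := << lam >>.

Definition fock_coeff lam (x : fock) : Qv := coeff lam x.

Definition f_diagram r lam : fock :=
  \sum_(a < (size lam).+1 | indent r lam a)
    v ^ N_exponent r lam a *: diagram (add_node lam a).

Definition f_op r : fock -> fock := fglift (f_diagram r).

(* f_{i_1} ... f_{i_m} applied to the empty diagram *)
Definition f_word (w : seq 'I_l) : fock := foldr f_op (diagram empty_diagram) w.

Definition M : set fock := span_over setT setT f_word.

(* The graph of the involution of [M], which is well defined. *)
Definition barM (x y : fock) : Prop :=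
  exists c : seq 'I_l -> Qv,
    combination setT setT f_word c x /\
    combination setT setT f_word (barQ \o c) y.

Definition self_dual (x : fock) : Prop := barM x x.

Definition qint (m : nat) : Qv := (v ^+ m - v ^- m) / (v - v^-1).
Definition qfact (m : nat) : Qv := \prod_(1 <= i < m.+1) qint i.

Definition f_div (p : 'I_l * nat) (x : fock) : fock :=
  (qfact p.2)^-1 *: iter p.2 (f_op p.1) x.

Definition f_div_word (w : seq ('I_l * nat)) : fock :=
  foldr f_div (diagram empty_diagram) w.

Definition M_Q : set fock := span_over laurentQ setT f_div_word.

Definition lattice : set fock := span_over regular_at0 setT diagram.

Definition lower_global_basis (G : young -> fock) : Prop :=
  is_basis laurentQ [set mu | l_regular l mu] G M_Q /\
  (forall mu, l_regular l mu ->
     (exists2 x, lattice x & G mu - diagram mu = v *: x) /\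
     self_dual (G mu)).

End FockSpace.

Section AffineWeylGroup.
Variables (R : realType) (k l : nat).

Local Notation V := 'rV[R]_k.
Local Notation aff := (V -> V).

(* the reflection hyperplane x_i - x_j = m l, its positive side, and the
   orthogonal reflection in it *)
Definition hyperplane (i j : 'I_k) (m : int) : set V :=
  [set x | x ord0 i - x ord0 j = (m * l%:Z)%:~R].

Definition positive_side (i j : 'I_k) (m : int) : set V :=
  [set x | (m * l%:Z)%:~R < x ord0 i - x ord0 j].

Definition reflection (i j : 'I_k) (m : int) : aff := fun x =>
  x - (x ord0 i - x ord0 j - (m * l%:Z)%:~R)
        *: (delta_mx ord0 i - delta_mx ord0 j).

Definition reflections : set aff :=
  [set t | exists (i j : 'I_k) m, (i < j)%N /\ t = reflection i j m].

Definition prod_word (s : seq aff) : aff := foldr (fun t w => t \o w) id s.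

Definition words (X : set aff) : set (seq aff) :=
  [set s | forall t, t \in s -> X t].

(* The subgroup generated by a set [X] of involutions. *)
Definition generated (X : set aff) : set aff := prod_word @` words X.

Definition affW : set aff := generated reflections.

Definition alcoves_support : set V :=
  [set x | forall (i j : 'I_k) m, (i < j)%N -> ~ hyperplane i j m x].

Definition alcove (C : set V) : Prop :=
  exists2 x, alcoves_support x & C = connected_component alcoves_support x.

Definition dominant_chamber : set V :=
  [set x | forall i j : 'I_k, (i <= j)%N -> x ord0 j <= x ord0 i].

Definition dominant_alcove (C : set V) : Prop :=
  alcove C /\ C `<=` dominant_chamber.

Definition fundamental_alcove : set V :=
  [set x | (forall i j : 'I_k, (i < j)%N -> x ord0 j < x ord0 i) /\
           (forall i j : 'I_k, i = 0%N :> nat -> j = k.-1 :> nat ->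
              x ord0 i - x ord0 j < l%:R)].

(* The hyperplane supports a face of [C], i.e. is the only hyperplane through
   some point of the closure of [C]. *)
Definition wall (C : set V) (i j : 'I_k) (m : int) : Prop :=
  exists2 x, closure C x &
    forall (i' j' : 'I_k) m', (i' < j')%N ->
      (hyperplane i' j' m' x <-> (i', j', m') = (i, j, m)).

Definition simple : set aff :=
  [set t | exists (i j : 'I_k) m,
    [/\ (i < j)%N, wall fundamental_alcove i j m
      & t = reflection i j m]].

Definition simple0 : set aff := [set t | simple t /\ t 0 = 0].

Definition finW : set aff := generated simple0.

Definition reduced_word (s : seq aff) : Prop :=
  words simple s /\
  forall s', words simple s' -> prod_word s' = prod_word s ->
    (size s <= size s')%N.

Definition len (w : aff) : nat :=
  xget 0%N [set n | exists s,
    [/\ reduced_word s, prod_word s = w & size s = n]].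

Definition minW : set aff :=
  [set x | affW x /\ forall w, finW w -> (len x <= len (w \o x))%N].

Inductive bruhat (y : aff) : aff -> Prop :=
| bruhat_refl : bruhat y y
| bruhat_step x t : bruhat y x -> reflections t ->
    (len x < len (x \o t))%N -> bruhat y (x \o t).

Definition bruhat_lt (y x : aff) : Prop := bruhat y x /\ y <> x.

Section Hecke.

(* [n] alternating factors a b a b ... *)
Fixpoint alternating {B : pzRingType} (a b : B) (n : nat) : B :=
  if n is n'.+1 then a * alternating b a n' else 1.

Definition order_of (w : aff) (n : nat) : Prop :=
  [/\ (0 < n)%N, iter n w =1 id
    & forall n', (0 < n')%N -> iter n' w =1 id -> (n <= n')%N].

Definition hecke_relations (B : algType laurent) (b : aff -> B) : Prop :=
  (forall s, simple s -> b s * b s = 1 + (vLV - vL) *: b s) /\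
  (forall s t n, simple s -> simple t -> s <> t -> order_of (s \o t) n ->
     alternating (b s) (b t) n = alternating (b t) (b s) n).

(* The Hecke algebra, given by generators and relations over Z[v, v^-1], with
   its standard basis [hstd] and its involution [hbar]; only the values of
   [hgen] on [simple] and of [hstd] on [affW] are relevant. *)
Record hecke := Hecke {
  hecke_alg :> algType laurent;
  hgen : aff -> hecke_alg;
  hgen_relations : hecke_relations hgen;
  hgen_universal : forall (B : algType laurent) (b : aff -> B),
    hecke_relations b ->
    exists f : {lrmorphism hecke_alg -> B},
      (forall s, simple s -> f (hgen s) = b s) /\
      (forall g : {lrmorphism hecke_alg -> B},
        (forall s, simple s -> g (hgen s) = b s) -> g =1 f);
  hstd : aff -> hecke_alg;
  hstd_reduced : forall s, reduced_word s ->
    hstd (prod_word s) = \prod_(t <- s) hgen t;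
  hstd_basis : is_basis setT affW hstd setT;
  hbar : {rmorphism hecke_alg -> hecke_alg};
  hbarZ : forall a h, hbar (a *: h) = barL a *: hbar h;
  hbar_std : forall x y, affW x -> affW y -> x \o y = id ->
    hbar (hstd x) * hstd y = 1 /\ hstd y * hbar (hstd x) = 1 }.

(* The subalgebra generated by the H_s, [s] in [simple0], together with its
   action on Z[v, v^-1]: [hf_char b c] means that [b] lies in this subalgebra
   and acts as multiplication by [c]. *)
Inductive hf_char (H : hecke) : H -> laurent -> Prop :=
| hf_gen s : simple0 s -> hf_char (hgen H s) (- vL)
| hf_scalar a : hf_char a%:A a
| hf_add b b' c c' :
    hf_char b c -> hf_char b' c' -> hf_char (b + b') (c + c')
| hf_mul b b' c c' :
    hf_char b c -> hf_char b' c' -> hf_char (b * b') (c * c').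

Definition biadditive (U U' P : zmodType) (phi : U -> U' -> P) : Prop :=
  (forall u, {morph phi u : x y / x + y}) /\
  (forall u, {morph phi^~ u : x y / x + y}).

Definition balanced (H : hecke) (P : zmodType) (phi : laurent -> H -> P) :=
  biadditive phi /\
  (forall b c, hf_char b c -> forall a h, phi (a * c) h = phi a (b * h)).

(* The right module Z[v, v^-1] (x) H over H, the tensor product being over the
   subalgebra H_f, with a (x) h written [tens a h]; its standard basis and its
   involution. *)
Record antispherical (H : hecke) := Antispherical {
  as_mod :> lmodType laurent;
  tens : laurent -> H -> as_mod;
  tens_balanced : balanced tens;
  tens_universal : forall (P : zmodType) (phi : laurent -> H -> P),
    balanced phi ->
    exists f : {additive as_mod -> P},
      (forall a h, f (tens a h) = phi a h) /\
      (forall g : {additive as_mod -> P},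
        (forall a h, g (tens a h) = phi a h) -> g =1 f);
  tensZ : forall a a' h, a *: tens a' h = tens (a * a') h;
  ract : as_mod -> H -> as_mod;
  ract_biadditive : biadditive ract;
  ract_tens : forall a h h', ract (tens a h) h' = tens a (h * h');
  tens_basis : is_basis setT minW (fun x => tens 1 (hstd H x)) setT;
  nbar : {additive as_mod -> as_mod};
  nbar_tens : forall a h, nbar (tens a h) = tens (barL a) (hbar H h) }.

Variables (H : hecke) (N : antispherical H).

Definition nstd (x : aff) : N := tens N 1 (hstd H x).

(* [uN x] is the self-dual element attached to [x]. *)
Definition kazhdan_lusztig_basis (uN : aff -> N) : Prop :=
  is_basis setT minW uN setT /\
  (forall x, minW x ->
     nbar N (uN x) = uN x /\
     span_over vZv [set y | minW y /\ bruhat_lt y x] nstd (uN x - nstd x)).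

(* n_{y, x}, for [y] and [x] in [minW] *)
Definition kl_poly (uN : aff -> N) (y x : aff) : laurent :=
  coordinates minW nstd (uN x) y.

(* the element of [minW] sending the fundamental alcove to [C] *)
Definition alcove_elt (C : set V) : aff :=
  xget (id : aff) [set x : aff | minW x /\ x @` fundamental_alcove = C].

(* n_{B, A} *)
Definition kl_poly_alcove (uN : aff -> N) (B A : set V) : laurent :=
  kl_poly uN (alcove_elt B) (alcove_elt A).

Definition aplus (x : V) : set V :=
  xget set0 [set C | [/\ dominant_alcove C, closure C x &
    forall (i j : 'I_k) m, (i < j)%N -> hyperplane i j m x ->
      C `<=` positive_side i j m]].

Definition kl_poly_point (uN : aff -> N) (y x : V) : laurent :=
  if `[< exists2 w, affW w & w x = y >]
  then kl_poly_alcove uN (aplus y) (aplus x) else 0.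

End Hecke.

(* [lam] + rho, with rho = (k-1, ..., 1, 0) *)
Definition rho_shift (lam : young) : V :=
  \row_(i < k) (row_len lam i + (k.-1 - i))%:R.

End AffineWeylGroup.

(* Main.v *)
Require Import Defs.
From mathcomp Require Import all_boot all_order all_algebra.
From mathcomp Require Import all_classical all_reals all_analysis.
From mathcomp Require Import perm zify.
From mathcomp.multinomials Require Import freeg.

Set Implicit Arguments.
Unset Strict Implicit.
Unset Printing Implicit Defensive.

Import Order.TTheory GRing.Theory Num.Theory.
Import numFieldNormedType.Exports.

Local Open Scope classical_set_scope.
Local Open Scope ring_scope.

(* A point y = lam + rho equals P \o u, where P is a point of the closed
   fundamental alcove and u an affine permutation. A v-weighted sum of the N_u
   over all such u gives an element M_y of the antispherical module. Some bar
   invariant operator of the Hecke algebra maps M_y to the sum of the v^N M_y'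
   that describes f_r on diagrams (lemma Xop_Mvec), and M_rho is bar invariant;
   so lam |-> M_(lam + rho), with diagrams of more than k rows going to 0, turns
   self-dual elements into bar invariant ones. Modulo v, M_y is the
   Kazhdan-Lusztig element of a^+(y); hence the coordinates of the image of
   G(mu) in the Kazhdan-Lusztig basis are bar invariant Laurent polynomials
   congruent modulo v to 0 or 1, so they are constant. Comparing coefficients at
   the standard basis element of a^+(lam + rho) gives the theorem. *)

(** [N] is a module over Z[v, v^-1], the Fock space a vector space over Q(v). No scalar extension of
    [N] is formed: the map from diagrams to [N] appears after composition with a Z[v, v^-1]-linear
    form [g] ([hecke_value g P]). Each operator f_r links two fundamental points, so statements
    about words quantify over [P].

    Bar invariance of M_rho rests on rho having the least [max_len] among decreasing points. The
    difference of M_rho and its bar conjugate is an eigenvector for the stabilizer of [P], supported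
    in lengths below [max_len rho]; but a nonzero eigenvector has nonzero coefficients on some whole
    fiber, up to its longest element.

    The final argument modulo v requires Laurent polynomials: v / (1 + v^2) is bar invariant and
    divisible by v without being 0. Since M_Q is defined by divided powers, these must be shown to
    preserve Laurent coefficients; for this f_r is split by rows into operators that q-commute. *)

(** * Affine permutations as windows of integers *)

Section AffinePermutations.
Variable k' : nat.
Local Notation k := (k'.+2).
Implicit Types (u : 'I_k -> int) (c x y : int) (i j : 'I_k).

Definition cong x y := (k%:Z %| x - y)%Z.

Lemma congP x y : reflect (exists h, x = y + k%:Z * h) (cong x y).
Proof.
apply: (iffP idP) => [/dvdzP[h e]|[h ->]].
  by exists h; rewrite mulrC -e addrC subrK.
by rewrite /cong addrAC subrr add0r dvdz_mulr.
Qed.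

Lemma cong_refl x : cong x x.
Proof. by rewrite /cong subrr. Qed.

Lemma cong_sym x y : cong x y = cong y x.
Proof. by rewrite /cong -opprB rpredN. Qed.

Lemma cong_trans y x z : cong x y -> cong y z -> cong x z.
Proof. by rewrite /cong => h1 h2; rewrite -(subrKA y) rpredD. Qed.

Lemma congDr x y z : cong (x + z) (y + z) = cong x y.
Proof. by rewrite /cong opprD addrACA subrr addr0. Qed.

Lemma cong_small x y : cong x y -> `|x - y| < k%:Z -> x = y.
Proof.
move=> /congP[h ->]; rewrite addrAC subrr add0r => hk.
suff: h = 0 by move=> ->; rewrite mulr0 addr0.
by move: hk; rewrite normrM; nia.
Qed.

Lemma cong_ord i j : cong i%:Z j%:Z -> i = j.
Proof.
have hi := ltn_ord i; have hj := ltn_ord j.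
move=> /cong_small h; apply/val_inj.
suff : i%:Z = j%:Z by case.
by apply: h; lia.
Qed.

Lemma cong_add1 x : cong (x + 1) x = false.
Proof.
apply/negP => /cong_small; lia.
Qed.

Lemma cong_sub1 x : cong (x - 1) x = false.
Proof. by apply/negP => /cong_small; lia. Qed.

Lemma congr_cong x x' y y' : cong x x' -> cong y y' -> cong x y = cong x' y'.
Proof.
move=> hx hy; apply/idP/idP => h.
  by apply: cong_trans hy; apply: cong_trans h; rewrite cong_sym.
by apply: (cong_trans hx); apply: (cong_trans h); rewrite cong_sym.
Qed.

Lemma fl_le (m : nat) (m0 : (0 < m)%N) (q x : int) : (q <= (x %/ m%:Z)%Z) = (q * m%:Z <= x).
Proof. by rewrite lez_divRL. Qed.

Lemma fl_lt (m : nat) (m0 : (0 < m)%N) (q x : int) : ((x %/ m%:Z)%Z < q) = (x < q * m%:Z).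
Proof. by rewrite ltz_divLR. Qed.

Lemma flE (m : nat) (m0 : (0 < m)%N) (q x : int) :
  q * m%:Z <= x -> x < (q + 1) * m%:Z -> (x %/ m%:Z)%Z = q.
Proof. by rewrite -fl_le // -fl_lt //; lia. Qed.

Lemma fl_bounds (m : nat) (m0 : (0 < m)%N) (x : int) :
  (x %/ m%:Z)%Z * m%:Z <= x /\ x < ((x %/ m%:Z)%Z + 1) * m%:Z.
Proof. by split; rewrite -?fl_le -?fl_lt //; lia. Qed.

Lemma fl_pred (m : nat) (m0 : (0 < m)%N) (x : int) :
  ((x - 1) %/ m%:Z)%Z = (x %/ m%:Z)%Z - (m%:Z %| x)%Z%:Z.
Proof.
have [h1 h2] := fl_bounds m0 x; set q := (x %/ m)%Z in h1 h2 *.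
case: (boolP (m%:Z %| x)%Z) => [/dvdzP[r e]|nd].
  have -> : q = r by rewrite /q e mulzK //; lia.
  by apply: flE => //; rewrite e; lia.
rewrite subr0; apply: flE => //; last by lia.
have : x <> q * m%:Z by move=> e; move: nd; rewrite e dvdz_mull.
by lia.
Qed.

Lemma fl_opp (m : nat) (m0 : (0 < m)%N) (x : int) :
  ~~ (m%:Z %| x)%Z -> ((- x) %/ m%:Z)%Z = - 1 - (x %/ m%:Z)%Z.
Proof.
move=> nd; have [h1 h2] := fl_bounds m0 x; set q := (x %/ m)%Z in h1 h2 *.
have : x <> q * m%:Z by move=> e; move: nd; rewrite e dvdz_mull.
by move=> ?; apply: flE => //; lia.
Qed.

(* [u] is the window of the affine permutation [u (i + k) = u i + k] of [int]. *)
Definition valid u :=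
  (forall i j, cong (u i) (u j) -> i = j) /\
  \sum_i u i = \sum_(i < k) i%:Z.

Definition increasing u := forall i j, (i < j)%N -> u i < u j.

Definition ordmod x : 'I_k := Ordinal (ltn_pmod `|(x %% k%:Z)%Z| (ltn0Sn k'.+1)).

Lemma ordmodE x : (ordmod x)%:Z = (x %% k%:Z)%Z.
Proof.
have h : 0 <= (x %% k%:Z)%Z by apply: modz_ge0; lia.
have h2 : (x %% k%:Z)%Z < k%:Z by apply: ltz_pmod; lia.
by rewrite /= modn_small; lia.
Qed.

Lemma ordmod_eq x y : (ordmod x == ordmod y) = cong x y.
Proof.
apply/eqP/idP => [e|h].
  by rewrite /cong -eqz_mod_dvd -!ordmodE e.
apply/val_inj/eqP; rewrite -eqz_nat !ordmodE.
by rewrite eqz_mod_dvd.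
Qed.

Lemma ordmod_bij u : valid u -> forall n, bijective (fun i => ordmod (u i - n)).
Proof.
move=> [hu _] n; apply: injF_bij => i j /eqP.
by rewrite ordmod_eq congDr => /hu.
Qed.

Lemma row_exists u c : valid u -> exists i, cong (u i) c.
Proof.
move=> hu; have [g _ gK] := ordmod_bij hu 0.
exists (g (ordmod c)); rewrite -ordmod_eq; apply/eqP.
by have := gK (ordmod c); rewrite /= subr0.
Qed.

(** The residues of the [u j - n] modulo k are 0, ..., k - 1 in some order. The window has the same
    sum as the identity window, so the quotients add up to [- n]. *)
Lemma sum_floor u n : valid u -> \sum_j ((u j - n) %/ k%:Z)%Z = - n.
Proof.
move=> hu.
have e1 : \sum_j (u j - n) =
    k%:Z * \sum_j ((u j - n) %/ k%:Z)%Z + \sum_(i < k) i%:Z.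
  have [g gK Kg] := ordmod_bij hu n.
  rewrite [X in _ + X](reindex (fun i => ordmod (u i - n))) /=; last first.
    by exists g => x _; [exact: gK | exact: Kg].
  rewrite mulr_sumr -big_split /=; apply: eq_bigr => j _.
  by have := ordmodE (u j - n); rewrite /= => ->; rewrite mulrC -divz_eq.
move: e1; rewrite sumrB hu.2 sumr_const card_ord -mulr_natl natz.
move: (\sum_j ((u j - n) %/ k%:Z)%Z) => S; move: (\sum_(i < k) _) => T e.
have e0 : k%:Z * (S + n) == 0 by apply/eqP; lia.
by move: e0; rewrite mulf_eq0 /= => /eqP; lia.
Qed.

(** By [sum_floor] at [n = u i], the value [u i] is recovered from the floors of the differences
    [u j - u i]; those with j < i follow from the others by [fl_opp]. *)
Lemma floors_inj u u' : valid u -> valid u' ->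
  (forall i j, (i < j)%N -> ((u j - u i) %/ k%:Z)%Z = ((u' j - u' i) %/ k%:Z)%Z) ->
  u = u'.
Proof.
move=> hu hu' H; apply/funext => i.
apply: oppr_inj; rewrite -(sum_floor (u i) hu) -(sum_floor (u' i) hu').
apply: eq_bigr => j _.
have nd (w : 'I_k -> int) (hw : valid w) : j != i -> ~~ (k%:Z %| w i - w j)%Z.
  by apply: contraNN => /hw.1 ->.
case: (ltngtP i j) => [ij|ji|/val_inj ->]; first exact: H.
  have ne : j != i by apply: contraTneq ji => ->; rewrite ltnn.
  by rewrite -opprB -[u' j - _]opprB !fl_opp ?nd // H.
by rewrite !subrr.
Qed.

(* the inverse of the affine permutation with window [u] *)
Definition winv u c : int := \sum_i (if cong (u i) c then i%:Z + c - u i else 0).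

Lemma winvE u c i : valid u -> cong (u i) c -> winv u c = i%:Z + c - u i.
Proof.
move=> hu hi; rewrite /winv (bigD1 i) //= hi big1 ?addr0 // => j ji.
case: ifP => // hj; case/eqP: ji; apply: hu.1.
by apply: cong_trans hj _; rewrite cong_sym.
Qed.

Lemma winv_row u i : valid u -> winv u (u i) = i%:Z.
Proof. by move=> hu; rewrite (winvE hu (cong_refl _)) addrK. Qed.

Lemma winv_inj u : valid u -> injective (winv u).
Proof.
move=> hu x y; have [i hi] := row_exists x hu; have [j hj] := row_exists y hu.
rewrite (winvE hu hi) (winvE hu hj) => e.
suff ij : i = j by move: e; rewrite ij; lia.
apply: cong_ord; move/congP: hi => [h1 e1]; move/congP: hj => [h2 e2].
by apply/congP; exists (h1 - h2); lia.
Qed.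

Lemma winv_shift u x h : valid u -> winv u (x + k%:Z * h) = winv u x + k%:Z * h.
Proof.
move=> hu; have [i hi] := row_exists x hu.
rewrite (winvE hu hi) (winvE (i := i) hu); first by lia.
by apply: (cong_trans hi); apply/congP; exists (- h); lia.
Qed.

(** This is [swap c] after u: the values congruent to c - 1 and to c are exchanged. Since [aff]
    reindexes coordinates and so reverses products, it becomes right multiplication by a simple
    reflection. *)
Definition act u c i :=
  if cong (u i) (c - 1) then u i + 1 else if cong (u i) c then u i - 1 else u i.

Definition swap c x :=
  if cong x (c - 1) then x + 1 else if cong x c then x - 1 else x.

Lemma actE u c i : act u c i = swap c (u i).
Proof. by []. Qed.

Lemma swapK c : involutive (swap c).
Proof.
move=> x; rewrite {2}/swap; case: ifP => [h1|h1].
  rewrite /swap.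
  have -> : cong (x + 1) (c - 1) = false.
    rewrite (congr_cong (x' := c) (y' := c - 1)) ?cong_refl //.
      by rewrite cong_sym cong_sub1.
    by rewrite -(congDr _ _ (- 1)) addrK.
  by rewrite -(congDr _ _ (-1)) addrK h1.
case: ifP => h2; last by rewrite /swap h1 h2.
by rewrite /swap congDr h2 subrK.
Qed.

Lemma swap_shift c x h : swap c (x + k%:Z * h) = swap c x + k%:Z * h.
Proof.
rewrite /swap; have e y : cong (x + k%:Z * h) y = cong x y.
  by apply: congr_cong; rewrite ?cong_refl //; apply/congP; exists h.
by rewrite !e; do 2?case: ifP => _; lia.
Qed.

Lemma swap_cong c x y : cong (swap c x) (swap c y) = cong x y.
Proof.
suff H z t : cong z t -> cong (swap c z) (swap c t).
  by apply/idP/idP => [/H|/H //]; rewrite !swapK.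
by move=> /congP[h ->]; rewrite swap_shift; apply/congP; exists h.
Qed.

Lemma actK u c : act (act u c) c = u.
Proof. by apply/funext => i; rewrite !actE swapK. Qed.

Lemma swap_cong' c c' : cong c c' -> swap c = swap c'.
Proof.
move=> h; apply/funext => x; rewrite /swap.
have e1 : cong x (c - 1) = cong x (c' - 1).
  by apply: congr_cong; rewrite ?cong_refl ?congDr.
have e2 : cong x c = cong x c'  by apply: congr_cong; rewrite ?cong_refl.
by rewrite e1 e2.
Qed.

Lemma act_cong u c c' : cong c c' -> act u c = act u c'.
Proof. by move=> h; apply/funext => i; rewrite !actE (swap_cong' h). Qed.

Lemma act_valid u c : valid u -> valid (act u c).
Proof.
move=> hu; split=> [i j|]; first by rewrite !actE swap_cong => /hu.1.
rewrite -hu.2; have [a ha] := row_exists (c - 1) hu; have [b hb] := row_exists c hu.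
have ab : b != a.
  apply/eqP => e; move: hb; rewrite e => hb.
  have := cong_trans _ hb; rewrite cong_sym in ha.
  by move=> /(_ _ ha); rewrite cong_sub1.
rewrite (bigD1 a) // (bigD1 b) //= [RHS](bigD1 a) // [X in _ = _ + X](bigD1 b) //=.
rewrite /act ha hb.
have -> : cong (u b) (c - 1) = false.
  apply/negP => h; move/eqP: ab; apply; apply: hu.1.
  by apply: (cong_trans h); rewrite cong_sym.
rewrite (eq_bigr u); first by lia.
move=> i /andP[ia ib]; case: ifP => [h|_].
  by case/eqP: ia; apply: hu.1; apply: (cong_trans h); rewrite cong_sym.
case: ifP => // h.
by case/eqP: ib; apply: hu.1; apply: (cong_trans h); rewrite cong_sym.
Qed.

Lemma winv_act u c x : valid u -> winv (act u c) x = winv u (swap c x).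
Proof.
move=> hu; have [i hi] := row_exists (swap c x) hu.
rewrite (winvE hu hi) (winvE (i := i) (act_valid c hu)); last first.
  by rewrite actE -(swapK c x) swap_cong.
have /congP[h e] := hi.
have -> : act u c i = x + k%:Z * h by rewrite actE e swap_shift swapK.
by lia.
Qed.

Lemma swap_r c : swap c c = c - 1.
Proof.
rewrite /swap cong_refl; case: ifP => //; rewrite cong_sym => /cong_small.
by lia.
Qed.

Lemma swap_l c : swap c (c - 1) = c.
Proof. by rewrite /swap cong_refl; lia. Qed.

End AffinePermutations.

(** * Length of windows, ascents and descents *)

Section Length.
Variable k' : nat.
Local Notation k := (k'.+2).
Local Notation cong := (cong k').
Implicit Types (u : 'I_k -> int) (c x y : int) (i j a b : 'I_k).

(* Shi's formula for the Coxeter length *)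
Definition ell u : nat :=
  \sum_(p : 'I_k * 'I_k | (p.1 < p.2)%N) `|((u p.2 - u p.1) %/ k%:Z)%Z|%N.

Lemma valid_neq u i j : valid u -> i != j -> ~~ (k%:Z %| u i - u j)%Z.
Proof. by move=> hu; apply: contraNN => /hu.1 ->. Qed.

Lemma cong_row u i j c : valid u -> cong (u i) c -> cong (u j) c = (j == i).
Proof.
move=> hu hi; apply/idP/eqP => [hj|->//].
by apply: hu.1; apply: (cong_trans hj); rewrite cong_sym.
Qed.

Lemma act_rows u c a b i : valid u -> cong (u a) (c - 1) -> cong (u b) c ->
  act u c i = u i + (i == a)%:Z - (i == b)%:Z.
Proof.
move=> hu ha hb; rewrite /act (cong_row i hu ha) (cong_row i hu hb).
have ab : a != b.
  apply/eqP => e; move: hb; rewrite -e => hb; have := cong_sub1 k' c.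
  by rewrite (cong_trans _ hb) // cong_sym.
case: eqP => [->|_]; first by rewrite (negPf ab); lia.
by case: eqP => _; lia.
Qed.

Lemma winv_lt u c a b : valid u -> cong (u a) (c - 1) -> cong (u b) c ->
  (winv u (c - 1) < winv u c) = (u b - u a < b%:Z - a%:Z + 1).
Proof. by move=> hu ha hb; rewrite (winvE hu ha) (winvE hu hb); lia. Qed.

Lemma row_step u c a b : cong (u a) (c - 1) -> cong (u b) c ->
  exists h, u b = u a + 1 + k%:Z * h.
Proof.
by move=> /congP[h1 e1] /congP[h2 e2]; exists (h2 - h1); lia.
Qed.

(** Let a and b be the rows with values congruent to c - 1 and c. The floor attached to this pair
    moves by 1 away from 0. For any other pair a change by 1 cannot cross a multiple of k, because
    values in distinct rows are incongruent. *)
Lemma ell_up u c : valid u -> winv u (c - 1) < winv u c ->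
  ell (act u c) = (ell u).+1.
Proof.
move=> hu; have [a ha] := row_exists (c - 1) hu; have [b hb] := row_exists c hu.
rewrite (winv_lt hu ha hb) => lt.
have ab : a != b.
  apply/eqP => e; move: hb; rewrite -e => hb; have := cong_sub1 k' c.
  by rewrite (cong_trans _ hb) // cong_sym.
have [h eh] := row_step ha hb.
have la := ltn_ord a; have lb := ltn_ord b.
have nab : (a : nat) <> b by move=> e; case/eqP: ab; apply/val_inj.
pose p0 := if (a < b)%N then (a, b) else (b, a).
have hp0 : (p0.1 < p0.2)%N by rewrite /p0; case: ifP => /=; lia.
rewrite /ell (bigD1 p0) //= [in RHS](bigD1 p0) //= -addSn.
have actu := act_rows _ hu ha hb.
congr addn.
  rewrite !actu /p0; case: ifP => hab /=; rewrite ?eqxx [b == a]eq_sym (negPf ab).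
    have -> : (u b - u a)%R = 1 + k%:Z * h by lia.
    have -> : (u b + 0%:Z - 1%:Z - (u a + 1%:Z - 0%:Z)) = (h - 1) * k%:Z + (k%:Z - 1) by lia.
    rewrite (@flE k isT (h - 1)) //; [|lia|lia].
    rewrite (@flE k isT (h)) //; [|lia|lia].
    have : h <= 0 by nia.
    by lia.
  have -> : (u a - u b)%R = - 1 - k%:Z * h by lia.
  have -> : (u a + 1%:Z - 0%:Z - (u b + 0%:Z - 1%:Z)) = 1 - k%:Z * h by lia.
  rewrite (@flE k isT (- h)) //; [|lia|lia].
  rewrite (@flE k isT (- h - 1)) //; [|lia|lia].
  have : h < 0 by nia.
  by lia.
apply: eq_bigr => -[i j] /andP[/= ij ne].
have nij : i != j by apply: contraTneq ij => ->; rewrite ltnn.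
have nji : j != i by rewrite eq_sym.
congr absz; rewrite !actu.
have hne : ~~ ((i == a) && (j == b)) /\ ~~ ((i == b) && (j == a)).
  move: ne; rewrite /p0; case: ifP => hab; rewrite xpair_eqE => ->; split=> //.
    by apply/negP => /andP[/eqP ei /eqP ej]; move: ij; rewrite ei ej; lia.
  by apply/negP => /andP[/eqP ei /eqP ej]; move: ij; rewrite ei ej; lia.
have ndv' i' j' : i' != j' -> ~~ (k%:Z %| u i' - u j')%Z by apply: valid_neq.
have fp x : ~~ (k%:Z %| x)%Z -> ((x - 1) %/ k%:Z)%Z = (x %/ k%:Z)%Z.
  by move=> nd; rewrite fl_pred // (negPf nd) subr0.
have [hne1 hne2] := hne.
case: (eqVneq i a) => [ea|ia].
  have ja : j != a by rewrite -ea.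
  have jb : j != b by apply: contraNneq hne1 => ->; rewrite ea !eqxx.
  rewrite (negPf ja) (negPf jb) ea (negPf ab).
  have -> : (u j + 0%:Z - 0%:Z - (u a + 1%:Z - 0%:Z)) = (u j - u a - 1) by clear; lia.
  by rewrite fp // ndv'.
case: (eqVneq j b) => [eb|jb].
  have ib : i != b by rewrite -eb.
  rewrite (negPf ib) eb [b == a]eq_sym (negPf ab).
  have -> : (u b + 0%:Z - 1%:Z - (u i + 0%:Z - 0%:Z)) = (u b - u i - 1) by clear; lia.
  by rewrite fp // ndv' // eq_sym.
case: (eqVneq i b) => [eb|ib].
  have ja : j != a by apply: contraNneq hne2 => ->; rewrite eb !eqxx.
  rewrite (negPf ja) eb.
  have -> : (u j + 0%:Z - 0%:Z - (u b + 0%:Z - 1%:Z)) = (u j - u b + 1) by clear; lia.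
  rewrite -[in RHS](addrK 1 (u j - u b)) fp //.
  have e : u j - u b + 1 = (u j - u a) + k%:Z * - h by clear -eh; lia.
  by rewrite e rpredDr ?dvdz_mulr // ndv'.
case: (eqVneq j a) => [ea|ja].
  rewrite ea; have -> : (u a + 1%:Z - 0%:Z - (u i + 0%:Z - 0%:Z)) = (u a - u i + 1) by clear; lia.
  rewrite -[in RHS](addrK 1 (u a - u i)) fp //.
  have e : u a - u i + 1 = (u b - u i) + k%:Z * - h by clear -eh; lia.
  by rewrite e rpredDr ?dvdz_mulr // ndv' // eq_sym.
by congr (_ %/ _)%Z; clear; lia.
Qed.

Lemma winv_neq u c : valid u -> winv u (c - 1) != winv u c.
Proof. by move=> hu; apply/eqP => /(winv_inj hu); lia. Qed.

Lemma winv_act_lt u c : valid u ->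
  (winv (act u c) (c - 1) < winv (act u c) c) = ~~ (winv u (c - 1) < winv u c).
Proof.
move=> hu; rewrite !winv_act // swap_l swap_r.
by have := winv_neq c hu; lia.
Qed.

Lemma ell_down u c : valid u -> ~~ (winv u (c - 1) < winv u c) ->
  ell u = (ell (act u c)).+1.
Proof.
move=> hu; rewrite -winv_act_lt // => /ell_up <-; first by rewrite actK.
exact: act_valid.
Qed.

(** One value goes up by 1 and another one down by 1. Incongruence modulo k protects the order
    unless these two are consecutive integers, and consecutive values of an increasing window sit in
    adjacent rows. *)
Lemma increasing_act u c : valid u -> increasing u ->
  increasing (act u c) \/
  exists a b, [/\ b = a.+1 :> nat, u b = u a + 1, cong (u a) (c - 1) & cong (u b) c].
Proof.
move=> hu inc; have [a ha] := row_exists (c - 1) hu; have [b hb] := row_exists c hu.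
case: (eqVneq (u b) (u a + 1)) => [e|ne].
  right; exists a, b; split=> //.
  have ab : (a < b)%N.
    case: (ltngtP a b) => // [/inc|/val_inj h]; first by lia.
    by move: e; rewrite h; lia.
  case: (ltngtP b a.+1) => // [|h]; first by lia.
  have lt : (a.+1 < k)%N by apply: leq_ltn_trans (ltn_ord b); lia.
  have := inc a (Ordinal lt) (ltnSn _); have := inc (Ordinal lt) b h.
  by lia.
left=> i j ij; rewrite !(act_rows _ hu ha hb).
have [h eh] := row_step ha hb; have lt := inc _ _ ij.
have nij : i != j by apply: contraTneq ij => ->; rewrite ltnn.
have nji : j != i by rewrite eq_sym.
case: (eqVneq i a) => [ea|ia].
  have ja : j != a by rewrite -ea.
  rewrite (negPf ja); case: (eqVneq j b) => [eb|jb].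
    have ib : i != b by rewrite -eb.
    rewrite (negPf ib) ea eb; rewrite ea eb in lt.
    have hn : h <> 0 by move=> h0; case/eqP: ne; rewrite eh h0; lia.
    have hp : k%:Z <= k%:Z * h by nia.
    by lia.
  case: (eqVneq i b) => ib; first by lia.
  have : u j <> u i + 1.
    move=> e; have := valid_neq hu jb.
    have -> : u j - u b = k%:Z * - h by rewrite e eh -ea; lia.
    by rewrite dvdz_mulr.
  by lia.
case: (eqVneq j b) => [eb|jb]; last by case: (j == a); case: (i == b); lia.
have ib : i != b by rewrite -eb.
rewrite (negPf ib); case: (eqVneq j a) => ja; first by lia.
have : u j <> u i + 1.
  move=> e; have := valid_neq hu ia.
  have -> : u i - u a = k%:Z * h by rewrite eb in e; lia.
  by rewrite dvdz_mulr.
by lia.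
Qed.

Definition id_perm i : int := i%:Z.

Lemma valid_id : valid id_perm.
Proof. by split=> // i j; exact: cong_ord. Qed.

Lemma winv_id x : winv id_perm x = x.
Proof.
have [i hi] := row_exists x valid_id.
by rewrite (winvE valid_id hi) /id_perm; lia.
Qed.

Lemma ell_id : ell id_perm = 0%N.
Proof.
rewrite /ell big1 // => -[i j] /= ij; rewrite /id_perm.
have lj := ltn_ord j; rewrite (@flE k isT 0) //; lia.
Qed.

(** Without a descent [winv u] grows by at least 1 at each step and by exactly k over a period. It
    is then a translation, and the normalisation of the sum forces the translation by 0. *)
Lemma exists_descent u : valid u -> u <> id_perm -> exists c, winv u c < winv u (c - 1).
Proof.
move=> hu ne; apply: contrapT => H.
have up x : winv u x + 1 <= winv u (x + 1).
  have := winv_neq (x + 1) hu; rewrite addrK => n1.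
  have : ~ winv u (x + 1) < winv u x by move=> h; apply: H; exists (x + 1); rewrite addrK.
  by lia.
have upn x (n : nat) : winv u x + n%:Z <= winv u (x + n%:Z).
  elim: n => [|n IH]; first by rewrite !addr0.
  have e1 : x + n.+1%:Z = x + n%:Z + 1 by lia.
  by have := up (x + n%:Z); rewrite e1; lia.
have eqn x (n : nat) : winv u (x + n%:Z) = winv u x + n%:Z.
  have := upn x n; have := upn (x + n%:Z) (k * n - n)%N.
  have -> : x + n%:Z + (k * n - n)%N%:Z = x + k%:Z * n%:Z by nia.
  rewrite winv_shift //; nia.
apply: ne.
have [t et] : exists t, forall x, winv u x = x + t.
  exists (winv u 0) => x; case: (lerP 0 x) => h.
    by have := eqn 0 `|x|%N; rewrite add0r gez0_abs //; lia.
  by have := eqn x `|x|%N; rewrite ltz0_abs // subrr => ->; lia.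
have ui i : u i = i%:Z - t by have := winv_row i hu; rewrite et; lia.
suff t0 : t = 0 by apply/funext => i; rewrite ui t0 subr0.
have := hu.2; under eq_bigr do rewrite ui.
rewrite sumrB sumr_const card_ord -mulr_natl natz => /eqP.
by rewrite subr_eq addrC -subr_eq subrr eq_sym mulf_eq0 /= => /eqP.
Qed.

Lemma increasing_descent u : valid u -> increasing u -> u <> id_perm ->
  exists c, [/\ increasing (act u c), valid (act u c) & ell u = (ell (act u c)).+1].
Proof.
move=> hu inc /(exists_descent hu)[c hc]; exists c.
have dn : ~~ (winv u (c - 1) < winv u c) by lia.
split; [|exact: act_valid|exact: ell_down].
case: (increasing_act c hu inc) => // -[a [b [eb e ha hb]]].
by move: dn; rewrite (winv_lt hu ha hb); lia.
Qed.

Lemma adjacent_up u a b c : valid u -> b = a.+1 :> nat -> u b = u a + 1 ->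
  cong (u a) (c - 1) -> cong (u b) c -> ell (act u c) = (ell u).+1.
Proof.
move=> hu e e1 ha hb; apply: ell_up => //.
by rewrite (winv_lt hu ha hb); lia.
Qed.

(** The remaining case of Deodhar's lemma: right multiplication by the simple reflection leaves the
    minimal coset representatives and equals left multiplication by a simple reflection of the
    finite group. *)
Lemma adjacent_act u a b c : valid u -> u b = u a + 1 ->
  cong (u a) (c - 1) -> cong (u b) c -> act u c = u \o tperm a b.
Proof.
move=> hu e ha hb; apply/funext => i; rewrite (act_rows _ hu ha hb) /=.
have ab : b != a by apply/eqP => h; move: e; rewrite h; lia.
case: tpermP => [->|->|/eqP/negPf -> /eqP/negPf ->]; last by lia.
  by rewrite eqxx eq_sym (negPf ab); lia.
by rewrite eqxx (negPf ab); lia.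
Qed.

Lemma valid_comp u (t : 'I_k -> 'I_k) : injective t -> valid u -> valid (u \o t).
Proof.
move=> tI hu; split=> [i j /= /hu.1 /tI //|].
by rewrite -hu.2 [RHS](reindex_inj tI).
Qed.

Let h x y := minn `|((x - y) %/ k%:Z)%Z| `|((y - x) %/ k%:Z)%Z|.

Let hC x y : h x y = h y x. Proof. exact: minnC. Qed.

Let sum_h u :
  (\sum_(p : 'I_k * 'I_k | p.1 != p.2) h (u p.1) (u p.2) =
   2 * \sum_(p : 'I_k * 'I_k | (p.1 < p.2)%N) h (u p.1) (u p.2))%N.
Proof.
rewrite (bigID (fun p : 'I_k * 'I_k => (p.1 < p.2)%N)) /= mul2n -addnn.
congr addn; first by apply: eq_bigl => -[i j] /=; rewrite -(inj_eq val_inj) /=; lia.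
rewrite (reindex_inj (h := fun p : 'I_k * 'I_k => (p.2, p.1))) /=; last by move=> [? ?] [? ?] [-> ->].
by apply: eq_big => [[i j]|[i j] _] /=; rewrite 1?hC // -(inj_eq val_inj) /=; lia.
Qed.

(** [h] is symmetric, so its sum over pairs of rows is invariant under permutation of the rows. Each
    term is a lower bound for the corresponding term of [ell], with equality when the window is
    increasing. *)
Lemma increasing_ell u t : valid u -> increasing u -> injective t ->
  (ell u <= ell (u \o t))%N.
Proof.
move=> hu inc tI.
have e1 : ell u = \sum_(p : 'I_k * 'I_k | (p.1 < p.2)%N) h (u p.1) (u p.2).
  apply: eq_bigr => -[i j] /= ij; rewrite /h.
  have := inc _ _ ij => lt; have nij : j != i by apply: contraTneq ij => ->; rewrite ltnn.
  rewrite -[u i - u j]opprB fl_opp ?valid_neq //.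
  have : 0 <= ((u j - u i) %/ k%:Z)%Z by rewrite divz_ge0 //; lia.
  by lia.
have e2 : (\sum_(p : 'I_k * 'I_k | (p.1 < p.2)%N) h ((u \o t) p.1) ((u \o t) p.2)
   <= ell (u \o t))%N.
  by apply: leq_sum => -[i j] _; rewrite /h geq_minr.
apply: leq_trans e2; rewrite e1 -(leq_pmul2l (m := 2)) // -!sum_h.
rewrite [X in (X <= _)%N](reindex_inj (h := fun p : 'I_k * 'I_k => (t p.1, t p.2))) /=.
  by apply: eq_leq; apply: eq_bigl => -[i j] /=; rewrite (inj_eq tI).
by move=> [? ?] [? ?] [/tI -> /tI ->].
Qed.

(** Since a and b are adjacent, the transposition carries every other pair of rows to a pair in the
    same order. *)
Lemma ell_tperm_down u a b : valid u -> b = a.+1 :> nat -> u b < u a ->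
  ell u = (ell (u \o tperm a b)).+1.
Proof.
move=> hu eb lt.
have ab : (a < b)%N by rewrite eb.
have nab : a != b by rewrite -(inj_eq val_inj) neq_ltn ab.
rewrite /ell (bigD1 (a, b)) //= [in RHS](bigD1 (a, b)) //= -addSn.
congr addn.
  rewrite tpermL tpermR -opprB fl_opp //; last by rewrite valid_neq.
  have : 0 <= ((u a - u b) %/ k%:Z)%Z by rewrite divz_ge0 //; lia.
  by lia.
rewrite [LHS](reindex_inj (h := fun p : 'I_k * 'I_k => (tperm a b p.1, tperm a b p.2))) /=.
  apply: eq_big => [[i j]|[i j] _]; last by [].
  rewrite /=; have vi (x y : 'I_k) : (x == y) = (x == y :> nat) by [].
  rewrite !xpair_eqE.
  case: (tpermP a b i) => [->|->|/eqP + /eqP +];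
  case: (tpermP a b j) => [->|->|/eqP + /eqP +]; rewrite ?eqxx ?(negPf nab) !vi; lia.
by move=> [? ?] [? ?] [/perm_inj -> /perm_inj ->].
Qed.

End Length.

(** * Levels of integers relative to a window *)

Section Level.
Variable k' : nat.
Local Notation k := (k'.+2).
Local Notation cong := (cong k').
Local Notation swap := (swap k').
Implicit Types (u : 'I_k -> int) (c x : int) (i a b : 'I_k).

(** If [u i] is congruent to c, then c is [u i] plus k times this number. Comparing the levels of c
    - 1 and c tells ascents from descents; for an increasing window, equality is the adjacent case,
    where [act u c] is no longer increasing. *)
Definition lev u c : int := (winv u c %/ k%:Z)%Z.

Lemma levE u c i : valid u -> cong (u i) c -> u i = c - k%:Z * lev u c.
Proof.
move=> hu hi; have /congP[h e] := hi.
rewrite /lev (winvE hu hi) (@flE k isT (- h)); first by lia.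
  by rewrite e; lia.
by have := ltn_ord i; rewrite e; lia.
Qed.

Lemma lev_row u i h : valid u -> lev u (u i + k%:Z * h) = h.
Proof.
move=> hu; have hc : cong (u i) (u i + k%:Z * h) by apply/congP; exists (- h); lia.
by have := levE hu hc; nia.
Qed.

Lemma lev_swap u c x : valid u -> lev (act u c) x = lev u (swap c x).
Proof. by move=> hu; rewrite /lev winv_act. Qed.

Lemma lev_up u c : valid u -> lev u (c - 1) < lev u c -> ell (act u c) = (ell u).+1.
Proof.
move=> hu lt; apply: ell_up => //.
have [a ha] := row_exists (c - 1) hu; have [b hb] := row_exists c hu.
rewrite (winv_lt hu ha hb) (levE hu ha) (levE hu hb).
have la := ltn_ord a; have lb := ltn_ord b.
by nia.
Qed.

Lemma lev_down u c : valid u -> lev u c < lev u (c - 1) -> ell u = (ell (act u c)).+1.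
Proof.
move=> hu lt; apply: ell_down => //.
have [a ha] := row_exists (c - 1) hu; have [b hb] := row_exists c hu.
rewrite (winv_lt hu ha hb) (levE hu ha) (levE hu hb).
have la := ltn_ord a; have lb := ltn_ord b.
by nia.
Qed.

Lemma lev_increasing u c : valid u -> increasing u -> lev u (c - 1) != lev u c ->
  increasing (act u c).
Proof.
move=> hu inc ne; case: (increasing_act c hu inc) => // -[a [b [_ e ha hb]]].
case/eqP: ne; have := levE hu ha; have := levE hu hb; nia.
Qed.

Lemma lev_adjacent u c : valid u -> increasing u -> lev u (c - 1) = lev u c ->
  ~ increasing (act u c) /\
  exists a b, [/\ b = a.+1 :> nat, u b = u a + 1, cong (u a) (c - 1) & cong (u b) c].
Proof.
move=> hu inc e; have [a ha] := row_exists (c - 1) hu; have [b hb] := row_exists c hu.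
have e1 : u b = u a + 1 by rewrite (levE hu ha) (levE hu hb) e; lia.
have ab : (a < b)%N.
  case: (ltngtP a b) => // [/inc|/val_inj h]; first by lia.
  by move: e1; rewrite h; lia.
have H : ~ increasing (act u c).
  move=> /(_ a b ab); rewrite !(act_rows _ hu ha hb) !eqxx.
  have -> : (a == b) = false by apply/eqP => h; rewrite h ltnn in ab.
  have -> : (b == a) = false by apply/eqP => h; rewrite h ltnn in ab.
  by lia.
by split=> //; case: (increasing_act c hu inc).
Qed.

End Level.

(** * Fundamental points and the fibers of their orbits *)

Section Points.
Variables k' l' : nat.
Local Notation k := (k'.+2).
Local Notation l := (l'.+2).
Local Notation cong := (cong k').
Local Notation swap := (swap k').
Implicit Types (u y : 'I_k -> int) (c x t : int) (i j a b : 'I_k) (P : int -> int).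

(* A point of the closed fundamental alcove, extended by
   [P (x + k) = P x - l]; [P \o u] then runs through its affine orbit. *)
Definition periodic P := forall x, P (x + k%:Z) = P x - l%:Z.
Definition weakly_decreasing P := forall x, P (x + 1) <= P x.
Definition fundamental P := periodic P /\ weakly_decreasing P.

Definition fiber P y u := valid u /\ P \o u = y.
Definition decreasing y := forall i j, (i < j)%N -> y j < y i.

(** For decreasing y this bounds [ell] on the fiber ([fiber_ell]), and [maximal] windows attain it
    ([max_len_floors]). *)
Definition max_len y : nat :=
  \sum_(p : 'I_k * 'I_k | (p.1 < p.2)%N) `|((y p.1 - y p.2) %/ l%:Z)%Z|%N.

(* In the fiber of [y], [u] is then the element attached to the alcove [a^+(y)]. *)
Definition maximal y u :=
  forall i j, (i < j)%N -> ((u j - u i) %/ k%:Z)%Z = ((y i - y j) %/ l%:Z)%Z.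

Lemma fundamental_shift P x h : fundamental P -> P (x + k%:Z * h) = P x - l%:Z * h.
Proof.
move=> [per _]; have nat_h (n : nat) t : P (t + k%:Z * n%:Z) = P t - l%:Z * n%:Z.
  elim: n => [|n IH]; first by rewrite !mulr0 addr0 subr0.
  have -> : t + k%:Z * n.+1%:Z = t + k%:Z * n%:Z + k%:Z by lia.
  by rewrite per IH; lia.
case: (lerP 0 h) => hh; first by have := nat_h `|h|%N x; rewrite gez0_abs.
have := nat_h `|h|%N (x + k%:Z * h); rewrite ltz0_abs //.
have -> : x + k%:Z * h + k%:Z * - h = x by lia.
by lia.
Qed.

Lemma fundamental_le P x t : fundamental P -> x <= t -> P t <= P x.
Proof.
move=> [_ dec] h; have -> : t = x + `|t - x|%N%:Z by lia.
elim: `|t - x|%N => [|n IH]; first by rewrite addr0.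
by apply: le_trans IH; have := dec (x + n%:Z); have -> : x + n%:Z + 1 = x + n.+1%:Z by lia.
Qed.

Lemma fundamental_lt P x t : fundamental P -> P t < P x -> x < t.
Proof. by move=> hP h; rewrite ltNge; apply/negP => /(fundamental_le hP); lia. Qed.

Lemma fiber_row P y u i : fiber P y u -> P (u i) = y i.
Proof. by move=> [_ <-]. Qed.

Lemma fiber_lev P y u x i : fundamental P -> fiber P y u -> cong (u i) x ->
  P x = y i - l%:Z * lev u x.
Proof.
move=> hP hu hi; have e := levE hu.1 hi.
have -> : P x = P (u i + k%:Z * lev u x) by congr P; lia.
by rewrite fundamental_shift // (fiber_row i hu).
Qed.

Lemma decreasing_inj y i j : decreasing y -> y i = y j -> i = j.
Proof. by move=> dy e; case: (ltngtP i j) => [/dy|/dy|/val_inj//]; lia. Qed.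

Lemma fiber_increasing P y u : fundamental P -> decreasing y -> fiber P y u -> increasing u.
Proof.
move=> hP dy hu i j /dy; rewrite -!(fiber_row _ hu); exact: fundamental_lt.
Qed.

Lemma fundamental_swap P c x : fundamental P -> P (c - 1) = P c -> P (swap c x) = P x.
Proof.
move=> hP e; rewrite /swap; case: ifP => [/congP[h ->]|_].
  have -> : c - 1 + k%:Z * h + 1 = c + k%:Z * h by lia.
  by rewrite !fundamental_shift // e.
case: ifP => // /congP[h ->].
have -> : c + k%:Z * h - 1 = (c - 1) + k%:Z * h by lia.
by rewrite !fundamental_shift // e.
Qed.

Lemma fiber_act P y u c : fundamental P -> P (c - 1) = P c -> fiber P y u ->
  fiber P y (act u c).
Proof.
move=> hP e [hu <-]; split; first exact: act_valid.
by apply/funext => i /=; rewrite actE fundamental_swap.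
Qed.

(** The stabilizer of P is generated by the simple reflections c with [P (c - 1) = P c]; the
    condition makes all of them ascents of u, so that u is shortest in its coset. The strict
    inequality also excludes ties, which for increasing u would give [P \o u] a repeated entry. *)
Definition block_minimal P u := forall c, P (c - 1) = P c -> lev u (c - 1) < lev u c.

Lemma block_minimal_lt P u x t : fundamental P -> block_minimal P u ->
  P x = P t -> x < t -> lev u x < lev u t.
Proof.
move=> hP min; have H (n : nat) : P x = P (x + n.+1%:Z) -> lev u x < lev u (x + n.+1%:Z).
  elim: n => [|n IH] e.
    by have := min (x + 1); rewrite addrK; apply.
  have e1 : P (x + n.+1%:Z) = P x.
    apply/eqP; rewrite eq_le fundamental_le //=; last by lia.
    by rewrite e fundamental_le //; lia.
  apply: (lt_trans (IH _)); first by rewrite e1.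
  have ea : x + n.+2%:Z - 1 = x + n.+1%:Z by lia.
  by have := min (x + n.+2%:Z); rewrite ea; apply; rewrite e1.
move=> e lt; have := H `|t - x|.-1; have -> : x + `|t - x|.-1.+1%:Z = t by lia.
exact.
Qed.

Lemma block_minimal_decreasing P u : fundamental P -> valid u -> increasing u ->
  block_minimal P u -> decreasing (P \o u).
Proof.
move=> hP hu inc min i j ij /=; rewrite lt_neqAle fundamental_le ?ltW ?inc // andbT.
apply/eqP => e; have := block_minimal_lt hP min (esym e) (inc _ _ ij).
have := lev_row i 0 hu; have := lev_row j 0 hu.
by rewrite mulr0 !addr0 => -> ->; rewrite ltxx.
Qed.

(** The floors of the differences of such a window can be read off y: positions with different
    values of P are ordered by these values, positions with equal values by their levels. *)
Lemma block_minimal_unique P y u u' : fundamental P -> decreasing y ->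
  fiber P y u -> fiber P y u' -> block_minimal P u -> block_minimal P u' -> u = u'.
Proof.
move=> hP dy hu hu' mu mu'.
have key w i j m : fiber P y w -> block_minimal P w -> (i < j)%N ->
   (m * k%:Z <= w j - w i) = (y j < y i - l%:Z * m) || ((y j == y i - l%:Z * m) && (m < 0)).
  move=> hw mw ij.
  have nd : w j - w i <> m * k%:Z.
    move=> e; have ji : j != i by apply: contraTneq ij => ->; rewrite ltnn.
    by have := valid_neq hw.1 ji; rewrite e dvdz_mull.
  have Pi : P (w i + k%:Z * m) = y i - l%:Z * m by rewrite fundamental_shift // (fiber_row i hw).
  have Pj := fiber_row j hw.
  have li := lev_row i m hw.1; have lj := lev_row j 0 hw.1; rewrite mulr0 addr0 in lj.
  case: (ltgtP (y j) (y i - l%:Z * m)) => /= c.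
  - by rewrite -Pi -Pj in c; have := fundamental_lt hP c; lia.
  - by rewrite -Pi -Pj in c; have := fundamental_lt hP c; lia.
  rewrite -Pi -Pj in c.
  case: (ltgtP (w i + k%:Z * m) (w j)) => d; last by lia.
    by have := block_minimal_lt hP mw (esym c) d; rewrite li lj; lia.
  by have := block_minimal_lt hP mw c d; rewrite li lj; lia.
apply: (floors_inj hu.1 hu'.1) => i j ij.
have [h1 h2] := @fl_bounds k isT (u j - u i).
apply/esym; apply: flE => //.
  by rewrite (key u' i j _ hu' mu' ij) -(key u i j _ hu mu ij).
rewrite ltNge; rewrite ltNge in h2; move: h2.
by rewrite (key u' i j _ hu' mu' ij) -(key u i j _ hu mu ij).
Qed.

(** A tie of levels would make two entries of y equal. These steps inside the fiber end at its block
    minimal window. *)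
Lemma fiber_descend P y u : fundamental P -> decreasing y -> fiber P y u ->
  ~ block_minimal P u ->
  exists c, [/\ P (c - 1) = P c, fiber P y (act u c), lev u c < lev u (c - 1) &
    ell u = (ell (act u c)).+1].
Proof.
move=> hP dy hu nm; apply: contrapT => H; apply: nm => c e.
have hc := fiber_act hP e hu.
have [a ha] := row_exists (c - 1) hu.1; have [b hb] := row_exists c hu.1.
case: (ltgtP (lev u (c - 1)) (lev u c)) => // d.
  by case: H; exists c; split=> //; apply: lev_down => //; case: hu.
have ab : a = b.
  apply: (decreasing_inj dy).
  have := fiber_lev hP hu ha; have := fiber_lev hP hu hb; rewrite -e d; lia.
have := levE hu.1 ha; have := levE hu.1 hb; rewrite ab d; lia.
Qed.

(** P falls by l over each period k, so every full period between [u i] and [u j] accounts for a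
    full l between [y j] and [y i]. *)
Lemma fiber_floor P y u i j : fundamental P -> decreasing y -> fiber P y u ->
  (i < j)%N -> 0 <= ((u j - u i) %/ k%:Z)%Z <= ((y i - y j) %/ l%:Z)%Z.
Proof.
move=> hP dy hu ij; have inc := fiber_increasing hP dy hu ij.
apply/andP; split; first by rewrite divz_ge0 //; lia.
rewrite fl_le // -!(fiber_row _ hu).
have [h1 h2] := @fl_bounds k isT (u j - u i); set m := (_ %/ _)%Z in h1 h2 *.
have : P (u j) <= P (u i + k%:Z * m) by apply: fundamental_le => //; lia.
by rewrite fundamental_shift //; lia.
Qed.

Lemma fiber_ell P y u : fundamental P -> decreasing y -> fiber P y u ->
  (ell u <= max_len y)%N.
Proof.
move=> hP dy hu; apply: leq_sum => -[i j] /= ij.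
by have := fiber_floor hP dy hu ij; lia.
Qed.

Lemma fiber_ell_eq P y u : fundamental P -> decreasing y -> fiber P y u ->
  ell u = max_len y ->
  maximal y u.
Proof.
move=> hP dy hu e i j ij; have h0 := fiber_floor hP dy hu ij.
suff : `|((u j - u i) %/ k%:Z)%Z|%N = `|((y i - y j) %/ l%:Z)%Z|%N by lia.
move: e; rewrite /ell /max_len (bigD1 (i, j)) //= [X in _ = X](bigD1 (i, j)) //=.
set A := (\sum_(_ | _) _)%N; set B := (X in _ = (_ + X)%N).
have : (A <= B)%N.
  apply: leq_sum => -[i' j'] /= /andP[ij' _].
  by have := fiber_floor hP dy hu ij'; lia.
by lia.
Qed.

Lemma max_len_floors y u : decreasing y ->
  maximal y u ->
  ell u = max_len y.
Proof. by move=> dy e; apply: eq_bigr => -[i j] /= ij; rewrite e. Qed.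

(** [sum_floor] locates x by the floors of its distances to the window, and P turns these into
    floors of distances from t to y. The right-hand side depends on y alone, so y determines P: an
    orbit meets the closed fundamental alcove once. *)
Lemma fiber_threshold P y u x t : fundamental P -> fiber P y u ->
  (t < P x) = (x < - \sum_i ((t - y i) %/ l%:Z)%Z).
Proof.
move=> hP hu; apply/idP/idP => h.
  have := sum_floor (x + 1) hu.1 => e.
  suff : \sum_i ((t - y i) %/ l%:Z)%Z <= \sum_j ((u j - (x + 1)) %/ k%:Z)%Z by lia.
  apply: ler_sum => i _; rewrite fl_le //.
  have [h1 h2] := @fl_bounds l isT (t - y i); set m := (_ %/ _)%Z in h1 h2 *.
  have : P (u i + k%:Z * - m) < P x by rewrite fundamental_shift // (fiber_row i hu); lia.
  by move=> /(fundamental_lt hP); lia.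
apply: contraTT h; rewrite -!leNgt => h.
have := sum_floor x hu.1 => e.
suff : \sum_j ((u j - x) %/ k%:Z)%Z <= \sum_i ((t - y i) %/ l%:Z)%Z by lia.
apply: ler_sum => i _; rewrite fl_le //.
have [h1 h2] := @fl_bounds k isT (u i - x); set m := (_ %/ _)%Z in h1 h2 *.
have : P (u i + k%:Z * - m) <= P x by apply: fundamental_le => //; lia.
by rewrite fundamental_shift // (fiber_row i hu); lia.
Qed.

Lemma fiber_unique P P' y u u' : fundamental P -> fundamental P' ->
  fiber P y u -> fiber P' y u' -> P = P'.
Proof.
move=> hP hP' hu hu'; apply/funext => x.
have H t : (t < P x) = (t < P' x).
  by rewrite (fiber_threshold _ _ hP hu) (fiber_threshold _ _ hP' hu').
by have := H (P x); have := H (P' x); rewrite !ltxx; lia.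
Qed.

End Points.

(** * Standardization of a regular integer point *)

Section Standardization.
Variable k' : nat.
Local Notation k := (k'.+2).
Variables (L : nat) (z : 'I_k -> int).
Hypothesis L0 : (0 < L)%N.
Hypothesis zL : forall i j, (L%:Z %| z i - z j)%Z -> i = j.

(** The rank of [z i], in decreasing order, among all translates of the entries of z by multiples of
    L. The formula is [sum_floor] at [n = u i], with the floors of the window replaced by those of
    z. *)
Definition standardization (i : 'I_k) : int := - \sum_j ((z i - z j) %/ L%:Z)%Z.

Local Notation u := standardization.

Lemma standardization_lt i j h h' :
  z j - h' * L%:Z < z i - h * L%:Z -> u i + k%:Z * h < u j + k%:Z * h'.
Proof.
have e (a : 'I_k) m : u a + k%:Z * m = - \sum_b ((z a - m * L%:Z - z b) %/ L%:Z)%Z.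
  have eb b : ((z a - m * L%:Z - z b) %/ L%:Z)%Z = ((z a - z b) %/ L%:Z)%Z - m.
    have -> : z a - m * L%:Z - z b = (- m) * L%:Z + (z a - z b) by lia.
    by rewrite divzMDl; [lia|lia].
  under eq_bigr do rewrite eb.
  rewrite sumrB sumr_const card_ord -mulr_natl natz /u /standardization.
  by rewrite opprB addrC.
move=> lt; rewrite !e ltrN2 (bigD1 i) //= [X in _ < X](bigD1 i) //=.
apply: ltr_leD.
  have -> : z i - h * L%:Z - z i = - h * L%:Z by lia.
  by rewrite mulzK //; [rewrite fl_lt //; lia|lia].
apply: ler_sum => b _; rewrite fl_le //.
by have [h1 h2] := fl_bounds L0 (z j - h' * L%:Z - z b); lia.
Qed.

(** The value depends on k alone. Applied to z and to the identity window, it shows that the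
    standardization has the sum required by [valid]. *)
Lemma sum_antisym (f : 'I_k -> 'I_k -> int) :
  (forall i j, i != j -> f i j + f j i = - 1) -> (forall i, f i i = 0) ->
  2 * \sum_i \sum_j f i j =
  \sum_(i < k) \sum_(j < k | i != j) (- 1).
Proof.
move=> h1 h0; rewrite mulr_natl mulr2n [X in X + _]exchange_big -big_split /=.
apply: eq_bigr => i _; rewrite -big_split /= [RHS]big_mkcond /=; apply: eq_bigr => j _.
case: eqP => [<-|/eqP ij]; first by rewrite h0.
by rewrite addrC h1.
Qed.

Lemma valid_standardization : valid u.
Proof.
split=> [i j /congP[h e]|].
  apply: zL; case: (ltgtP (z i - 0 * L%:Z) (z j - h * L%:Z)) => d.
  - by have := standardization_lt d; lia.
  - by have := standardization_lt d; lia.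
  by apply/dvdzP; exists (- h); lia.
apply/eqP; rewrite -(inj_eq (mulfI (_ : 2 != 0 :> int))) //.
have -> : \sum_i u i = - \sum_i \sum_j ((z i - z j) %/ L%:Z)%Z by rewrite sumrN.
have -> : \sum_(i < k) i%:Z = - \sum_(i < k) \sum_(j < k) ((i%:Z - j%:Z) %/ k%:Z)%Z.
  rewrite exchange_big -sumrN; apply: eq_bigr => i _.
  by rewrite (sum_floor i (valid_id k')) opprK.
rewrite !mulrN !sum_antisym // => [i j ij|i|i j ij|i].
- rewrite -opprB addrC fl_opp //; first by lia.
  by have := valid_neq (valid_id k') ij; rewrite /id_perm -rpredN opprB.
- by rewrite subrr.
- rewrite -opprB addrC fl_opp //; first by lia.
  by apply: contraNN ij => d; rewrite (zL (i := i) (j := j)) // -opprB rpredN.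
by rewrite subrr div0z.
Qed.

End Standardization.

(** * Existence of the longest window over a decreasing point *)

Section MaximalPoint.
Variables k' l' : nat.
Local Notation k := (k'.+2).
Local Notation l := (l'.+2).
Variable y : 'I_k -> int.

(* Moving the point in the direction of rho makes it regular and keeps it on
   the positive side of the hyperplanes containing it. *)
Let z (i : 'I_k) : int := k%:Z * y i - i%:Z.
Let L := (k * l)%N.

Let zL i j : (L%:Z %| z i - z j)%Z -> i = j.
Proof.
move=> /dvdzP[h e]; apply: (@cong_ord k'); apply/congP; exists (y i - y j - h * l%:Z).
by move: e; rewrite /z /L; lia.
Qed.

Let u := standardization L z.
Let hu : valid u := valid_standardization (ltn0Sn _ : (0 < L)%N) zL.

Let P (x : int) : int :=
  let i := xchoose (row_exists x hu) in y i - l%:Z * lev u x.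

Let PE i h : P (u i + k%:Z * h) = y i - l%:Z * h.
Proof.
rewrite /P; set i' := xchoose _; have hi' : cong k' (u i') (u i + k%:Z * h) := xchooseP (row_exists (u i + k%:Z * h) hu).
rewrite lev_row //; suff -> : i' = i by [].
apply: hu.1; apply: (cong_trans hi'); apply/congP; exists h; lia.
Qed.

Lemma exists_maximal_fiber : decreasing y ->
  exists P u, [/\ fundamental k' l' P, fiber P y u &
   maximal l' y u].
Proof.
move=> dy; exists P, u; split.
- have rep x : exists i h, x = u i + k%:Z * h.
    have [i hi] := row_exists x hu; exists i, (lev u x).
    by have := levE hu hi; lia.
  split=> x.
    have [i [h ->]] := rep x; have -> : u i + k%:Z * h + k%:Z = u i + k%:Z * (h + 1) by lia.
    by rewrite !PE; lia.
  have [i [h e]] := rep x; have [j [h' e']] := rep (x + 1).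
  rewrite e' e !PE leNgt; apply/negP => lt.
  suff : u j + k%:Z * h' < u i + k%:Z * h by lia.
  apply: standardization_lt => //.
  have li := ltn_ord i; have lj := ltn_ord j.
  (* The values are integers, so a strict inequality between them gains k, more than the
     perturbation by row numbers in z can undo. *)
  have : k%:Z * (y i - l%:Z * h + 1) <= k%:Z * (y j - l%:Z * h') by rewrite ler_pM2l //; lia.
  by rewrite /z /L; lia.
- split=> //; apply/funext => i /=.
  by have := PE i 0; rewrite !mulr0 addr0 subr0.
move=> i j ij; have li := ltn_ord i; have lj := ltn_ord j.
have [h1 h2] := @fl_bounds l isT (y i - y j); set m := (_ %/ _)%Z in h1 h2 *.
apply: flE => //.
  suff : u i + k%:Z * m < u j + k%:Z * 0 by lia.
  apply: standardization_lt => //; rewrite /z /L.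
  have : k%:Z * (m * l%:Z) <= k%:Z * (y i - y j) by rewrite ler_pM2l.
  by lia.
suff : u j + k%:Z * 0 < u i + k%:Z * (m + 1) by lia.
apply: standardization_lt => //; rewrite /z /L.
have : k%:Z * (y i - y j + 1) <= k%:Z * ((m + 1) * l%:Z) by rewrite ler_pM2l //; lia.
by lia.
Qed.

End MaximalPoint.

(** * The affine Weyl group acting by reindexing *)

Section AffineMaps.
Variables (R : realType) (k' l' : nat).
Local Notation k := (k'.+2).
Local Notation l := (l'.+2).
Local Notation V := 'rV[R]_k.
Local Notation cong := (cong k').
Local Notation swap := (swap k').
Local Notation id_perm := (@id_perm k').
Implicit Types (x : V) (u : 'I_k -> int) (i j a b : 'I_k) (c n m h : int).

(* [x (i + k) = x i - l], so that the affine Weyl group acts by reindexing *)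
Definition ext x n : R := x ord0 (ordmod k' n) - (l%:Z * (n %/ k%:Z)%Z)%:~R.

Lemma extE x i h : ext x (i%:Z + k%:Z * h) = x ord0 i - (l%:Z * h)%:~R.
Proof.
have li := ltn_ord i; rewrite /ext (@flE k isT h) //; [|lia|lia].
suff -> : ordmod k' (i%:Z + k%:Z * h) = i by [].
apply: (@cong_ord k'); rewrite ordmodE; apply/congP.
exists (h - ((i%:Z + k%:Z * h) %/ k%:Z)%Z).
by have := divz_eq (i%:Z + k%:Z * h) k%:Z; lia.
Qed.

Lemma ext_ord x i : ext x i%:Z = x ord0 i.
Proof. by have := extE x i 0; rewrite !mulr0 addr0 subr0. Qed.

Lemma int_ord n : exists i h, n = i%:Z + k%:Z * h.
Proof.
exists (ordmod k' n), (n %/ k%:Z)%Z; rewrite ordmodE.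
by have := divz_eq n k%:Z; lia.
Qed.

Lemma ext_shift x n h : ext x (n + k%:Z * h) = ext x n - (l%:Z * h)%:~R.
Proof.
have [i [h' ->]] := int_ord n; rewrite -addrA -mulrDr !extE mulrDr intrD opprD.
by rewrite addrA.
Qed.

Definition aff u x : V := \row_i ext x (u i).

Lemma comp_idr (f : V -> V) : f \o id = f. Proof. by []. Qed.

Lemma aff_id : aff id_perm = id.
Proof. by apply/funext => x; apply/rowP => i; rewrite mxE ext_ord. Qed.

(** Its extension to the integers is linear and strictly decreasing, so comparing coordinates of its
    images compares integers: the image of this point determines the window. *)
Definition barycenter : V := \row_i (- (l%:R * i%:R / k%:R)).

Lemma ext_barycenter n : ext barycenter n = - (l%:R * n%:~R / k%:R).
Proof.
have [i [h ->]] := int_ord n; rewrite extE mxE -opprD; congr (- _).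
rewrite intrD mulrDr mulrDl; congr (_ + _).
by rewrite !intrM mulrCA mulrAC mulfV ?mul1r // pnatr_eq0.
Qed.

Lemma ext_barycenter_lt n n' : (ext barycenter n < ext barycenter n') = (n' < n).
Proof.
rewrite !ext_barycenter ltrN2 ltr_pM2r ?invr_gt0 ?ltr0n //.
by rewrite ltr_pM2l ?ltr0n // ltr_int.
Qed.

Lemma aff_inj : injective aff.
Proof.
move=> u u' /(congr1 (fun f => f barycenter)) /rowP e; apply/funext => i.
have := e i; rewrite !mxE => {}e.
have := ext_barycenter_lt (u i) (u' i); have := ext_barycenter_lt (u' i) (u i).
by rewrite e !ltxx; lia.
Qed.

Definition simple_refl c : V -> V := aff (act id_perm c).

Lemma ext_simple_refl c x n : ext (simple_refl c x) n = ext x (swap c n).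
Proof.
have [i [h ->]] := int_ord n.
by rewrite swap_shift !ext_shift ext_ord mxE actE.
Qed.

Lemma aff_comp_simple u c : aff u \o simple_refl c = aff (act u c).
Proof. by apply/funext => x; apply/rowP => i; rewrite !mxE ext_simple_refl. Qed.

Lemma simple_reflK c : simple_refl c \o simple_refl c = id.
Proof. by rewrite aff_comp_simple actK aff_id. Qed.

Lemma simple_refl_comp_aff u a b : b = a.+1 :> nat ->
  simple_refl b%:Z \o aff u = aff (u \o tperm a b).
Proof.
move=> e; apply/funext => x; apply/rowP => i; rewrite !mxE.
have ha : cong (id_perm a) (b%:Z - 1) by rewrite /id_perm e; apply/congP; exists 0; lia.
have hb : cong (id_perm b) b%:Z by rewrite cong_refl.
rewrite (adjacent_act (valid_id k') _ ha hb); last by rewrite /id_perm e; lia.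
by rewrite /= /id_perm ext_ord mxE.
Qed.

Definition refl_perm u i j m i' : int :=
  if i' == i then u j - k%:Z * m else if i' == j then u i + k%:Z * m else u i'.

Lemma reflection_aff u i j m : (i < j)%N ->
  reflection l i j m \o aff u = aff (refl_perm u i j m).
Proof.
move=> ij; have ne : i != j by apply: contraTneq ij => ->; rewrite ltnn.
apply/funext => x; apply/rowP => i'; rewrite /= /reflection !mxE /refl_perm eqxx /=.
have e1 : (m * l%:Z)%:~R = (l%:Z * m)%:~R :> R by rewrite mulrC.
case: (eqVneq i' i) => [->|ni]; first by rewrite /= (negPf ne) -[- (k%:Z * m)]mulrN ext_shift subr0 mulr1 mulrN rmorphN /= opprK -[ext x (u i) - _ - _]addrA -opprD subKr e1.
case: (eqVneq i' j) => [->|nj]; last by rewrite subrr mulr0 subr0.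
by rewrite ext_shift sub0r mulrN1 opprK e1 addrA addrCA subrr addr0.
Qed.

Lemma refl_perm_valid u i j m : (i < j)%N -> valid u -> valid (refl_perm u i j m).
Proof.
move=> ij hu; have ne : j != i by apply: contraTneq ij => ->; rewrite ltnn.
have c a : cong (refl_perm u i j m a) (u (tperm i j a)).
  rewrite /refl_perm; case: tpermP => [->|->|/eqP/negPf -> /eqP/negPf ->]; rewrite ?eqxx ?(negPf ne).
  - by apply/congP; exists (- m); lia.
  - by apply/congP; exists m; lia.
  exact: cong_refl.
split=> [a b|].
  by rewrite (congr_cong (c a) (c b)) => /hu.1 /perm_inj.
rewrite -hu.2 (bigD1 i) // (bigD1 j) //= [RHS](bigD1 i) // [X in _ = _ + X](bigD1 j) //=.
rewrite /refl_perm !eqxx (negPf ne); set A := \sum_(_ | _) _; set B := \sum_(_ | _) _.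
suff -> : A = B by lia.
by apply: eq_bigr => a /andP[/negPf -> /negPf ->].
Qed.

Lemma simple_refl_cong c c' : cong c c' -> simple_refl c = simple_refl c'.
Proof. by move=> h; rewrite /simple_refl (act_cong _ h). Qed.

Lemma simple_refl_pos a b : b = a.+1 :> nat -> simple_refl b%:Z = reflection l a b 0.
Proof.
move=> e; rewrite -[simple_refl _]comp_idr -aff_id (simple_refl_comp_aff _ e).
rewrite -[RHS]comp_idr -aff_id reflection_aff ?e //; congr aff; apply/funext => i.
rewrite /refl_perm /= mulr0 subr0 addr0.
by case: tpermP => [->|->|/eqP/negPf -> /eqP/negPf ->]; rewrite ?eqxx //; case: eqP => [->|].
Qed.

Lemma simple_refl_0 : simple_refl 0 = reflection l ord0 ord_max 1.
Proof.
rewrite -[RHS]comp_idr -aff_id reflection_aff //; congr aff; apply/funext => i.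
have ha : cong (id_perm ord_max) (0 - 1) by rewrite /id_perm; apply/congP; exists 1; rewrite /=; lia.
have hb : cong (id_perm ord0) 0 by rewrite cong_refl.
rewrite (act_rows _ (valid_id k') ha hb) /refl_perm /id_perm.
case: (eqVneq i ord0) => [->|ni].
  have -> : (ord0 == ord_max :> 'I_k) = false by [].
  by rewrite /=; lia.
by case: (eqVneq i ord_max) => [->|nm] /=; lia.
Qed.

Lemma simple_refl_cases c : simple_refl c = reflection l ord0 ord_max 1 \/
  exists a b, [/\ b = a.+1 :> nat, simple_refl c = simple_refl b%:Z &
     simple_refl b%:Z = reflection l a b 0].
Proof.
have [b [h e]] := int_ord c.
have cb : cong c b%:Z by apply/congP; exists h.
case: (posnP b) => b0.
  left; rewrite (simple_refl_cong cb) -simple_refl_0; congr simple_refl.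
  by rewrite b0.
have lt : (b.-1 < k)%N by have := ltn_ord b; lia.
right; exists (Ordinal lt), b; rewrite (simple_refl_cong cb) /= prednK //; split=> //.
by apply: simple_refl_pos; rewrite /= prednK.
Qed.

Lemma simple_refl_reflections c : reflections l (simple_refl c).
Proof.
case: (simple_refl_cases c) => [->|[a [b [e -> ->]]]]; first by exists ord0, ord_max, 1.
by exists a, b, 0; rewrite e.
Qed.

Lemma prod_word_cat (s s' : seq (V -> V)) : prod_word (s ++ s') = prod_word s \o prod_word s'.
Proof. by elim: s => //= t s ->. Qed.

Lemma affW_aff w : affW l w -> exists2 u, valid u & w = aff u.
Proof.
move=> [s hs <-]; elim: s hs => [|t s IH] hs.
  by exists id_perm; [exact: valid_id | rewrite aff_id].
have [u hu e] : exists2 u, valid u & prod_word s = aff u.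
  by apply: IH => t' ht'; apply: hs; rewrite inE ht' orbT.
have [i [j [m [ij et]]]] : reflections l t by apply: hs; rewrite inE eqxx.
exists (refl_perm u i j m); first exact: refl_perm_valid.
by rewrite -reflection_aff // -e -et.
Qed.

Definition simple_word (cs : seq int) := [seq simple_refl c | c <- cs].

Lemma aff_word u : valid u -> exists cs, prod_word (simple_word cs) = aff u /\ size cs = ell u.
Proof.
move: {2}(ell u) (erefl (ell u)) => n; elim: n u => [|n IH] u en hu.
  case: (pselect (u = id_perm)) => [->|/(exists_descent hu)[c hc]].
    by exists [::]; rewrite aff_id ell_id.
  by move: (@ell_down _ u c hu); rewrite en => /(_ ltac:(lia)).
case: (pselect (u = id_perm)) => [e|/(exists_descent hu)[c hc]].
  by move: en; rewrite e ell_id.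
have e1 := @ell_down _ u c hu ltac:(lia).
have [|cs [e2 e3]] := IH (act u c) _ (act_valid c hu); first by lia.
exists (rcons cs c); split; last by rewrite size_rcons e3 e1.
rewrite -cats1 /simple_word map_cat prod_word_cat /= e2.
by rewrite comp_idr aff_comp_simple actK.
Qed.

Lemma aff_affW u : valid u -> affW l (aff u).
Proof.
move=> /aff_word[cs [<- _]]; exists (simple_word cs) => // t /mapP[c _ ->].
exact: simple_refl_reflections.
Qed.

Lemma word_aff cs : exists u, [/\ valid u, prod_word (simple_word cs) = aff u & (ell u <= size cs)%N].
Proof.
elim/last_ind: cs => [|cs c [u [hu e le]]].
  by exists id_perm; rewrite aff_id ell_id; split=> //; exact: valid_id.
exists (act u c); split; first exact: act_valid.
  by rewrite -cats1 /simple_word map_cat prod_word_cat /= -/(simple_word cs) e comp_idr aff_comp_simple.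
rewrite size_rcons; case: (boolP (winv u (c - 1) < winv u c)) => h.
  by rewrite ell_up.
by have := ell_down hu h; lia.
Qed.

End AffineMaps.

(** * Walls, simple reflections and minimal coset representatives *)

Section CoxeterGroup.
Variables (R : realType) (k' l' : nat).
Local Notation k := (k'.+2).
Local Notation l := (l'.+2).
Local Notation V := 'rV[R]_k.
Local Notation aff := (@aff R k' l').
Local Notation simple_refl := (@simple_refl R k' l').
Implicit Types (x y z : V) (w : V -> V) (u : 'I_k -> int) (i j a b : 'I_k) (c n m h : int) (C : set V).

Lemma closure_segment C y z :
  (forall t : R, 0 < t -> t <= 1 -> C (y + t *: (z - y))) -> closure C y.
Proof.
move=> H U nU.
have cv : (fun t : R => y + t *: (z - y)) @ (0 : R)^'+ --> y.
  rewrite -[X in _ --> X]addr0 -[X in _ --> y + X](scale0r (z - y)).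
  apply: cvgD; first exact: cvg_cst.
  apply: cvgZr_tmp; apply: cvg_within_filter; exact: cvg_id.
have h1 : \forall t \near (0 : R)^'+, U (y + t *: (z - y)) by exact: cv.
have h2 : \forall t \near (0 : R)^'+, 0 < t <= 1.
  near=> t; apply/andP; split; first by near: t; exact: nbhs_right_gt.
  by near: t; apply: nbhs_right_le.
have [t [ht /andP[t0 t1]]] := filter_ex (filterI h1 h2).
by exists (y + t *: (z - y)); split=> //; apply: H.
Unshelve. all: by end_near. Qed.

Lemma coord_diff_continuous i j : continuous (fun x : V => x ord0 i - x ord0 j).
Proof.
move=> x; apply: (@continuousB R R^o _ (fun M : V => M ord0 i : R^o) (fun M : V => M ord0 j : R^o) x);
exact: coord_continuous.
Qed.

Lemma closure_ge C i j (s : R) : (forall x, C x -> s <= x ord0 i - x ord0 j) ->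
  forall x, closure C x -> s <= x ord0 i - x ord0 j.
Proof.
move=> H x; have cl : closed [set x : V | s <= x ord0 i - x ord0 j].
  apply: (@preimage_closed V R^o (fun x : V => x ord0 i - x ord0 j) [set t | s <= t]).
    by move=> ? _; exact: coord_diff_continuous.
  exact: closed_ge.
by move=> hx; apply: cl; move: x hx; apply: closure_subset.
Qed.

Local Notation F := (@fundamental_alcove R k l).
Local Notation z0 := (barycenter R k' l').

Lemma segment_gt (s t : R) y z i j : 0 < t -> t <= 1 ->
  s <= y ord0 i - y ord0 j -> s < z ord0 i - z ord0 j ->
  s < (y + t *: (z - y)) ord0 i - (y + t *: (z - y)) ord0 j.
Proof.
move=> t0 t1; rewrite !mxE.
set a := y ord0 i; set b := y ord0 j; set c := z ord0 i; set d := z ord0 j.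
move=> h1 h2.
have -> : a + t * (c - a) - (b + t * (d - b)) = (1 - t) * (a - b) + t * (c - d).
  rewrite opprD addrACA mulrBl mul1r -mulrBr -[RHS]addrA; congr (_ + _).
  rewrite addrC -mulrBr; congr (_ * _).
  by rewrite !opprB addrACA [RHS]addrACA [- a - d]addrC.
have -> : s = (1 - t) * s + t * s by rewrite -mulrDl subrK mul1r.
apply: ler_ltD; last by rewrite ltr_pM2l.
by apply: ler_wpM2l => //; rewrite subr_ge0.
Qed.

Lemma fundamental_alcoveP x : F x <->
  (forall i j, (i < j)%N -> x ord0 j < x ord0 i) /\ x ord0 ord0 - x ord0 ord_max < l%:R.
Proof.
split=> [[h1 h2]|[h1 h2]]; split=> //; first exact: h2.
move=> i j i0 jk; have -> : i = ord0 by exact: val_inj.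
by have -> : j = ord_max by exact: val_inj.
Qed.

Lemma barycenter_fundamental : F z0.
Proof.
apply/fundamental_alcoveP; split=> [i j ij|].
  by rewrite -!(ext_ord l') ext_barycenter_lt ltz_nat.
have := ext_barycenter_lt R k' l' ((@nat_of_ord k ord0)%:Z + k%:Z * 1) (@nat_of_ord k ord_max)%:Z.
rewrite extE ext_ord mulr1 ltrBlDr => h.
by rewrite ltrBlDr addrC h /=; lia.
Qed.

(** Evaluating the extended barycenter at weakly increasing positions of spread at most k gives a
    point of the closure. The hyperplanes through it are the coincidences of f up to multiples of k,
    and the hypothesis leaves exactly one. *)
Lemma wall_point (f : 'I_k -> int) i j m : (i < j)%N ->
  (forall a b, (a < b)%N -> f a <= f b) -> f ord_max <= f ord0 + k%:Z ->
  (forall a b n, (a < b)%N -> f a = f b - k%:Z * n <-> (a, b, n) = (i, j, m)) ->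
  wall l F i j m.
Proof.
move=> ij mono range hf; pose y : V := \row_a ext l' z0 (f a).
have le n n' : (ext l' z0 n <= ext l' z0 n') = (n' <= n) by rewrite leNgt ext_barycenter_lt leNgt.
have [F1 F2] := (fundamental_alcoveP z0).1 barycenter_fundamental.
exists y.
  apply: (@closure_segment F y z0) => t t0 t1; apply/fundamental_alcoveP; split=> [a b ab|].
    rewrite -subr_gt0; apply: segment_gt => //; last by rewrite subr_gt0 F1.
    by rewrite subr_ge0 !mxE le mono.
  rewrite -ltrN2 opprB; apply: segment_gt => //; last by rewrite ltrNl opprB.
  rewrite lerNl opprB !mxE lerBlDl.
  have -> : l%:R = - (l%:Z * - 1)%:~R :> R by rewrite mulrN1 rmorphN /= opprK.
  by rewrite -ext_shift le; lia.
move=> a b n ab; rewrite -hf // /hyperplane /= !mxE.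
have e : ext l' z0 (f b - k%:Z * n) = ext l' z0 (f b) + (n * l%:Z)%:~R.
  by rewrite -[- (k%:Z * n)]mulrN ext_shift mulrN rmorphN opprK mulrC.
split=> [h|h]; last by rewrite h e addrAC subrr add0r.
have h1 : ext l' z0 (f a) = ext l' z0 (f b - k%:Z * n) by rewrite e addrC -h subrK.
by have := le (f a) (f b - k%:Z * n); have := le (f b - k%:Z * n) (f a); rewrite h1 lexx; lia.
Qed.

Lemma closure_fundamental x : closure F x ->
  (forall i j, (i < j)%N -> 0 <= x ord0 i - x ord0 j) /\ x ord0 ord0 - x ord0 ord_max <= l%:R.
Proof.
move=> hx; split=> [i j ij|].
  by move: x hx; apply: closure_ge => x /fundamental_alcoveP[h _]; rewrite subr_ge0 ltW // h.
rewrite -lerN2 opprB; move: x hx; apply: closure_ge => x /fundamental_alcoveP[_ h].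
by rewrite lerNl opprB ltW.
Qed.

(** For the direct implication, let x be a point of the closure lying on one hyperplane. Then m is 0
    or 1, and monotonicity of the coordinates puts x on the hyperplane of two consecutive
    coordinates, or of the extreme ones with m = 1; this must be the given hyperplane. *)
Lemma simpleP t : simple l t <-> exists c, t = simple_refl c.
Proof.
split=> [[i [j [m [ij [x clx hx] ->]]]]|[c ->]]; last first.
  case: (simple_refl_cases R k' l' c) => [e|[a [b [eb e e']]]].
    exists ord0, ord_max, 1; split=> //.
    (* The last coordinate is moved to position k, one period after the first. *)
    apply: (@wall_point (fun i => if i == ord_max then k%:Z else i%:Z)) => [//|a b ab||a b n ab].
    - have := ltn_ord b; case: eqP => [ea|_]; first by move: ab; rewrite ea /=; lia.
      by case: eqP => _; lia.
    - by rewrite eqxx.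
    have la := ltn_ord a; have lb := ltn_ord b.
    have -> : (a == ord_max) = false by apply/eqP => h; rewrite h /= in ab; lia.
    split=> [|[-> -> ->]]; last by rewrite eqxx /=; lia.
    case: eqP => [->|ne] h; last by (have n0 : n = 0 by nia); move: h; rewrite n0; lia.
    have n1 : n = 1 by nia.
    rewrite n1 in h *; suff -> : a = ord0 by [].
    by apply: val_inj; rewrite /=; lia.
  exists a, b, 0; rewrite e e' eb; split=> //.
  (* All positions from b on are moved back by one, so that rows a and b coincide. *)
  apply: (@wall_point (fun i => i%:Z - (b <= i)%N%:Z)) => [|a' b' ab|/=|a' b' n ab]; rewrite ?eb //; try lia.
  have la := ltn_ord a'; have lb := ltn_ord b'; have la1 := ltn_ord a; have lb1 := ltn_ord b.
  split=> [h|[-> -> ->]]; last by rewrite eb; lia.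
  have n0 : n = 0 by nia.
  rewrite n0 in h *; have h1 : a' = a :> nat by lia.
  have h2 : b' = b :> nat by lia.
  by rewrite (val_inj h1) (val_inj h2).
have [h1 h2] := closure_fundamental clx.
have hij : hyperplane l i j m x by apply/hx.
have ge0 a b : (a <= b)%N -> x ord0 b <= x ord0 a.
  by rewrite leq_eqVlt => /orP[/eqP/val_inj->//|/h1]; rewrite subr_ge0.
have m0 : 0 <= m.
  by have := h1 _ _ ij; rewrite hij -[0](mulr0z 1) ler_int; nia.
have le_l : x ord0 i - x ord0 j <= x ord0 ord0 - x ord0 ord_max.
  by apply: lerB; apply: ge0 => //; rewrite -ltnS ltn_ord.
have m1 : m <= 1.
  have : (m * l%:Z)%:~R <= (l%:Z)%:~R :> R by rewrite -hij; apply: le_trans h2.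
  by rewrite ler_int; nia.
have [e|e] : m = 0 \/ m = 1 by lia.
  have lt : (i.+1 < k)%N by apply: leq_ltn_trans (ltn_ord j).
  exists (Ordinal lt)%:Z; rewrite (@simple_refl_pos R k' l' i (Ordinal lt)) //.
  have hp : hyperplane l i (Ordinal lt) 0 x.
    rewrite /hyperplane /= mul0r; apply/eqP; rewrite eq_le subr_ge0 ge0 //= andbT.
    rewrite -[X in _ <= X](_ : x ord0 i - x ord0 j = 0); last by rewrite hij e mul0r.
    by rewrite lerD2l lerN2 ge0.
  by have /= [<- <-] := (hx _ _ _ (ltnSn _ : (i < Ordinal lt)%N)).1 hp.
exists 0; rewrite simple_refl_0.
have hp : hyperplane l ord0 ord_max 1 x.
  apply/eqP; rewrite eq_le mul1r h2 /=.
  by rewrite (le_trans _ le_l) // hij e mul1r.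
by have [<- <- <-] := (hx ord0 ord_max 1 isT).1 hp.
Qed.

Lemma simple0P t : simple0 l t <-> exists a b, b = a.+1 :> nat /\ t = simple_refl b%:Z.
Proof.
split=> [[/simpleP[c ->]]|[a [b [e ->]]]].
  case: (simple_refl_cases R k' l' c) => [e|[a [b [eb e _]]]]; last by exists a, b.
  rewrite e => /rowP /(_ ord0); rewrite !mxE /= !subr0 mulr1 !sub0r opprK.
  by rewrite mul1r => /eqP; rewrite intr_eq0.
split; first by apply/simpleP; exists b%:Z.
rewrite (@simple_refl_pos R k' l' a b e); apply/rowP => i; rewrite !mxE mul0r !subr0 mul0r.
by rewrite subr0.
Qed.

Lemma simple_words s : words (simple l) s -> exists cs, s = simple_word R k' l' cs.
Proof.
elim: s => [|t s IH] hs; first by exists [::].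
have [|cs ->] := IH; first by move=> t' ht'; apply: hs; rewrite inE ht' orbT.
have /simpleP[c ->] : simple l t by apply: hs; rewrite inE eqxx.
by exists (c :: cs).
Qed.

Lemma words_simple cs : words (simple l) (simple_word R k' l' cs).
Proof. by move=> t /mapP[c _ ->]; apply/simpleP; exists c. Qed.

Lemma reduced_aff cs u : valid u -> prod_word (simple_word R k' l' cs) = aff u ->
  size cs = ell u -> reduced_word l (simple_word R k' l' cs).
Proof.
move=> hu e es; split; first exact: words_simple.
move=> s' /simple_words[cs' ->]; rewrite e => e'; rewrite !size_map es.
have [u' [hu' e'' le]] := word_aff R k' l' cs'.
by rewrite (aff_inj (etrans (esym e') e'')).
Qed.

Lemma reduced_word_aff cs u : valid u -> prod_word (simple_word R k' l' cs) = aff u ->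
  reduced_word l (simple_word R k' l' cs) -> size cs = ell u.
Proof.
move=> hu e [_ h]; have [u' [hu' e'' le]] := word_aff R k' l' cs.
have eu := aff_inj (etrans (esym e) e'').
have [cs' [e' es']] := aff_word R l' hu.
have := h _ (@words_simple cs') (etrans e' (esym e)); rewrite !size_map es'.
by rewrite -eu in le *; lia.
Qed.

Lemma len_aff u : valid u -> len l (aff u) = ell u.
Proof.
move=> hu; have [cs [e es]] := aff_word R l' hu.
apply: xget_unique.
  by exists (simple_word R k' l' cs); split=> //; [exact: reduced_aff hu e es|rewrite size_map].
move=> n [s [hs es1 <-]]; have [cs' ecs'] := simple_words hs.1.
by rewrite ecs' in hs es1 *; rewrite size_map; apply: reduced_word_aff hs.
Qed.

Lemma finW_aff w u : finW l w -> valid u ->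
  exists2 t : 'I_k -> 'I_k, injective t & w \o aff u = aff (u \o t).
Proof.
move=> [s hs <-] hu; elim: s hs => [|t s IH] hs; first by exists id.
have [|p pI e] := IH; first by move=> t' ht'; apply: hs; rewrite inE ht' orbT.
have /simple0P[a [b [eb et]]] : simple0 l t by apply: hs; rewrite inE eqxx.
exists (p \o tperm a b); first by apply: inj_comp => //; exact: perm_inj.
rewrite /= -[RHS](@simple_refl_comp_aff R k' l' (u \o p) a b) // -e et.
by [].
Qed.

Lemma adjacent_increasing u :
  (forall a b, b = a.+1 :> nat -> u a < u b) -> increasing u.
Proof.
move=> H i j; have [n] := ubnP (j - i); elim: n j => // n IH j nj ij.
case: (eqVneq (j : nat) i.+1) => [/H//|ne].
have lt : (j.-1 < k)%N by have := ltn_ord j; lia.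
have := IH (Ordinal lt); have := H (Ordinal lt) j; rewrite /=; lia.
Qed.

(** Permuting the rows of an increasing window cannot shorten it; a window that decreases between
    adjacent rows is shortened by the simple reflection exchanging them. *)
Lemma minW_aff u : valid u -> minW l (aff u) <-> increasing u.
Proof.
move=> hu; split=> [[_ H]|inc]; last first.
  split; first exact: aff_affW.
  move=> w hw; have [t tI ->] := finW_aff hw hu.
  by rewrite !len_aff //; [exact: increasing_ell | exact: valid_comp].
apply: adjacent_increasing => a b e; case: (ltgtP (u a) (u b)) => // lt.
  have hs : finW l (simple_refl b%:Z).
    exists [:: simple_refl b%:Z] => // t; rewrite inE => /eqP ->.
    by apply/simple0P; exists a, b.
  have := H _ hs; rewrite (simple_refl_comp_aff R l' u e) !len_aff //; last by apply: valid_comp => //; exact: perm_inj.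
  by rewrite (ell_tperm_down hu e lt) ltnn.
have : a = b by apply: hu.1; rewrite lt cong_refl.
by move=> h; move: e; rewrite h; lia.
Qed.

Lemma minWP w : minW l w <-> exists u, [/\ valid u, increasing u & w = aff u].
Proof.
split=> [h|[u [hu inc ->]]]; last exact/minW_aff.
have [u hu e] := affW_aff h.1; exists u; split=> //; apply/minW_aff => //.
by rewrite -e.
Qed.

Lemma bruhat_len (y x : V -> V) : bruhat l (y : V -> V) x -> y = x \/ (len l y < len l x)%N.
Proof.
elim=> [|x' t _ [<-|lt] _ lt']; [by left|by right|right].
exact: ltn_trans lt'.
Qed.

End CoxeterGroup.

(** * Alcoves as regions and the points inside their closures *)

Section Alcoves.
Variables (R : realType) (k' l' : nat).
Local Notation k := (k'.+2).
Local Notation l := (l'.+2).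
Local Notation V := 'rV[R]_k.
Local Notation aff := (@aff R k' l').
Local Notation ext := (@ext R k' l').
Local Notation F := (@fundamental_alcove R k l).
Local Notation z0 := (barycenter R k' l').
Local Notation support := (@alcoves_support R k l).
Implicit Types (x z : V) (u y : 'I_k -> int) (i j a b : 'I_k) (c n m h : int) (C : set V).

Lemma aff_inverse u : valid u ->
  exists u', [/\ valid u', aff u \o aff u' = id & aff u' \o aff u = id].
Proof.
move=> hu; have [cs [e _]] := aff_word R l' hu.
have [u' [hu' e' _]] := word_aff R k' l' (rev cs); exists u'; split=> //.
  rewrite -e -e' {u hu u' hu' e e'}; elim: cs => //= c cs IH.
  rewrite rev_cons -cats1 /simple_word map_cat prod_word_cat /=.
  rewrite -[RHS](simple_reflK R k' l' c) -[in RHS](comp_idr (simple_refl l' c)) -IH.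
  by [].
rewrite -e -e' {u hu u' hu' e e'}; elim: cs => //= c cs IH.
rewrite rev_cons -cats1 /simple_word map_cat prod_word_cat /=.
transitivity (prod_word (simple_word R k' l' (rev cs)) \o
  ((simple_refl l' c \o simple_refl l' c) \o prod_word (simple_word R k' l' cs))); first by [].
by rewrite simple_reflK; exact: IH.
Qed.

Lemma ext_lt_fundamental x : F x -> forall n n', n < n' -> ext x n' < ext x n.
Proof.
move=> /fundamental_alcoveP[h1 h2].
have step n : ext x (n + 1) < ext x n.
  have [i [h ->]] := int_ord k' n; have li := ltn_ord i.
  case: (eqVneq (i : nat) k'.+1) => e.
    have -> : i%:Z + k%:Z * h + 1 = (@nat_of_ord k ord0)%:Z + k%:Z * (h + 1) by rewrite e /=; lia.
    have -> : i = ord_max by exact: val_inj.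
    rewrite !extE mulrDr mulr1 intrD opprD addrCA addrC ltrD2r.
    by rewrite ltrBlDr addrC -ltrBlDr.
  have lt : (i.+1 < k)%N by lia.
  have -> : i%:Z + k%:Z * h + 1 = (Ordinal lt)%:Z + k%:Z * h by rewrite /=; lia.
  by rewrite !extE ltrD2r h1.
move=> n n' lt; have -> : n' = n + `|n' - n|.-1.+1%:Z by lia.
elim: (`|n' - n|.-1) => [|t IH]; first exact: step.
by apply: lt_trans IH; have := step (n + t.+1%:Z); have -> : n + t.+1%:Z + 1 = n + t.+2%:Z by lia.
Qed.

Lemma fundamental_ext_lt x : (forall n n', n < n' -> ext x n' < ext x n) -> F x.
Proof.
move=> H; apply/fundamental_alcoveP; split=> [i j ij|].
  by rewrite -!(ext_ord l'); apply: H; rewrite ltz_nat.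
have lt : (@nat_of_ord k ord_max)%:Z < (@nat_of_ord k ord0)%:Z + k%:Z * 1 by rewrite /=; lia.
by have := H _ _ lt; rewrite extE ext_ord mulr1 ltrBlDr addrC -ltrBlDr.
Qed.

Definition region u : set V :=
  [set z | forall i j m, u i + k%:Z * m < u j -> (m * l%:Z)%:~R < z ord0 i - z ord0 j].

Lemma regionP u z i j m : valid u -> region u z ->
  ((m * l%:Z)%:~R < z ord0 i - z ord0 j) = (u i + k%:Z * m < u j).
Proof.
move=> hu hz; case: (ltgtP (u i + k%:Z * m) (u j)) => [|lt|e]; first exact: hz.
  have /hz : u j + k%:Z * - m < u i by lia.
  by rewrite mulNr rmorphN ltrNl opprB => /ltW; rewrite leNgt => /negPf.
have ij : i = j by apply: hu.1; apply/congP; exists (- m); lia.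
have m0 : m = 0 by move: e; rewrite ij; nia.
by rewrite ij m0 mul0r subrr ltxx.
Qed.

Lemma aff_diff u x i j m :
  ((m * l%:Z)%:~R < aff u x ord0 i - aff u x ord0 j) = (ext x (u j) < ext x (u i + k%:Z * m)).
Proof. by rewrite ext_shift !mxE mulrC ltrBrDl [RHS]ltrBrDr. Qed.

Lemma aff_region u x : F x -> region u (aff u x).
Proof.
by move=> hx i j m lt; rewrite aff_diff; apply: ext_lt_fundamental.
Qed.

Lemma image_fundamental u : valid u -> aff u @` F = region u.
Proof.
move=> hu; apply/seteqP; split=> [_ [x hx <-]|z hz]; first exact: aff_region.
have [u' [hu' e e']] := aff_inverse hu.
have ez : aff u (aff u' z) = z by have := congr1 (fun f => f z) e.
exists (aff u' z) => //; apply: fundamental_ext_lt => n n' lt.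
have [a ha] := row_exists n hu; have [b hb] := row_exists n' hu.
have /congP[h eh] := ha; have /congP[h' eh'] := hb.
rewrite -(addrK (k%:Z * h') n') -(addrK (k%:Z * h') n).
have -> : n' + k%:Z * h' = u b by lia.
have -> : n + k%:Z * h' = u a + k%:Z * (h' - h) by lia.
rewrite -[- (k%:Z * h')]mulrN !ext_shift ltrD2r -ext_shift -aff_diff ez.
by apply: hz; lia.
Qed.

Lemma region_barycenter u : region u (aff u z0).
Proof. exact/aff_region/barycenter_fundamental. Qed.

Lemma region_inj u u' : valid u -> valid u' -> region u = region u' -> u = u'.
Proof.
move=> hu hu' e.
have H i j m : (u i + k%:Z * m < u j) = (u' i + k%:Z * m < u' j).
  rewrite -(@regionP u (aff u z0) i j m hu (@region_barycenter u)).
  rewrite -(@regionP u' (aff u z0) i j m hu') //.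
  by rewrite -e; exact: region_barycenter.
apply: floors_inj => // i j ij.
have [h1 h2] := @fl_bounds k isT (u' j - u' i); move: (_ %/ _)%Z h1 h2 => q h1 h2.
have ji : j != i by apply: contraTneq ij => ->; rewrite ltnn.
have nd w n : valid w -> (w j - w i) <> n * k%:Z.
  by move=> hw eq; have := valid_neq hw ji; rewrite eq dvdz_mull.
have := nd _ q hu; have := nd _ q hu'.
have H2 := H i j q; have H1 := H i j (q + 1) => H3 H4.
have H5 := nd _ (q + 1) hu.
by apply: flE => //; lia.
Qed.

Lemma support_neq z i j m : support z -> i != j -> z ord0 i - z ord0 j <> (m * l%:Z)%:~R.
Proof.
move=> hz ij; case: (ltngtP i j) => [lt|lt|/val_inj e]; last by rewrite e eqxx in ij.
  exact: hz.
move=> e; apply: (hz j i (- m) lt); rewrite /hyperplane /=.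
by rewrite -opprB e mulNr rmorphN.
Qed.

Lemma region_support u : valid u -> region u `<=` support.
Proof.
move=> hu z hz i j m ij; rewrite /hyperplane /= => e.
have ne : i != j by apply: contraTneq ij => ->; rewrite ltnn.
have h1 := regionP i j m hu hz; have h2 := regionP j i (- m) hu hz.
move: h1 h2; rewrite -[z ord0 j - _]opprB e mulNr rmorphN !ltxx => h1 h2.
have eu : u i = u j + k%:Z * - m by lia.
by case/eqP: ne; apply: hu.1; apply/congP; exists (- m).
Qed.

Lemma same_side C z w i j m : connected C -> C `<=` support -> C z -> C w -> i != j ->
  (m * l%:Z)%:~R < z ord0 i - z ord0 j -> (m * l%:Z)%:~R < w ord0 i - w ord0 j.
Proof.
move=> cC sC Cz Cw ij lt; rewrite ltNge; apply/negP => le.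
have : connected ((fun x : V => x ord0 i - x ord0 j : R^o) @` C).
  apply: connected_continuous_connected => //.
  by apply: continuous_subspaceT => ?; exact: coord_diff_continuous.
move/connected_intervalP => /(_ (w ord0 i - w ord0 j) (z ord0 i - z ord0 j)).
move=> /(_ (ex_intro2 _ _ w Cw erefl) (ex_intro2 _ _ z Cz erefl) (m * l%:Z)%:~R).
by rewrite le (ltW lt) => /(_ isT)[x Cx]; apply: support_neq => //; exact: sC.
Qed.

(** On the segment from z to w all differences of coordinates stay strictly on the side common to
    both ends, so the segment avoids every hyperplane. *)
Lemma component_same_signs (z w : V) : support z ->
  (forall i j m, i != j -> (m * l%:Z)%:~R < z ord0 i - z ord0 j -> (m * l%:Z)%:~R < w ord0 i - w ord0 j) ->
  connected_component support z w.
Proof.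
move=> hz H; pose f (t : R^o) : V := z + t *: (w - z).
have f0 : f 0 = z by rewrite /f scale0r addr0.
have f1 : f 1 = w by rewrite /f scale1r addrC subrK.
rewrite -[X in connected_component _ X]f0 -f1.
have cf : connected (f @` [set` `[0 : R, 1]]).
  apply: connected_continuous_connected.
    by apply/connected_intervalP; exact: interval_is_interval.
  apply: continuous_subspaceT => t; apply: cvgD; first exact: cvg_cst.
  by apply: cvgZr_tmp; exact: cvg_id.
apply: (connected_component_max (B := f @` [set` `[0 : R, 1]])) => //.
- by exists 0 => //; rewrite /= in_itv /= lexx ler01.
- move=> _ [t /= + <-] i j m ij; rewrite in_itv /= => /andP[t0 t1].
  have ne : i != j by apply: contraTneq ij => ->; rewrite ltnn.
  case: (eqVneq t 0) => [->|tn0]; first by rewrite f0; exact: hz.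
  have tp : 0 < t by rewrite lt_neqAle eq_sym tn0.
  have := support_neq (m := m) hz ne; rewrite /hyperplane /= => /eqP; rewrite neq_lt => /orP[lt|lt] e.
    have ji : j != i by rewrite eq_sym.
    have lt' : (- m * l%:Z)%:~R < z ord0 j - z ord0 i by rewrite mulNr rmorphN /= -opprB ltrN2.
    have := segment_gt tp t1 (ltW lt') (H _ _ _ ji lt').
    by rewrite -[X in _ < X]opprB mulNr rmorphN ltrN2 e ltxx.
  by have := segment_gt tp t1 (ltW lt) (H _ _ _ ne lt); rewrite e ltxx.
by exists 1 => //; rewrite /= in_itv /= lexx ler01.
Qed.

Lemma region_component u z : valid u -> region u z ->
  region u = connected_component support z.
Proof.
move=> hu hz; apply/seteqP; split=> w hw.
  apply: component_same_signs; first exact: region_support hu _ hz.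
  by move=> i j m ij; rewrite !(regionP _ _ _ hu).
move=> i j m lt; case: (eqVneq i j) => [e|ij].
  by rewrite e subrr -[ltRHS](mulr0z 1) ltr_int; rewrite e in lt; nia.
apply: (same_side (z := z) _ _ _ hw ij); last exact: hz.
- exact: component_connected.
- exact: connected_component_sub.
by apply: connected_component_refl; apply: region_support hz.
Qed.

Lemma region_dominant u : valid u -> increasing u -> dominant_alcove l (region u).
Proof.
move=> hu inc; split.
  exists (aff u z0); first exact: (region_support hu (@region_barycenter u)).
  exact: (region_component hu (@region_barycenter u)).
move=> z hz i j; rewrite leq_eqVlt => /orP[/eqP/val_inj->//|/inc lt].
by apply: ltW; rewrite -subr_gt0; have := hz i j 0; rewrite mul0r mulr0 addr0; apply.
Qed.

Definition int_point y : V := \row_i (y i)%:~R.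

Section Point.
Variables (P : int -> int) (y u : 'I_k -> int).
Hypothesis (hP : fundamental k' l' P) (dy : decreasing y) (hu : fiber P y u).
Hypothesis floors : maximal l' y u.

Let y_le i j m : u i + k%:Z * m < u j -> m * l%:Z <= y i - y j.
Proof.
move=> lt; have := fundamental_le hP (ltW lt).
by rewrite (fundamental_shift _ _ hP) !(fiber_row _ hu); lia.
Qed.

(** The floors of u are those of y, and a difference of window entries in distinct rows is no
    multiple of k: u is strictly on the positive side of each hyperplane through y. *)
Let y_eq i j m : (i < j)%N -> y i - y j = m * l%:Z -> u i + k%:Z * m < u j.
Proof.
move=> ij e; have ji : j != i by apply: contraTneq ij => ->; rewrite ltnn.
have [h1 h2] := @fl_bounds k isT (u j - u i); move: h1 h2; rewrite floors // e mulzK //.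
have : u j - u i <> m * k%:Z.
  by move=> eq; have := valid_neq hu.1 ji; rewrite eq dvdz_mull.
by lia.
Qed.

Lemma closure_region : closure (region u) (int_point y).
Proof.
apply: (@closure_segment R k' (region u) _ (aff u z0)) => t t0 t1 i j m lt.
apply: segment_gt => //; last exact: region_barycenter.
by rewrite !mxE -rmorphB ler_int y_le.
Qed.

Lemma region_positive i j m : (i < j)%N -> hyperplane l i j m (int_point y) ->
  region u `<=` positive_side l i j m.
Proof.
move=> ij; rewrite /hyperplane /= !mxE -rmorphB => /eqP; rewrite eqr_int => /eqP e.
by move=> z; apply; apply: y_eq.
Qed.

(** A competing alcove C is compared with the region one hyperplane at a time. The positive side
    condition decides for hyperplanes through the point. *)
Lemma aplus_region : aplus l (int_point y) = region u.
Proof.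
have hv := hu.1; have inc := fiber_increasing hP dy hu.
apply: xget_unique.
  by split; [exact: region_dominant | exact: closure_region | exact: region_positive].
move=> C [[[z hz eC] _] clC posC].
have Cz : C z by rewrite eC; exact: connected_component_refl.
have cC : connected C by rewrite eC; exact: component_connected.
have sC : C `<=` support by rewrite eC; exact: connected_component_sub.
rewrite eC -(region_component hv) // => i j m lt.
case: (eqVneq i j) => [e|ij].
  by rewrite e subrr -[ltRHS](mulr0z 1) ltr_int; rewrite e in lt; nia.
have := y_le lt; rewrite le_eqVlt => /orP[/eqP e|lty].
  case: (ltngtP i j) => [lij|lji|/val_inj eij]; last by rewrite eij eqxx in ij.
    by apply: (posC i j m) => //; rewrite /hyperplane /= !mxE -rmorphB e.
  by have := y_eq (m := - m) lji; move=> /(_ ltac:(lia)); lia.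
(* For a hyperplane that misses the point, an open half space around the point meets C, and C is
   connected. *)
have op : open [set x : V | (m * l%:Z)%:~R < x ord0 i - x ord0 j].
  have -> : [set x : V | (m * l%:Z)%:~R < x ord0 i - x ord0 j] =
     (fun x : V => x ord0 i - x ord0 j : R^o) @^-1` [set t | (m * l%:Z)%:~R < t] by [].
  apply: open_comp; last exact: open_gt.
  by move=> ? _; exact: coord_diff_continuous.
have [|w [Cw hw]] := clC [set x : V | (m * l%:Z)%:~R < x ord0 i - x ord0 j].
  by apply: open_nbhs_nbhs; split=> //=; rewrite !mxE -rmorphB ltr_int.
exact: same_side cC sC Cw Cz ij hw.
Qed.

Lemma alcove_elt_region : alcove_elt l (region u) = aff u.
Proof.
have hv := hu.1; have inc := fiber_increasing hP dy hu.
apply: xget_unique; first by split; [exact/minW_aff | exact: image_fundamental].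
move=> _ [/minWP[u' [hu' _ ->]]]; rewrite image_fundamental // => e.
by rewrite (region_inj hu' hv e).
Qed.

End Point.

Lemma aff_int_point P u : fundamental k' l' P ->
  aff u (int_point (fun i => P i%:Z)) = int_point (P \o u).
Proof.
move=> hP; apply/rowP => i; rewrite !mxE /=.
have [j [h ->]] := int_ord k' (u i).
by rewrite extE mxE (fundamental_shift _ _ hP) rmorphB.
Qed.

Lemma int_point_inj : injective int_point.
Proof.
move=> y y' /rowP e; apply/funext => i; have := e i.
by rewrite !mxE => /eqP; rewrite eqr_int => /eqP.
Qed.

Lemma affW_comp w w' : affW l w -> affW l w' -> affW l (w \o w' : V -> V).
Proof.
move=> [s hs <-] [s' hs' <-]; exists (s ++ s'); last by rewrite prod_word_cat.
by move=> t; rewrite mem_cat => /orP[/hs|/hs'].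
Qed.

(** Affine Weyl group elements change the window and keep P, so orbits correspond to fundamental
    points by [fiber_unique]. *)
Lemma int_point_orbit P P' y y' u u' :
  fundamental k' l' P -> fundamental k' l' P' -> fiber P y u -> fiber P' y' u' ->
  (exists2 w, affW l w & w (int_point y') = int_point y) <-> P = P'.
Proof.
move=> hP hP' hu hu'; split=> [[w hw]|e].
  rewrite -hu'.2 -aff_int_point // -[LHS]/((w \o aff u') _).
  have /affW_aff[u'' hu'' ->] := affW_comp hw (aff_affW R l' hu'.1).
  rewrite aff_int_point // => /int_point_inj e.
  exact: (fiber_unique hP hP' hu (conj hu'' e)).
have [v [hv _ e']] := aff_inverse hu'.1.
exists (aff u \o aff v); first by apply: affW_comp; apply: aff_affW => //; case: hu.
rewrite -hu'.2 -aff_int_point // -[LHS]/((aff u \o (aff v \o aff u')) _) e' /=.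
by rewrite -e aff_int_point // hu.2.
Qed.

Lemma kl_poly_int_point (H : hecke R k l) (N : antispherical H) (uN : (V -> V) -> N)
    P P' y y' u u' :
  fundamental k' l' P -> fundamental k' l' P' -> decreasing y -> decreasing y' ->
  fiber P y u -> fiber P' y' u' ->
  maximal l' y u ->
  maximal l' y' u' ->
  kl_poly_point uN (int_point y) (int_point y') =
    if `[< P = P' >] then kl_poly uN (aff u) (aff u') else 0.
Proof.
move=> hP hP' dy dy' hu hu' fl fl'; rewrite /kl_poly_point.
rewrite (asbool_equiv_eq (int_point_orbit hP hP' hu hu')); case: ifP => // _.
rewrite /kl_poly_alcove (aplus_region hP dy hu fl) (aplus_region hP' dy' hu' fl').
by rewrite (alcove_elt_region hP dy hu) (alcove_elt_region hP' dy' hu').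
Qed.

End Alcoves.

(** * Finite linear combinations and coordinates *)

Section Combinations.
Context {A : pzRingType} {M : lmodType A} {I : choiceType}.
Implicit Types (S : set A) (D : set I) (b : I -> M) (c : I -> A) (m : M).

Lemma combination_seq S D b c m : combination S D b c m ->
  exists r : seq I, [/\ uniq r, forall i, i \in r -> D i,
    forall i, i \notin r -> c i = 0, forall i, S (c i) & m = \sum_(i <- r) c i *: b i].
Proof.
move=> [/finite_seqP[s es] sD cS ->]; exists (undup s).
have ins i : (i \in undup s) <-> c i <> 0.
  by rewrite mem_undup; have := congr1 (fun X => X i) es => /= ->.
split=> //.
- exact: undup_uniq.
- by move=> i /ins; exact: sD.
- by move=> i /negP h; apply: contrapT => /ins.
rewrite (fsbigE (undup s)).
- rewrite big_seq_cond [RHS]big_seq; apply: eq_bigl => i.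
  by apply/andb_idr => /ins /sD h; rewrite inE.
- exact: undup_uniq.
- by move=> i /= /ins; exact: sD.
by move=> i _ /negP h; rewrite (contrapT (fun n => h ((ins i).2 n))) scale0r.
Qed.

Lemma seq_combination S D b c (r : seq I) : uniq r -> (forall i, i \in r -> D i) ->
  (forall i, i \notin r -> c i = 0) -> (forall i, S (c i)) ->
  combination S D b c (\sum_(i <- r) c i *: b i).
Proof.
move=> ru rD c0 cS; have sr i : c i <> 0 -> i \in r by move=> h; apply: contra_notT h => /c0.
split=> //.
- by apply: (sub_finite_set (B := [set` r])) => //; exact: sr.
- by move=> i /= /sr /rD.
rewrite [RHS](fsbigE r) //.
  by rewrite big_seq [RHS]big_seq_cond; apply: eq_bigl => i; apply/esym/andb_idr => /rD h; rewrite inE.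
by move=> i _ /c0 ->; rewrite scale0r.
Qed.

Lemma combinationD D b c c' m m' : combination setT D b c m -> combination setT D b c' m' ->
  combination setT D b (fun i => c i + c' i) (m + m').
Proof.
move=> /combination_seq[r [ru rD rc _ ->]] /combination_seq[r' [ru' rD' rc' _ ->]].
pose s := undup (r ++ r').
have widen (d : I -> A) (q : seq I) : uniq q -> (forall i, i \notin q -> d i = 0) ->
    {subset q <= s} -> \sum_(i <- q) d i *: b i = \sum_(i <- s) d i *: b i.
  move=> qu q0 qs; rewrite [RHS](bigID (mem q)) /= [X in _ = _ + X]big1 ?addr0; last first.
    by move=> i /q0 ->; rewrite scale0r.
  rewrite -[RHS]big_filter; apply: perm_big; apply: uniq_perm => //.
    by rewrite filter_uniq // undup_uniq.
  by move=> i; rewrite mem_filter; apply/esym/andb_idr => /qs.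
rewrite (widen c) ?(widen c') //; try by move=> i hi; rewrite mem_undup mem_cat hi ?orbT.
rewrite -big_split /=.
under eq_bigr do rewrite -scalerDl.
apply: seq_combination => //; first exact: undup_uniq.
- by move=> i; rewrite mem_undup mem_cat => /orP[/rD|/rD'].
by move=> i; rewrite mem_undup mem_cat negb_or => /andP[/rc -> /rc' ->]; rewrite addr0.
Qed.

Lemma combinationZ D b c m (a : A) : combination setT D b c m ->
  combination setT D b (fun i => a * c i) (a *: m).
Proof.
move=> /combination_seq[r [ru rD rc _ ->]]; rewrite scaler_sumr.
under eq_bigr do rewrite scalerA.
by apply: seq_combination => // i /rc ->; rewrite mulr0.
Qed.

Section Basis.
Variables (D : set I) (b : I -> M).
Hypothesis hb : is_basis setT D b setT.
Local Notation coord := (coordinates D b).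

Lemma coordinatesP m : combination setT D b (coord m) m.
Proof.
have [c hc] : span_over setT D b m by rewrite hb.1.
exact: (@xgetPex _ (fun=> 0) [set c | combination setT D b c m] (ex_intro _ c hc)).
Qed.

Lemma coordinates_unique c m : combination setT D b c m -> coord m = c.
Proof.
move=> hc; apply/funext => i.
have := combinationD (coordinatesP m) (combinationZ (- 1) hc).
rewrite scaleN1r subrr => /hb.2 /(_ i) /eqP.
by rewrite mulN1r subr_eq0 => /eqP.
Qed.

Lemma coordinatesD m m' i : coord (m + m') i = coord m i + coord m' i.
Proof. by rewrite (coordinates_unique (combinationD (coordinatesP m) (coordinatesP m'))). Qed.

Lemma coordinatesZ (a : A) m i : coord (a *: m) i = a * coord m i.
Proof. by rewrite (coordinates_unique (combinationZ a (coordinatesP m))). Qed.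

Lemma coordinates0 i : coord 0 i = 0.
Proof. by rewrite -(scale0r 0) coordinatesZ mul0r. Qed.

Lemma coordinates_basis i j : D i -> coord (b i) j = (i == j)%:R.
Proof.
move=> Di; have := @seq_combination setT D b (fun j => (i == j)%:R) [:: i].
rewrite big_seq1 eqxx scale1r => h; rewrite (coordinates_unique (h _ _ _ _)) //.
  by move=> i'; rewrite inE => /eqP ->.
by move=> i'; rewrite inE eq_sym => /negPf ->.
Qed.

Lemma coordinates_seq m : exists r : seq I, [/\ uniq r, forall i, i \in r -> D i,
  forall i, i \notin r -> coord m i = 0 & m = \sum_(i <- r) coord m i *: b i].
Proof. by have [r [ru rD rc _ e]] := combination_seq (coordinatesP m); exists r. Qed.

Lemma coordinates_out m i : ~ D i -> coord m i = 0.
Proof.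
move=> nD; have [r [_ rD rc _]] := coordinates_seq m.
by apply: rc; apply/negP => /rD.
Qed.

Lemma coordinates_inj m m' : (forall i, D i -> coord m i = coord m' i) -> m = m'.
Proof.
move=> e; have := coordinatesP m'; have -> : coord m' = coord m.
  by apply/funext => i; case: (pselect (D i)) => [/e->//|nD]; rewrite !coordinates_out.
by move=> [_ _ _ ->]; have [_ _ _] := coordinatesP m.
Qed.

Lemma basis_ind (Q : M -> Prop) : Q 0 -> (forall x y, Q x -> Q y -> Q (x + y)) ->
  (forall a i, D i -> Q (a *: b i)) -> forall m, Q m.
Proof.
move=> Q0 QD Qb m; have [r [_ rD _ ->]] := coordinates_seq m.
by rewrite big_seq; apply: big_ind => // i /rD; exact: Qb.
Qed.

End Basis.
End Combinations.

(** * The bar involution on rational functions and Laurent polynomials *)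

Section LaurentPolynomials.

Lemma eval_invD p q : eval_inv (p + q) = eval_inv p + eval_inv q.
Proof. by rewrite /eval_inv rmorphD hornerD. Qed.

Lemma Qv_frac (x : Qv) : exists p q, q != 0 /\ x = ofQX p / ofQX q.
Proof.
exists (frac (repr x)).1, (frac (repr x)).2; split; last exact: fracE.
exact: denom_ratioP.
Qed.

Lemma barQD x y : barQ (x + y) = barQ x + barQ y.
Proof.
have [p [q [q0 ->]]] := Qv_frac x; have [p' [q' [q0' ->]]] := Qv_frac y.
rewrite addf_div ?ofQX_eq0 // -!rmorphM -rmorphD !barQ_frac ?mulf_neq0 //.
by rewrite eval_invD !eval_invM addf_div ?eval_inv_eq0.
Qed.

Lemma barQM x y : barQ (x * y) = barQ x * barQ y.
Proof.
have [p [q [q0 ->]]] := Qv_frac x; have [p' [q' [q0' ->]]] := Qv_frac y.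
by rewrite mulf_div -!rmorphM !barQ_frac ?mulf_neq0 // !eval_invM mulf_div.
Qed.

Lemma barQ_poly p : barQ (ofQX p) = eval_inv p.
Proof.
rewrite -[ofQX p]divr1 -(rmorph1 ofQX) barQ_frac ?oner_neq0 //.
by rewrite {2}/eval_inv rmorph1 hornerC divr1.
Qed.

Lemma barQ_natr n : barQ n%:R = n%:R.
Proof.
rewrite -(rmorph_nat ofQX) barQ_poly /eval_inv.
by rewrite !rmorph_nat -[n%:R in LHS](polyC_natr _ n) hornerC.
Qed.

Lemma barQ0 : barQ 0 = 0. Proof. exact: (barQ_natr 0). Qed.

Lemma barQ1 : barQ 1 = 1. Proof. exact: (barQ_natr 1). Qed.

Lemma barQN x : barQ (- x) = - barQ x.
Proof. by apply/eqP; rewrite -addr_eq0 -barQD addNr barQ0. Qed.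

Lemma barQ_v : barQ v = v^-1.
Proof. by rewrite barQ_poly -['X]expr1 eval_invX. Qed.

Lemma barQV x : barQ x^-1 = (barQ x)^-1.
Proof.
case: (eqVneq x 0) => [->|x0]; first by rewrite invr0 barQ0 invr0.
have h : barQ x^-1 * barQ x = 1 by rewrite -barQM mulVf // barQ1.
have nz : barQ x != 0.
  by apply/eqP => e; move: h; rewrite e mulr0 => /esym/eqP; rewrite oner_eq0.
by rewrite -[LHS](mulfK nz) h mul1r.
Qed.

(** As b(0) is nonzero, X^(n+1) divides p, so x is v times a polynomial c. Bar invariance then reads
    c(1/v) = v^2 c(v); multiplied by v^(deg c), it equates a polynomial of degree at most deg c with
    one of degree 2 deg c + 2. *)
Lemma bar_invariant_eq0 x : laurentQ x -> barQ x = x ->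
  (exists2 y, regular_at0 y & x = v * y) -> x = 0.
Proof.
move=> [p [n xE]] bx [_ [a [b [b0 ->]]] xE'].
have bn0 : b != 0 by apply: contraNneq b0 => ->; rewrite horner0.
have vE i : v ^+ i = ofQX 'X^i by rewrite rmorphXn.
have e : p * b = 'X^(n.+1) * a.
  apply/eqP; rewrite -subr_eq0 -ofQX_eq0 rmorphB !rmorphM -vE subr_eq0.
  have h1 : ofQX p = x * v ^+ n by rewrite xE (divfK (expf_neq0 n v_neq0)).
  have bq : ofQX b != 0 by rewrite ofQX_eq0.
  have h2 : x * ofQX b = v * ofQX a by rewrite xE' -mulrA (divfK bq).
  by rewrite h1 mulrAC h2 -mulrA [_ * v ^+ n]mulrC mulrA -exprS.
have /dvdpP[c pc] : 'X^(n.+1) %| p.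
  have cop : coprimep 'X^(n.+1) b.
    apply: coprimep_expl; rewrite coprimep_sym -['X]subr0 -polyC0 coprimep_XsubC.
    exact: b0.
  by rewrite -(Gauss_dvdpl p cop) e dvdp_mulr.
have xc : x = v * ofQX c.
  by rewrite xE pc rmorphM -vE exprS mulrA (mulfK (expf_neq0 n v_neq0)) mulrC.
case: (eqVneq c 0) => [c0|c0]; first by rewrite xc c0 rmorph0 mulr0.
have ce : eval_inv c = v ^+ 2 * ofQX c.
  have h : v^-1 * eval_inv c = v * ofQX c by rewrite -barQ_v -barQ_poly -barQM -xc bx.
  by rewrite expr2 -mulrA -h mulrA (mulfV v_neq0) mul1r.
pose s := (size c).-1; have sc : size c = s.+1 by rewrite prednK // size_poly_gt0.
have rc : v ^+ s * eval_inv c = ofQX (\sum_(i < s.+1) c`_i *: 'X^(s - i)).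
  rewrite /eval_inv (@horner_coef_wide _ s.+1) ?size_map_poly ?sc // mulr_sumr rmorph_sum.
  apply: eq_bigr => -[i /= lti] _; rewrite coef_map /= -mul_polyC rmorphM mulrCA -vE.
  congr (_ * _); rewrite exprVn -expfB_cond ?v_neq0 //.
  by rewrite (negPf v_neq0) add0n.
have /eqP : ofQX (\sum_(i < s.+1) c`_i *: 'X^(s - i)) = ofQX ('X^(s.+2) * c).
  by rewrite -rc ce mulrA -exprD addn2 rmorphM vE.
rewrite -subr_eq0 -rmorphB ofQX_eq0 subr_eq0 => /eqP /(congr1 (fun q : {poly rat} => q`_(s.+2 + s))).
rewrite coefXnM ltnNge leq_addr /= addKn -[c`_s]/(lead_coef c) => /esym/eqP.
rewrite coef_sum big1 ?lead_coef_eq0 ?(negPf c0) // => i _.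
rewrite coefZ coefXn [_ == _](_ : _ = false) ?mulr0 //; lia.
Qed.

Lemma val_barL (a : laurent) : val (barL a) = barQ (val a).
Proof. by []. Qed.

Lemma barLD a b : barL (a + b) = barL a + barL b.
Proof. by apply: val_inj; rewrite /= barQD. Qed.

Lemma barLM a b : barL (a * b) = barL a * barL b.
Proof. by apply: val_inj; rewrite /= barQM. Qed.

Lemma barL1 : barL 1 = 1.
Proof. by apply: val_inj; rewrite /= barQ1. Qed.

Lemma barL0 : barL 0 = 0.
Proof. by apply: val_inj; rewrite /= barQ0. Qed.

Lemma val_vL : val vL = v. Proof. exact: expr1. Qed.

Lemma val_vLV : val vLV = v^-1. Proof. by rewrite /= expr1. Qed.

Lemma barL_v : barL vL = vLV.
Proof. by apply: val_inj; rewrite val_barL val_vL val_vLV barQ_v. Qed.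

Lemma barL_vV : barL vLV = vL.
Proof. by apply: val_inj; rewrite val_barL val_vL val_vLV barQV barQ_v invrK. Qed.

Lemma vLK : vL * vLV = 1.
Proof. by apply: val_inj; rewrite rmorphM /= !expr1 divff ?v_neq0. Qed.

Lemma laurent_mulf_eq0 (a b : laurent) : a * b = 0 -> a = 0 \/ b = 0.
Proof.
move=> /(congr1 val); rewrite rmorphM => /eqP; rewrite mulf_eq0 => /orP[]/eqP h.
  by left; exact: val_inj.
by right; exact: val_inj.
Qed.

Lemma vL_neq0 : vL <> 0.
Proof. by move=> /(congr1 val); rewrite val_vL => /eqP; rewrite (negPf v_neq0). Qed.

Lemma laurentZ_expz (n : int) : v ^ n \in laurentZ.
Proof. by case: n => n; [exact: vX_laurentZ | exact: vXV_laurentZ]. Qed.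

Definition vpow (n : int) : laurent := Laurent (laurentZ_expz n).

Lemma vpowD m n : vpow (m + n) = vpow m * vpow n.
Proof. by apply: val_inj; rewrite rmorphM /= expfzDr ?v_neq0. Qed.

Lemma vpow0 : vpow 0 = 1. Proof. exact: val_inj. Qed.

Lemma vpow1 : vpow 1 = vL. Proof. exact: val_inj. Qed.

Lemma vpowS n : vpow (n + 1) = vL * vpow n.
Proof. by rewrite vpowD vpow1 mulrC. Qed.

Lemma vLVK (a b : laurent) : a = vL * b -> b = vLV * a.
Proof. by move=> ->; rewrite mulrA [vLV * vL]mulrC vLK mul1r. Qed.

End LaurentPolynomials.

(** * The antispherical module in terms of windows *)

Section HeckeModule.
Variables (R : realType) (k' l' : nat).
Local Notation k := (k'.+2).
Local Notation l := (l'.+2).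
Local Notation cong := (cong k').
Local Notation id_perm := (@id_perm k').
Local Notation aff := (@aff R k' l').
Local Notation simple_refl := (@simple_refl R k' l').
Variables (H : hecke R k l) (N : antispherical H).
Implicit Types (u w : 'I_k -> int) (i : 'I_k) (c : int) (n : N) (h : H) (a : laurent).

Definition Hgen c : H := hgen H (simple_refl c).
Definition Hstd u : H := hstd H (aff u).

Lemma Hstd_word u cs : valid u -> prod_word (simple_word R k' l' cs) = aff u ->
  size cs = ell u -> Hstd u = \prod_(c <- cs) Hgen c.
Proof.
move=> hu e es; rewrite /Hstd -e (hstd_reduced H (reduced_aff hu e es)).
by rewrite /simple_word big_map.
Qed.

Lemma Hstd_id : Hstd id_perm = 1.
Proof.
rewrite (@Hstd_word _ [::]) ?big_nil //; first exact: valid_id.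
  by rewrite aff_id.
by rewrite ell_id.
Qed.

Lemma Hstd_act u c : valid u -> ell (act u c) = (ell u).+1 ->
  Hstd (act u c) = Hstd u * Hgen c.
Proof.
move=> hu e; have [cs [e1 e2]] := aff_word R l' hu.
rewrite (Hstd_word hu e1 e2) (@Hstd_word _ (rcons cs c)); first by rewrite -cats1 big_cat big_seq1.
- exact: act_valid.
- by rewrite -cats1 /simple_word map_cat prod_word_cat /= -/(simple_word R k' l' cs) e1 comp_idr aff_comp_simple.
by rewrite size_rcons e2 e.
Qed.

Lemma Hstd_tperm u (a b : 'I_k) : valid u -> b = a.+1 :> nat -> ell (u \o tperm a b) = (ell u).+1 ->
  Hstd (u \o tperm a b) = Hgen b%:Z * Hstd u.
Proof.
move=> hu eb e; have [cs [e1 e2]] := aff_word R l' hu.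
rewrite (Hstd_word hu e1 e2) (@Hstd_word _ (b%:Z :: cs)) ?big_cons //.
- by apply: valid_comp => //; exact: perm_inj.
- by rewrite /= -/(simple_word R k' l' cs) e1 (simple_refl_comp_aff R l' u eb).
by rewrite /= e2 e.
Qed.

Lemma simple_simple_refl c : simple l (simple_refl c).
Proof. by apply/simpleP; exists c. Qed.

Lemma Hgen_quadratic c : Hgen c * Hgen c = 1 + (vLV - vL) *: Hgen c.
Proof. exact: (hgen_relations H).1 (simple_simple_refl c). Qed.

Lemma Hgen_std c : Hgen c = Hstd (act id_perm c).
Proof.
rewrite Hstd_act; first by rewrite Hstd_id mul1r.
  exact: valid_id.
apply: ell_up; first exact: valid_id.
by rewrite !winv_id; lia.
Qed.

(** A simple reflection is its own inverse, so the bar involution sends H_s to the inverse of H_s,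
    which the quadratic relation gives as H_s + v - v^-1. *)
Lemma hbar_Hgen c : hbar H (Hgen c) = Hgen c + (vL - vLV)%:A.
Proof.
have hv := act_valid c (valid_id k').
have [e1 e2] : hbar H (Hgen c) * Hgen c = 1 /\ Hgen c * hbar H (Hgen c) = 1.
  by rewrite Hgen_std; apply: hbar_std; [exact: aff_affW|exact: aff_affW|exact: simple_reflK].
have e3 : Hgen c * (Hgen c + (vL - vLV)%:A) = 1.
  rewrite mulrDr Hgen_quadratic -scalerAr mulr1 -addrA -scalerDl.
  by rewrite addrA subrK subrr scale0r addr0.
transitivity (hbar H (Hgen c) * Hgen c * (Hgen c + (vL - vLV)%:A)).
  by rewrite -mulrA e3 mulr1.
by rewrite e1 mul1r.
Qed.

Definition Nstd u : N := nstd N (aff u).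
Definition kappa n u : laurent := coordinates (minW l) (nstd N) n (aff u).

Lemma N_basis : is_basis setT (minW l) (nstd N) setT.
Proof. exact: tens_basis. Qed.

Lemma kappaD n n' u : kappa (n + n') u = kappa n u + kappa n' u.
Proof. exact: coordinatesD N_basis _ _ _. Qed.

Lemma kappaZ a n u : kappa (a *: n) u = a * kappa n u.
Proof. exact: coordinatesZ N_basis _ _ _. Qed.

Lemma kappa0 u : kappa 0 u = 0.
Proof. exact: coordinates0 N_basis _. Qed.

Lemma kappaN n u : kappa (- n) u = - kappa n u.
Proof. by rewrite -scaleN1r kappaZ mulN1r. Qed.

Lemma kappa_sum (I : Type) (r : seq I) (Q : pred I) (f : I -> N) u :
  kappa (\sum_(i <- r | Q i) f i) u = \sum_(i <- r | Q i) kappa (f i) u.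
Proof.
exact: (big_morph (fun n => kappa n u) (fun x y => kappaD x y u) (kappa0 u)).
Qed.

Lemma kappa_inj n n' : (forall u, valid u -> increasing u -> kappa n u = kappa n' u) -> n = n'.
Proof.
move=> e; apply: (coordinates_inj N_basis) => _ /minWP[u [hu inc ->]]; exact: e.
Qed.

Lemma kappa_Nstd u w : valid u -> increasing u -> kappa (Nstd u) w = (u == w)%:R.
Proof.
move=> hu inc; rewrite /kappa /Nstd (coordinates_basis N_basis); last exact/minW_aff.
by congr ((nat_of_bool _)%:R); apply/eqP/eqP => [/aff_inj//|->].
Qed.

Lemma N_ind (Q : N -> Prop) : Q 0 -> (forall x y, Q x -> Q y -> Q (x + y)) ->
  (forall a u, valid u -> increasing u -> Q (a *: Nstd u)) -> forall n, Q n.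
Proof.
move=> Q0 QD Qb; apply: (basis_ind N_basis) => // a _ /minWP[u [hu inc ->]]; exact: Qb.
Qed.

Lemma tensD a h h' : tens N a (h + h') = tens N a h + tens N a h'.
Proof. by have [[h1 _] _] := tens_balanced N; exact: h1. Qed.

Lemma tens0 a : tens N a 0 = 0.
Proof. by apply: (addrI (tens N a 0)); rewrite -tensD !addr0. Qed.

Lemma tens_ind (Q : N -> Prop) : (forall x y, Q x -> Q y -> Q (x + y)) ->
  (forall a h, Q (tens N a h)) -> forall n, Q n.
Proof.
move=> QD Qt; apply: N_ind => //; first by rewrite -(tens0 0).
by move=> a u _ _; rewrite /Nstd /nstd tensZ mulr1.
Qed.

Lemma tens_char a (b : H) (c : laurent) h : hf_char b c -> tens N (a * c) h = tens N a (b * h).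
Proof. by move=> hc; apply: (tens_balanced N).2. Qed.

Lemma tens_scale a (c : laurent) h : tens N a (c *: h) = tens N (a * c) h.
Proof. by rewrite (tens_char _ _ (hf_scalar H c)) -scalerAl mul1r. Qed.

Lemma ractDl n n' h : ract (n + n') h = ract n h + ract n' h.
Proof. by have [_ /(_ h)] := ract_biadditive N. Qed.

Lemma ractDr n h h' : ract n (h + h') = ract n h + ract n h'.
Proof. by have [/(_ n)] := ract_biadditive N. Qed.

Lemma ractZ a n h : ract (a *: n) h = a *: ract n h.
Proof.
elim/tens_ind: n => [x y e1 e2|a' h']; first by rewrite scalerDr !ractDl scalerDr e1 e2.
by rewrite tensZ !ract_tens tensZ.
Qed.

Lemma ractM n h h' : ract n (h * h') = ract (ract n h) h'.
Proof.
elim/tens_ind: n => [x y e1 e2|a' h'']; first by rewrite !ractDl e1 e2.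
by rewrite !ract_tens mulrA.
Qed.

Lemma ract1 n : ract n 1 = n.
Proof.
elim/tens_ind: n => [x y e1 e2|a' h'']; first by rewrite !ractDl e1 e2.
by rewrite ract_tens mulr1.
Qed.

Lemma ractZr a n h : ract n (a *: h) = a *: ract n h.
Proof.
elim/tens_ind: n => [x y e1 e2|a' h']; first by rewrite !ractDl scalerDr e1 e2.
by rewrite !ract_tens tensZ -scalerAr tens_scale mulrC.
Qed.

Lemma nbarZ a n : nbar N (a *: n) = barL a *: nbar N n.
Proof.
elim/tens_ind: n => [x y e1 e2|a' h']; first by rewrite scalerDr !raddfD e1 e2 ?scalerDr.
by rewrite tensZ !nbar_tens tensZ barLM.
Qed.

Lemma nbar_ract n h : nbar N (ract n h) = ract (nbar N n) (hbar H h).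
Proof.
elim/tens_ind: n => [x y e1 e2|a' h']; first by rewrite ractDl !raddfD ractDl e1 e2.
by rewrite ract_tens !nbar_tens ract_tens rmorphM.
Qed.

Definition T c n : N := ract n (Hgen c).

Lemma TD c n n' : T c (n + n') = T c n + T c n'.
Proof. exact: ractDl. Qed.

Lemma TZ c a n : T c (a *: n) = a *: T c n.
Proof. exact: ractZ. Qed.

Lemma T0 c : T c 0 = 0.
Proof. by have := TZ c 0 0; rewrite !scale0r. Qed.

Lemma TN c n : T c (- n) = - T c n.
Proof. by rewrite -scaleN1r TZ scaleN1r. Qed.

Lemma T_quadratic c n : T c (T c n) = n + (vLV - vL) *: T c n.
Proof. by rewrite /T -ractM Hgen_quadratic ractDr ract1 ractZr. Qed.

Lemma T_cong c c' n : cong c c' -> T c n = T c' n.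
Proof. by move=> e; rewrite /T /Hgen (simple_refl_cong _ _ e). Qed.

Lemma nbar_T c n : nbar N (T c n) = T c (nbar N n) + (vL - vLV) *: nbar N n.
Proof. by rewrite /T nbar_ract hbar_Hgen ractDr ractZr ract1. Qed.

Lemma T_up u c : valid u -> lev u (c - 1) < lev u c -> T c (Nstd u) = Nstd (act u c).
Proof.
move=> hu lt; rewrite /T /Nstd /nstd ract_tens -/(Hstd u) -Hstd_act //.
exact: lev_up.
Qed.

Lemma T_down u c : valid u -> lev u c < lev u (c - 1) ->
  T c (Nstd u) = Nstd (act u c) + (vLV - vL) *: Nstd u.
Proof.
move=> hu lt; have hv := act_valid c hu.
have lt' : lev (act u c) (c - 1) < lev (act u c) c by rewrite !lev_swap // swap_l swap_r.
have e := T_up hv lt'; rewrite actK in e.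
by rewrite -{1}e T_quadratic e.
Qed.

(** Here H_u H_c = H_s H_u for a simple reflection s of the finite group, and H_s passes through the
    tensor sign as [- vL]. *)
Lemma T_adjacent u c : valid u -> increasing u -> lev u (c - 1) = lev u c ->
  T c (Nstd u) = - vL *: Nstd u.
Proof.
move=> hu inc e; have [_ [a [b [eb e1 ha hb]]]] := lev_adjacent hu inc e.
have up := adjacent_up hu eb e1 ha hb.
rewrite /T /Nstd /nstd ract_tens -/(Hstd u) -Hstd_act //.
rewrite (adjacent_act hu e1 ha hb) in up *; rewrite Hstd_tperm //.
rewrite -(@tens_char 1 _ (- vL) (Hstd u)); first by rewrite mul1r tensZ mulr1.
by apply: hf_gen; apply/simple0P; exists a, b.
Qed.

(** Diagonal entry of [T c] at N_u for an ascent, a descent and the adjacent case, in this order. *)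
Definition eps u c : laurent :=
  if lev u (c - 1) < lev u c then 0 else if lev u c < lev u (c - 1) then vLV - vL else - vL.

Lemma kappa_T c n u : valid u -> increasing u ->
  kappa (T c n) u = (if lev u (c - 1) == lev u c then 0 else kappa n (act u c)) + eps u c * kappa n u.
Proof.
move=> hu inc; elim/N_ind: n => [|x y e1 e2|a w hw wi].
- by rewrite T0 !kappa0 mulr0 addr0; case: ifP.
- by rewrite TD !kappaD e1 e2 mulrDr; case: ifP => _; [rewrite !add0r | rewrite addrACA].
rewrite TZ !kappaZ mulrCA [X in _ = X + _](_ : _ = a * (if lev u (c - 1) == lev u c then 0 else kappa (Nstd w) (act u c))); last first.
  by case: ifP => _; rewrite ?mulr0 // kappaZ.
rewrite -mulrDr; congr (_ * _).
have actw_inc : lev w (c - 1) != lev w c -> increasing (act w c) by exact: lev_increasing.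
have e1 : (w == act u c) = (act w c == u) by apply/eqP/eqP => [->|<-]; rewrite actK.
rewrite !kappa_Nstd // e1.
have -> : kappa (T c (Nstd w)) u = (if lev w (c - 1) == lev w c then 0 else (act w c == u)%:R) + eps w c * (w == u)%:R.
  have vw := act_valid c hw; rewrite /eps; case: (ltgtP (lev w (c - 1)) (lev w c)) => lw.
  - rewrite T_up // kappa_Nstd // ?mul0r ?addr0 //; apply: actw_inc; lia.
  - rewrite T_down // kappaD kappaZ !kappa_Nstd //; apply: actw_inc; lia.
  by rewrite T_adjacent // kappaZ kappa_Nstd // add0r.
case: (eqVneq w u) => [->//|wu]; rewrite !mulr0 !addr0.
case: (eqVneq (act w c) u) => [e|ne]; last by do 2?case: ifP.
rewrite -e !lev_swap // swap_l swap_r [in RHS]eq_sym.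
by [].
Qed.

End HeckeModule.

(** * Braid relations for the right action *)

Section BraidRelations.
Variables (R : realType) (k' l' : nat).
Local Notation k := (k'.+2).
Local Notation l := (l'.+2).
Local Notation cong := (cong k').
Local Notation swap := (swap k').
Local Notation id_perm := (@id_perm k').
Local Notation aff := (@aff R k' l').
Local Notation simple_refl := (@simple_refl R k' l').
Variables (H : hecke R k l) (N : antispherical H).
Implicit Types (u : 'I_k -> int) (i : 'I_k) (c d x : int) (n : N) (h : int) (a : laurent) (t : nat).
Local Notation T := (@T R k' l' H N).

Lemma cong_neq x y : `|x - y| < k%:Z -> x <> y -> cong x y = false.
Proof. by move=> h ne; apply/negP => /cong_small /(_ h). Qed.

Lemma iter_simple_refl c d t :
  iter t (simple_refl c \o simple_refl d) =1 aff (iter t (fun u => act (act u c) d) id_perm).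
Proof.
elim: t => [|t IH] x; first by rewrite aff_id.
by rewrite iterSr IH /= -[LHS]/(((aff _ \o simple_refl c) \o simple_refl d) x) !aff_comp_simple.
Qed.

Lemma iter_act c d t i :
  iter t (fun u => act (act u c) d) id_perm i = iter t (swap d \o swap c) i%:Z.
Proof. by elim: t => // t IH; rewrite iterS /= !actE IH. Qed.

Lemma iter_swap_shift c d t x h :
  iter t (swap d \o swap c) (x + k%:Z * h) = iter t (swap d \o swap c) x + k%:Z * h.
Proof. by elim: t => // t IH; rewrite !iterS IH /= !swap_shift. Qed.

Lemma iter_simple_refl_id c d t :
  iter t (simple_refl c \o simple_refl d) =1 id <-> iter t (swap d \o swap c) =1 id.
Proof.
split=> [e x|e x].
  have [i [h ->]] := int_ord k' x; rewrite iter_swap_shift; congr (_ + _).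
  have ea : aff (iter t (fun u => act (act u c) d) id_perm) = aff id_perm.
    by rewrite aff_id; apply/funext => z; rewrite -iter_simple_refl e.
  by have := congr1 (fun f => f i) (aff_inj ea); rewrite iter_act.
rewrite iter_simple_refl; have -> : iter t (fun u => act (act u c) d) id_perm = id_perm.
  by apply/funext => i; rewrite iter_act e.
by rewrite aff_id.
Qed.

(** The defining relation asks for the exact order of a product of reflections;
    [iter_simple_refl_id] moves its computation to permutations of the integers. *)
Lemma Hgen_relation c d t : (1 < t)%N -> iter t (swap d \o swap c) =1 id ->
  (forall t', (0 < t' < t)%N -> exists x, iter t' (swap d \o swap c) x != x) ->
  Defs.alternating (Hgen H c) (Hgen H d) t = Defs.alternating (Hgen H d) (Hgen H c) t.
Proof.
move=> t1 e ne; have nid t' : (0 < t' < t)%N -> ~ iter t' (simple_refl c \o simple_refl d) =1 id.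
  by move=> /ne[x /eqP nx] /iter_simple_refl_id /(_ x).
apply: (hgen_relations H).2; [exact: simple_simple_refl|exact: simple_simple_refl| |].
  move=> e'; apply: (nid 1%N); first by rewrite t1.
  by move=> x; rewrite /= e' -[LHS]/((simple_refl d \o simple_refl d) x) simple_reflK.
split; [exact: ltnW|exact/iter_simple_refl_id|].
move=> t' t'0 e'; rewrite leqNgt; apply/negP => lt.
by apply: (nid t') e'; rewrite t'0.
Qed.

Lemma swap_out c x : cong x (c - 1) = false -> cong x c = false -> swap c x = x.
Proof. by rewrite /swap => -> ->. Qed.

Lemma T_comm c d n : cong c d = false -> cong (c + 1) d = false -> cong c (d + 1) = false ->
  T c (T d n) = T d (T c n).
Proof.
move=> h1 h2 h3; rewrite /T -!ractM; congr (ract n _).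
have h4 : cong (c - 1) (d - 1) = false by rewrite congDr.
have h5 : cong (c - 1) d = false.
  by rewrite -(congDr k' _ _ 1) subrK.
have h6 : cong c (d - 1) = false by rewrite -(congDr k' _ _ 1) subrK.
have o1 : swap c d = d by apply: swap_out; rewrite cong_sym.
have o2 : swap c (d - 1) = d - 1 by apply: swap_out; rewrite cong_sym.
have e x : swap c (swap d x) = swap d (swap c x).
  have [cx|cx] := boolP (cong x (d - 1)).
    have /congP[h ->] := cx; rewrite !swap_shift; congr (_ + _).
    by rewrite swap_l o1 o2 swap_l.
  have [cx'|cx'] := boolP (cong x d).
    have /congP[h ->] := cx'; rewrite !swap_shift; congr (_ + _).
    by rewrite swap_r o1 o2 swap_r.
  rewrite [swap d x]swap_out ?(negPf cx) ?(negPf cx') //.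
  apply/esym/swap_out; apply/negP => hc.
    by move/negP: cx; apply; rewrite -o2 swap_cong in hc.
  by move/negP: cx'; apply; rewrite -o1 swap_cong in hc.
have := @Hgen_relation d c 2 isT; rewrite /= !mulr1; apply.
  by move=> x /=; rewrite e !swapK.
move=> t' ht'; have -> : t' = 1%N by lia.
have o3 : swap d c = c by exact: swap_out.
exists c; rewrite /= o3 swap_r.
by lia.
Qed.

(** The condition means k > 2: for k = 2 the two simple reflections generate an infinite dihedral
    group. *)
Lemma T_braid c n : (0 < k')%N ->
  T c (T (c + 1) (T c n)) = T (c + 1) (T c (T (c + 1) n)).
Proof.
move=> k0; rewrite /T -!ractM; congr (ract n _).
have c1 : swap (c + 1) c = c + 1 by have := swap_l k' (c + 1); rewrite addrK.
have c2 : swap (c + 1) (c + 1) = c by rewrite swap_r addrK.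
have c3 : swap c (c + 1) = c + 1.
  by apply: swap_out; apply: cong_neq; lia.
have c4 : swap (c + 1) (c - 1) = c - 1.
  by apply: swap_out; apply: cong_neq; lia.
have := @Hgen_relation c (c + 1) 3 isT; rewrite /= !mulr1; apply.
  move=> x /=.
  have [cx|cx] := boolP (cong x (c - 1)).
    by have /congP[h ->] := cx; rewrite !swap_shift swap_l c1 c3 c2 swap_r c4.
  have [cx'|cx'] := boolP (cong x c).
    by have /congP[h ->] := cx'; rewrite !swap_shift swap_r c4 swap_l c1 c3 c2.
  have [cx''|cx''] := boolP (cong x (c + 1)).
    by have /congP[h ->] := cx''; rewrite !swap_shift c3 c2 swap_r c4 swap_l c1.
  have s1 : swap c x = x by rewrite swap_out ?(negPf cx) ?(negPf cx').
  have s2 : swap (c + 1) x = x by rewrite swap_out ?addrK ?(negPf cx') ?(negPf cx'').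
  by rewrite !(s1, s2).
move=> t' ht'; have [->|->] : t' = 1%N \/ t' = 2%N by lia.
  by exists (c - 1); rewrite /= swap_l c1; clear; lia.
by exists (c - 1); rewrite /= swap_l c1 c3 c2; clear; lia.
Qed.

Fixpoint Tword c t n : N := if t is t'.+1 then T c (Tword (c + 1) t' n) else n.

Lemma Tword_Z c t a n : Tword c t (a *: n) = a *: Tword c t n.
Proof. by elim: t c => //= t IH c; rewrite IH TZ. Qed.

Lemma Tword_comm d c t n : (forall s : nat, (s <= t.+1)%N -> cong d (c - 1 + s%:Z) = false) ->
  (0 < t)%N -> T d (Tword c t n) = Tword c t (T d n).
Proof.
elim: t c => // t IH c h _ /=.
have e0 := h 0%N isT; have e1 := h 1%N isT; have e2 := h 2%N isT.
rewrite addr0 in e0; rewrite subrK in e1.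
have e2' : cong d (c + 1) = false by rewrite -e2; congr (cong d _); lia.
rewrite T_comm //; last by rewrite -(congDr k' _ _ (- 1)) addrK.
case: t IH h => [//|t] IH h; rewrite IH // => s hs.
have := h s.+1 hs; have -> : c - 1 + s.+1%:Z = c + 1 - 1 + s%:Z by lia.
by [].
Qed.

(** The generator c + s + 1 commutes with the letters c, ..., c + s - 1, a braid relation turns it
    into c + s, and this commutes with the remaining letters. The bound t < k keeps the word from
    wrapping around. *)
Lemma Tword_braid c s t n : (s.+1 < t)%N -> (t < k)%N ->
  T (c + s.+1%:Z) (Tword c t n) = Tword c t (T (c + s%:Z) n).
Proof.
elim: s c t => [|s IH] c [|[|t]] // st tk.
  rewrite /= addr0 -T_braid; last by lia.
  congr (T c (T (c + 1) _)).
  case: t st tk => [//|t] st tk; apply: Tword_comm => // q hq.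
  by apply: cong_neq; lia.
rewrite [Tword _ _ _]/= [Tword _ _ (T _ n)]/= T_comm.
- congr (T c _); have := IH (c + 1) t.+1; rewrite [Tword _ _ _]/= [Tword _ _ (T _ n)]/=.
  have -> : c + 1 + s.+1%:Z = c + s.+2%:Z by lia.
  have -> : c + 1 + s%:Z = c + s.+1%:Z by lia.
  by apply; lia.
- by apply: cong_neq; lia.
- by apply: cong_neq; lia.
by apply: cong_neq; lia.
Qed.

End BraidRelations.

(** * Eigenvectors for the stabilizer and partial symmetrization *)

Section Invariants.
Variables (R : realType) (k' l' : nat).
Local Notation k := (k'.+2).
Local Notation l := (l'.+2).
Local Notation cong := (cong k').
Variables (H : hecke R k l) (N : antispherical H).
Implicit Types (u : 'I_k -> int) (i : 'I_k) (c d x : int) (n : N) (a : laurent) (m : nat).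
Implicit Types P : int -> int.
Local Notation T := (@T R k' l' H N).
Local Notation kappa := (@kappa R k' l' H N).
Local Notation Tword := (@Tword R k' l' H N).

(** The eigenvalue v^-1 is that of H_s on multiples of H_s + v: n is quantum symmetric under the
    stabilizer of P. *)
Definition block_invariant P n := forall c, P (c - 1) = P c -> T c n = vLV *: n.

Lemma vL_add_vLV (a : laurent) : (vL + vLV) * a = 0 -> a = 0.
Proof.
move=> /laurent_mulf_eq0[h|//].
have : val (vL * vL + 1) = 0 by rewrite -vLK -mulrDr h mulr0.
rewrite /= expr1 -expr2 -(rmorph1 ofQX) -rmorphXn -rmorphD => /eqP.
rewrite ofQX_eq0 => /eqP /(congr1 (horner_eval 1)).
by rewrite /horner_eval hornerD hornerXn hornerC horner0 expr1n.
Qed.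

Lemma kappa_eigen P c n u : T c n = vLV *: n -> valid u -> increasing u ->
  (lev u (c - 1) = lev u c -> kappa n u = 0) /\
  (lev u c < lev u (c - 1) -> kappa n (act u c) = vL * kappa n u).
Proof.
move=> /(congr1 (fun n => kappa n u)) + hu inc; rewrite kappa_T // kappaZ /eps => e.
split=> lt; move: e; rewrite ?lt ?eqxx ?ltxx ?add0r.
  move=> /eqP; rewrite -subr_eq0 -mulrBl -opprD mulNr oppr_eq0 => /eqP.
  exact: vL_add_vLV.
rewrite gt_eqF // ltNge ltW //=.
rewrite mulrBl => /eqP; rewrite addrCA -[X in _ == X]addr0 (inj_eq (addrI _)) subr_eq0.
by move/eqP.
Qed.

Lemma eigen_kappa c n :
  (forall u, valid u -> increasing u -> lev u (c - 1) = lev u c -> kappa n u = 0) ->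
  (forall u, valid u -> increasing u -> lev u c < lev u (c - 1) ->
     kappa n (act u c) = vL * kappa n u) -> T c n = vLV *: n.
Proof.
move=> h1 h2; apply: kappa_inj => u hu inc; rewrite kappa_T // kappaZ /eps.
case: (ltgtP (lev u (c - 1)) (lev u c)) => lt.
- rewrite mul0r addr0; apply: vLVK; rewrite -h2 ?actK //.
  + exact: act_valid.
  + by apply: lev_increasing => //; lia.
  by rewrite !lev_swap // swap_l swap_r.
- by rewrite h2 // -mulrDl addrC subrK.
by rewrite h1 // !mulr0 addr0.
Qed.

(** Off the block minimal windows a coefficient either vanishes, at a tie of levels, or differs by a
    factor v from the one at a shorter window with the same [P \o u]. *)
Lemma invariant_eq0 P n : fundamental k' l' P -> block_invariant P n ->
  (forall u, valid u -> increasing u -> block_minimal P u -> kappa n u = 0) -> n = 0.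
Proof.
move=> hP inv h0; apply: kappa_inj => u hu inc; rewrite kappa0.
have [m] := ubnP (ell u); elim: m u hu inc => // m IH u hu inc um.
case: (pselect (block_minimal P u)) => [|nm]; first exact: h0.
apply: contrapT => nz; apply: nm => c e.
have [e1 e2] := kappa_eigen P (inv c e) hu inc.
case: (ltgtP (lev u (c - 1)) (lev u c)) => // lt; last by case: nz; exact: e1.
case: nz; have := e2 lt; have eu := lev_down hu lt.
rewrite IH; first by move=> /esym /laurent_mulf_eq0[/vL_neq0|].
- exact: act_valid.
- by apply: lev_increasing => //; lia.
by lia.
Qed.

Lemma invariantD P n n' : block_invariant P n -> block_invariant P n' -> block_invariant P (n + n').
Proof. by move=> h h' c e; rewrite TD h // h' // scalerDr. Qed.

Lemma invariantZ P a n : block_invariant P n -> block_invariant P (a *: n).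
Proof. by move=> h c e; rewrite TZ h // !scalerA mulrC. Qed.

Lemma invariant0 P : block_invariant P 0.
Proof. by move=> c e; rewrite T0 scaler0. Qed.

Lemma invariant_sum P (I : Type) (r : seq I) (Q : pred I) (f : I -> N) :
  (forall q : I, Q q -> block_invariant P (f q)) -> block_invariant P (\sum_(i <- r | Q i) f i).
Proof. by apply: big_ind; [exact: invariant0|exact: invariantD]. Qed.

Lemma invariant_nbar P n : block_invariant P n -> block_invariant P (nbar N n).
Proof.
move=> h c e; have := nbar_T c n; rewrite h // nbarZ barL_vV scalerBl => /eqP.
by rewrite addrCA -[X in X == _]addr0 (inj_eq (addrI _)) eq_sym subr_eq0 => /eqP.
Qed.

(** Partial symmetrizer from S_m, acting on the positions j0 - m, ..., j0 - 1, to S_(m+1), acting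
    also on j0: a weighted sum over the m + 1 minimal coset representatives, expanded in
    [Xop_sum]. *)
Fixpoint Xop (j0 : int) m n : N :=
  if m is m'.+1 then vL *: Xop j0 m' n + Tword (j0 - m'%:Z) m n else n.

Section Raise.
Variables (P' : int -> int) (j0 : int) (m0 : nat).
Hypothesis hP' : fundamental k' l' P'.
Hypothesis block : forall s : nat, (s <= m0)%N -> P' (j0 - s%:Z) = P' j0.
Hypothesis block_r : P' (j0 + 1) < P' j0.
Hypothesis block_l : P' j0 < P' (j0 - m0.+1%:Z).

(** Undoes the addition of a node on the level of fundamental points. Since j0 is the last position
    of its block, the result is still weakly decreasing ([lower_fundamental]), and the block loses
    one position. *)
Definition lower x := P' x - (cong x j0)%:Z.

Lemma block_bound : (m0 < k)%N.
Proof.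
rewrite ltnNge; apply/negP => h; have := block h.
have -> : j0 - k%:Z = j0 + k%:Z * - 1 by lia.
by rewrite (fundamental_shift _ _ hP'); lia.
Qed.

Lemma lower_block s : (0 < s <= m0)%N -> lower (j0 - s%:Z) = P' j0.
Proof.
move=> /andP[s0 sm]; rewrite /lower block // cong_neq ?subr0 //; have := block_bound; lia.
Qed.

Lemma Xop_comm d m n : (forall s : nat, (s <= m.+1)%N -> cong d (j0 + 1 - s%:Z) = false) ->
  T d n = vLV *: n -> T d (Xop j0 m n) = vLV *: Xop j0 m n.
Proof.
move=> h e; elim: m h => [//|m IH] h; rewrite [Xop _ _ _]/= -[T _ (Tword _ _ _)]/(Tword _ m.+1 _).
rewrite TD TZ IH; last by move=> s hs; apply: h; apply: leqW.
rewrite Tword_comm // => [|s hs]; first by rewrite e Tword_Z scalerDr !scalerA mulrC.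
have -> : j0 - m%:Z - 1 + s%:Z = j0 + 1 - (m.+2 - s)%N%:Z by lia.
by apply: h; lia.
Qed.

Lemma T_Xop n m : block_invariant lower n -> (m.+1 < m0)%N ->
  T (j0 - m.+1%:Z) (Xop j0 m n) = vLV *: Xop j0 m n.
Proof.
move=> inv lt; have kb := block_bound; apply: Xop_comm => [s hs|].
  by apply: cong_neq; lia.
apply: inv; have -> : j0 - m.+1%:Z - 1 = j0 - m.+2%:Z by lia.
by rewrite !lower_block //; lia.
Qed.

(** The summands of [Xop] are not bar invariant one by one. This three-term recursion involves the
    bar invariant operator H_c + v, which yields [nbar_Xop]. *)
Lemma Xop_rec n m : block_invariant lower n -> (m.+1 < m0)%N ->
  Xop j0 m.+2 n = T (j0 - m.+1%:Z) (Xop j0 m.+1 n) + vL *: Xop j0 m.+1 n - Xop j0 m n.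
Proof.
move=> inv lt; rewrite [in T _ _]/= TD TZ T_Xop // scalerA vLK scale1r.
rewrite [LHS]/= -/(Tword (j0 - m%:Z) m.+1 n).
have -> : j0 - m.+1%:Z + 1 = j0 - m%:Z by lia.
by rewrite addrC [RHS]addrC !addrA addNr add0r.
Qed.

Lemma nbar_Xop n m : block_invariant lower n -> nbar N n = n -> (m <= m0)%N ->
  nbar N (Xop j0 m n) = Xop j0 m n.
Proof.
move=> inv bn; have C c (z : N) : nbar N z = z -> nbar N (T c z + vL *: z) = T c z + vL *: z.
  move=> bx; rewrite raddfD nbar_T nbarZ bx barL_v -addrA -scalerDl.
  by rewrite subrK.
have H2 q : (q.+1 <= m0)%N -> nbar N (Xop j0 q n) = Xop j0 q n /\ nbar N (Xop j0 q.+1 n) = Xop j0 q.+1 n.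
  elim: q => [|q IH] h.
    by split=> //=; rewrite subr0 addrC; exact: C.
  have [e1 e2] := IH (ltnW h); split=> //.
  by rewrite Xop_rec // raddfB /= C // e1.
by case: m => [//|m] hm; case: (H2 m hm).
Qed.

(** In effect X_(m+1) = (H_c + v) X_m - Y, where Y is X_(m-1), or 0 for m = 0. Both terms are
    eigenvectors: Y by [T_Xop], the other because every vector in the image of H_c + v is. *)
Lemma T_Xop_top n m : block_invariant lower n -> (m < m0)%N ->
  T (j0 - m%:Z) (Xop j0 m.+1 n) = vLV *: Xop j0 m.+1 n.
Proof.
move=> inv lt; set c := j0 - m%:Z.
have [W [Y [eX eX1 eY]]] : exists W Y, [/\ Xop j0 m n = vL *: Y + W,
    Xop j0 m.+1 n = vL *: Xop j0 m n + T c W & T c Y = vLV *: Y].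
  case: m lt @c => [|m] lt c.
    by exists n, 0; rewrite scaler0 add0r T0 scaler0.
  exists (Tword (j0 - m%:Z) m.+1 n), (Xop j0 m n); split=> //; last exact: T_Xop.
  rewrite [LHS]/= -/(Tword (j0 - m%:Z) m.+1 n) /c.
  by have -> : j0 - m.+1%:Z + 1 = j0 - m%:Z by lia.
have e : T c (Xop j0 m n) = Y + T c W by rewrite eX TD TZ eY scalerA vLK scale1r.
have -> : vLV *: Xop j0 m.+1 n = vL *: Y + W + vLV *: T c W.
  by rewrite eX1 scalerDr scalerA [vLV * vL]mulrC vLK scale1r -eX.
rewrite eX1 TD TZ e T_quadratic scalerDr scalerBl addrACA; congr (_ + _).
by rewrite addrC subrK.
Qed.

(** Below the top, the braid relation carries the generator through the longest word and lowers its
    index by one; it then acts on n within the shortened block. *)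
Lemma T_Xop_inner n m s : block_invariant lower n -> (s < m)%N -> (m <= m0)%N ->
  T (j0 - s%:Z) (Xop j0 m n) = vLV *: Xop j0 m n.
Proof.
move=> inv; elim: m => // m IH sm mm.
case: (eqVneq s m) => [->|ne]; first exact: T_Xop_top.
have kb := block_bound.
rewrite [Xop _ _ _]/= -[T _ (Tword _ _ _)]/(Tword _ m.+1 _) TD TZ IH; [|lia|lia].
have [q eq] : exists q, m = (s + q.+1)%N by exists (m - s).-1; lia.
have -> : j0 - s%:Z = (j0 - m%:Z) + q.+1%:Z by lia.
rewrite Tword_braid; [|lia|lia].
have -> : T (j0 - m%:Z + q%:Z) n = vLV *: n.
  apply: inv; have -> : j0 - m%:Z + q%:Z = j0 - s.+1%:Z by lia.
  have -> : j0 - s.+1%:Z - 1 = j0 - s.+2%:Z by lia.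
  by rewrite !lower_block //; lia.
by rewrite Tword_Z scalerDr !scalerA mulrC.
Qed.

Lemma Xop_invariant n : block_invariant lower n -> block_invariant P' (Xop j0 m0 n).
Proof.
move=> inv c e; have kb := block_bound.
have shift s h : P' (j0 - s%:Z + k%:Z * h) = P' (j0 - s%:Z) - l%:Z * h by rewrite (fundamental_shift _ _ hP').
case: (pselect (exists s, (s < m0)%N /\ cong c (j0 - s%:Z))) => [[s [sm hc]]|nc].
  by rewrite (T_cong _ hc) T_Xop_inner.
(* P' jumps at both ends of the block, so c avoids j0 + 1 and j0 - m0. The remaining generators
   commute with all letters of [Xop]. *)
have c1 : cong c (j0 + 1) = false.
  apply/negP => /congP[h eh]; move: e; rewrite eh.
  have -> : j0 + 1 + k%:Z * h - 1 = j0 + k%:Z * h by lia.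
  by rewrite !(fundamental_shift _ _ hP'); lia.
have c2 : cong c (j0 - m0%:Z) = false.
  apply/negP => /congP[h eh]; move: e; rewrite eh.
  have -> : j0 - m0%:Z + k%:Z * h - 1 = j0 - m0.+1%:Z + k%:Z * h by lia.
  by rewrite !(fundamental_shift _ _ hP') (block (leqnn m0)); lia.
have c3 s : (s <= m0.+1)%N -> cong c (j0 + 1 - s%:Z) = false.
  case: s => [|s] hs; first by rewrite subr0.
  have -> : j0 + 1 - s.+1%:Z = j0 - s%:Z by lia.
  case: (eqVneq s m0) => [->//|ne]; apply/negP => hc; apply: nc.
  by exists s; split=> //; lia.
apply: Xop_comm => //; apply: inv; rewrite /lower e.
congr (_ - Posz (nat_of_bool _)).
have := c3 0%N isT; have := c3 1%N isT; rewrite subr0 addrK => -> h.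
by rewrite -(congDr k' _ _ 1) subrK.
Qed.

End Raise.
End Invariants.

(** * Weighted fiber sums and bar invariance at rho *)

Section FiberSums.
Variables (R : realType) (k' l' : nat).
Local Notation k := (k'.+2).
Local Notation l := (l'.+2).
Local Notation id_perm := (@id_perm k').
Variables (H : hecke R k l) (N : antispherical H).
Implicit Types (u w y : 'I_k -> int) (i j : 'I_k) (c x : int) (n : N) (a : laurent) (m : nat).
Implicit Types P : int -> int.
Local Notation T := (@T R k' l' H N).
Local Notation kappa := (@kappa R k' l' H N).
Local Notation Nstd := (@Nstd R k' l' H N).
Local Notation max_len := (@max_len k' l').
Local Notation block_invariant := (@block_invariant R k' l' H N).

Lemma fiber_bound P y u i : fundamental k' l' P -> fiber P y u ->
  `|u i| <= k%:Z * (`|P 0 - y i| + 1).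
Proof.
move=> hP hu; have e := fiber_row i hu; pose B : int := `|P 0 - y i| + 1.
have B1 : 0 < B by rewrite /B; lia.
have lB : B <= l%:Z * B by nia.
pose p0 := P (0 : int).
have sh h : P (k%:Z * h) = p0 - l%:Z * h.
  by rewrite -[k%:Z * h](add0r (k%:Z * h)) (fundamental_shift _ _ hP).
have [lo hi] : p0 - B < y i /\ y i < p0 + B.
  by rewrite /B -/p0; move: (p0) => q; lia.
rewrite -/B; clearbody B p0; rewrite ler_norml; apply/andP; split.
  rewrite leNgt; apply/negP => /ltW /(fundamental_le hP).
  by rewrite -mulrN sh e; lia.
rewrite leNgt; apply/negP => /ltW /(fundamental_le hP).
by rewrite sh e; lia.
Qed.

Lemma fiber_finite P y : fundamental k' l' P -> finite_set [set u | fiber P y u].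
Proof.
move=> hP; pose B := (\sum_i k * (`|P 0 - y i|%N + 1))%N.
pose g (f : {ffun 'I_k -> 'I_(B + B).+1}) : 'I_k -> int := fun i => (f i)%:Z - B%:Z.
apply: (@sub_finite_set _ _ (g @` setT)); last exact/finite_image/finite_finset.
move=> u /= hu; exists [ffun i : 'I_k => inord `|(u i + B%:Z)%R|%N] => //.
apply/funext => i; rewrite /g ffunE.
have : `|u i| <= B%:Z.
  apply: (le_trans (fiber_bound i hP hu)); rewrite /B (bigD1 i) //=.
  by move: (\sum_(_ | _) _)%N => S; rewrite PoszD PoszM PoszD abszE lerDl.
move=> hB; rewrite inordK; lia.
Qed.

Definition Mvec P y : N :=
  \sum_(u \in [set u | fiber P y u]) vpow ((max_len y)%:Z - (ell u)%:Z) *: Nstd u.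

Lemma Mvec_seq P y : fundamental k' l' P -> exists r : seq ('I_k -> int),
  [/\ uniq r, forall u, u \in r <-> fiber P y u &
   Mvec P y = \sum_(u <- r) vpow ((max_len y)%:Z - (ell u)%:Z) *: Nstd u].
Proof.
move=> hP; have /finite_seqP[s es] := fiber_finite y hP.
have hs u : (u \in undup s) <-> fiber P y u.
  by rewrite mem_undup; have := congr1 (fun X => X u) es => /= ->.
exists (undup s); split=> //; first exact: undup_uniq.
rewrite /Mvec (fsbigE (undup s)) ?undup_uniq //.
- rewrite big_seq_cond [RHS]big_seq; apply: eq_bigl => u; apply/andb_idr => /hs h.
  by rewrite inE.
- by move=> u /= /hs.
by move=> u /hs ->.
Qed.

Lemma kappa_Mvec P y w : fundamental k' l' P -> decreasing y ->
  kappa (Mvec P y) w = if `[< fiber P y w >] then vpow ((max_len y)%:Z - (ell w)%:Z) else 0.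
Proof.
move=> hP dy; have [r [ur hr ->]] := Mvec_seq y hP; rewrite kappa_sum.
have e : \sum_(u <- r) kappa (vpow ((max_len y)%:Z - (ell u)%:Z) *: Nstd u) w =
    \sum_(u <- r) (if u == w then vpow ((max_len y)%:Z - (ell w)%:Z) else 0).
  rewrite !big_seq; apply: eq_bigr => u /hr hu; rewrite kappaZ kappa_Nstd; last exact: (fiber_increasing hP dy hu).
    by case: eqP => [->|_]; rewrite ?mulr1 ?mulr0.
  by case: hu.
rewrite e; case: asboolP => [/hr hw|nw].
  rewrite (bigD1_seq w) //= eqxx big1 ?addr0 // => u /negPf -> //.
rewrite big_seq big1 // => u /hr hu; case: eqP => // eu.
by rewrite eu in hu.
Qed.

(** A descent inside the fiber shortens u by 1 and so multiplies the weight by v; a tie of levels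
    would repeat an entry of y. *)
Lemma Mvec_invariant P y : fundamental k' l' P -> decreasing y -> block_invariant P (Mvec P y).
Proof.
move=> hP dy c e; apply: eigen_kappa => u hu inc lt; rewrite !kappa_Mvec //.
  case: asboolP => // hf; have [_ [a [b [eb e1 ha hb]]]] := lev_adjacent hu inc lt.
  have ab : a = b.
    apply: (decreasing_inj dy).
    by have := fiber_lev hP hf ha; have := fiber_lev hP hf hb; rewrite -e lt; lia.
  by move: eb; rewrite ab; lia.
have ef : `[< fiber P y (act u c) >] = `[< fiber P y u >].
  apply/asbool_equiv_eq; split; last exact: (fiber_act hP e).
  by move=> /(fiber_act hP e); rewrite actK.
rewrite ef; case: ifP => _; last by rewrite mulr0.
by rewrite -vpowS (lev_down hu lt); congr vpow; lia.
Qed.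

(** A filtration by length with respect to which the bar involution is unitriangular
    ([nbar_Nstd]). *)
Definition below m n := forall u, valid u -> increasing u -> kappa n u <> 0 -> (ell u < m)%N.

Lemma belowW m m' n : (m <= m')%N -> below m n -> below m' n.
Proof. by move=> le h u hu inc /(h u hu inc) lt; apply: leq_trans le. Qed.

Lemma belowD m n n' : below m n -> below m n' -> below m (n + n').
Proof.
move=> h h' u hu inc; rewrite kappaD => nz.
case: (pselect (kappa n u = 0)) => [e|]; last exact: h.
by apply: h' => //; rewrite e add0r in nz.
Qed.

Lemma belowZ m a n : below m n -> below m (a *: n).
Proof.
move=> h u hu inc; rewrite kappaZ => nz; apply: h => // e.
by apply: nz; rewrite e mulr0.
Qed.

Lemma below0 m : below m 0.
Proof. by move=> u _ _; rewrite kappa0. Qed.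

Lemma below_Nstd m u : valid u -> increasing u -> (ell u < m)%N -> below m (Nstd u).
Proof.
move=> hu inc lt w hw _; rewrite kappa_Nstd //; case: eqP => [<-//|_]; by case.
Qed.

Lemma below_T m c n : below m n -> below m.+1 (T c n).
Proof.
move=> h u hu inc; rewrite kappa_T // => nz.
case: (pselect (kappa n u = 0)) => [e|]; last by move=> /(h u hu inc)/ltnW.
move: nz; rewrite e mulr0 addr0; case: eqP => // /eqP ne /(h _ (act_valid c hu)).
move=> /(_ (lev_increasing hu inc ne)).
case: (ltgtP (lev u (c - 1)) (lev u c)) ne => // lt _.
  by rewrite (lev_up hu lt); lia.
by rewrite (lev_down hu lt); lia.
Qed.

Lemma nbar_Nstd u : valid u -> increasing u -> below (ell u) (nbar N (Nstd u) - Nstd u).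
Proof.
move: {2}(ell u) (erefl (ell u)) => m; elim: m u => [|m IH] u em hu inc.
  have -> : u = id_perm.
    by apply: contrapT => /(increasing_descent hu inc)[c [_ _]]; rewrite em.
  have -> : Nstd id_perm = tens N 1 1.
    by rewrite /Nstd /nstd -[hstd _ _]/(Hstd H id_perm) Hstd_id.
  by rewrite nbar_tens barL1 rmorph1 subrr; exact: below0.
have ne : u <> id_perm by move=> e; move: em; rewrite e ell_id.
have [c0 hc0] := exists_descent hu ne.
have [c [inc' hv e]] := increasing_descent hu inc ne.
have lt' : lev (act u c) (c - 1) < lev (act u c) c.
  rewrite ltNge; apply/negP; rewrite le_eqVlt => /orP[/eqP h|h].
    by have [] := lev_adjacent hv inc' (esym h); rewrite actK.
  by have := lev_down hv h; rewrite actK e; lia.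
have eN := T_up N hv lt'; rewrite actK in eN.
have {}IH := IH (act u c) _ hv inc'; rewrite -eN nbar_T.
set x := Nstd (act u c) in IH eN *.
have eD : nbar N x = (nbar N x - x) + x by rewrite subrK.
rewrite addrAC -TN -TD; apply: belowD.
  by rewrite e; apply: below_T; apply: IH; lia.
apply: belowZ; rewrite eD; apply: belowD.
  by apply: (@belowW (ell (act u c))); [rewrite e | apply: IH; lia].
by apply: below_Nstd => //; rewrite e.
Qed.

Definition rho i : int := k'.+1%:Z - i%:Z.

Lemma rho_decreasing : decreasing rho.
Proof. by move=> i j ij; rewrite /rho; lia. Qed.

(** The entries of a decreasing integer point drop at least as fast as those of rho. *)
Lemma max_len_rho y : decreasing y -> (max_len rho <= max_len y)%N.
Proof.
move=> dy; apply: leq_sum => -[i j] /= ij.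
have step (s : nat) (hs : (i + s < k)%N) : s%:Z <= y i - y (Ordinal hs).
  elim: s hs => [|s IH] hs.
    have e : Ordinal hs = i by apply: val_inj; rewrite /= addn0.
    by rewrite e subrr.
  have hs' : (i + s < k)%N by lia.
  have := IH hs'; have := dy (Ordinal hs') (Ordinal hs); rewrite /=; lia.
have hj : (i + (j - i) < k)%N by rewrite subnKC // ltnW.
have := step (j - i)%N hj; have -> : Ordinal hj = j by apply: val_inj; rewrite /= subnKC // ltnW.
move=> h; have e : rho i - rho j = (j - i)%N%:Z by rewrite /rho; lia.
rewrite e; have h0 : 0 <= (((j - i)%N)%:Z %/ l%:Z)%Z by rewrite divz_ge0.
have : (((j - i)%N)%:Z %/ l%:Z)%Z <= ((y i - y j) %/ l%:Z)%Z
  by have [h1 _] := @fl_bounds l isT (j - i)%N%:Z; rewrite fl_le //; lia.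
by lia.
Qed.

Lemma nbar_Mvec_rho P : fundamental k' l' P -> nbar N (Mvec P rho) = Mvec P rho.
Proof.
move=> hP; apply/eqP; rewrite -subr_eq0; apply/eqP.
set D := _ - _; have dr := rho_decreasing.
have inv : block_invariant P D.
  apply: invariantD; first exact/invariant_nbar/Mvec_invariant.
  by rewrite -scaleN1r; apply/invariantZ/Mvec_invariant.
have bel : below (max_len rho) D.
  have [r [_ hr eM]] := Mvec_seq rho hP.
  rewrite /D eM raddf_sum -sumrB big_seq.
  apply: (big_ind (below (max_len rho))); [exact: below0|exact: belowD|].
  move=> u /hr hf; have hu := hf.1; have inc := fiber_increasing hP dr hf.
  have le := fiber_ell hP dr hf; rewrite nbarZ.
  have hN := nbar_Nstd hu inc.
  case: (ltngtP (ell u) (max_len rho)) le => // [lt _|eu _].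
    apply: belowD.
      apply: belowZ; rewrite -[nbar N _](subrK (Nstd u)); apply: belowD.
        exact: belowW (ltnW lt) hN.
      exact: below_Nstd.
    by rewrite -scaleN1r; do 2!apply: belowZ; exact: below_Nstd.
  (* A term of top length has weight 1, so bar conjugation changes it in lower length alone. *)
  by rewrite eu subrr vpow0 barL1 !scale1r -eu.
apply: (invariant_eq0 hP inv) => w hw wi wmin; apply: contrapT => nz.
have hf : fiber P (P \o w) w by [].
have dy := block_minimal_decreasing hP hw wi wmin.
have [P1 [u1 [hP1 hf1 fl]]] := exists_maximal_fiber l' dy.
have eP := fiber_unique hP hP1 hf hf1; rewrite -eP in hf1.
(* Nonvanishing spreads from w to its whole fiber, since each descent changes the coefficient by a
   factor v. The longest window of the fiber then contradicts [bel]. *)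
have conn u : fiber P (P \o w) u -> kappa D u <> 0.
  have [m] := ubnP (ell u); elim: m u => // m IH u um hu.
  case: (pselect (block_minimal P u)) => [mu|/(fiber_descend hP dy hu)[c [e hc lt eu]]].
    by rewrite (block_minimal_unique hP dy hu hf mu wmin).
  have uinc := fiber_increasing hP dy hu.
  have [_ /(_ lt) e2] := kappa_eigen P (inv c e) hu.1 uinc.
  move=> e0; apply: (IH _ _ hc); first by lia.
  by rewrite e2 e0 mulr0.
have := bel u1 hf1.1 (fiber_increasing hP dy hf1) (conn u1 hf1).
rewrite (max_len_floors dy fl) => h; have := max_len_rho dy; lia.
Qed.

End FiberSums.

(** * Raising one entry of a point *)

Section RaisedPoint.
Variables (k' l' : nat).
Local Notation k := (k'.+2).
Local Notation l := (l'.+2).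
Local Notation congl := (cong l').
Implicit Types (y : 'I_k -> int) (i j a b : 'I_k) (x C : int).
Local Notation max_len := (@max_len k' l').

Definition raise y a i : int := y i + (i == a)%:Z.

(** The exponent N of the Fock space in terms of lam + rho, seen as beads on an abacus with l
    runners; the link is [bead_exponent_shifted] with [N_exponentE]. *)
Definition bead_exponent C y a : int :=
  \sum_(b < k | (b < a)%N) ((congl (y b) C)%:Z - (congl (y b) (C + 1))%:Z).

Lemma max_len_sum y : decreasing y ->
  (max_len y)%:Z = \sum_(i < k) \sum_(j < k | (i < j)%N) ((y i - y j) %/ l%:Z)%Z.
Proof.
move=> dy; rewrite /max_len -natz natr_sum pair_big_dep /=.
apply: eq_bigr => -[i j] /= ij; rewrite natz gez0_abs // divz_ge0 //.
by have := dy i j ij; lia.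
Qed.

Lemma fl_succ (x : int) : ((x + 1) %/ l%:Z)%Z = (x %/ l%:Z)%Z + (l%:Z %| x + 1)%Z%:Z.
Proof. by have := @fl_pred l isT (x + 1); rewrite addrK => ->; rewrite subrK. Qed.

(** Only floors involving row a can change: one with a later row goes up by 1, one with an earlier
    row goes down by 1, exactly when the new, respectively the old difference is a multiple of l. *)
Lemma max_len_raise y a : decreasing y -> decreasing (raise y a) ->
  (max_len (raise y a))%:Z = (max_len y)%:Z + \sum_(b < k | (a < b)%N) (congl (y b) (y a + 1))%:Z
    - \sum_(b < k | (b < a)%N) (congl (y b) (y a))%:Z.
Proof.
move=> dy dy'; rewrite !max_len_sum //.
have e i j : (i < j)%N -> ((raise y a i - raise y a j) %/ l%:Z)%Z = ((y i - y j) %/ l%:Z)%Z +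
    ((if i == a then (congl (y j) (y a + 1))%:Z else 0) -
     (if j == a then (congl (y i) (y a))%:Z else 0)).
  move=> ij; rewrite /raise; case: (eqVneq i a) => [ia|ia].
    have ja : j != a by apply: contraTneq ij => ->; rewrite ia ltnn.
    rewrite (_ : y i + _ - (y j + _) = y i - y j + 1); last by rewrite (negPf ja) /=; lia.
    rewrite (negPf ja) subr0 fl_succ; congr (_ + Posz (nat_of_bool _)).
    by rewrite cong_sym /congl ia; congr (_ %| _)%Z; lia.
  case: (eqVneq j a) => [ja|ja]; last by rewrite !addr0.
  rewrite (_ : y i + _ - (y j + _) = y i - y j - 1); last by rewrite /=; lia.
  by rewrite fl_pred // sub0r /congl ja.
under eq_bigr => i _ do (under eq_bigr => j ij do rewrite e //; rewrite big_split sumrB /=).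
rewrite big_split sumrB /= -!addrA; congr (_ + (_ - _)).
  rewrite (bigD1 a) //= [X in _ + X]big1 ?addr0; last by move=> i /negPf ->; rewrite big1.
  by apply: eq_bigr => b _; rewrite eqxx.
rewrite (exchange_big_dep xpredT) //= (bigD1 a) //= [X in _ + X]big1 ?addr0.
  by apply: eq_bigr => i _; rewrite eqxx.
by move=> j /negPf ->; rewrite big1.
Qed.

End RaisedPoint.

(** * Symmetrizing a fiber sum raises the point *)

Section RaisingIdentity.
Variables (R : realType) (k' l' : nat).
Local Notation k := (k'.+2).
Local Notation l := (l'.+2).
Local Notation congl := (cong l').
Local Notation cong := (cong k').
Variables (H : hecke R k l) (N : antispherical H).
Implicit Types (w y : 'I_k -> int) (i j b : 'I_k) (c x : int) (n : N) (t : nat).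
Local Notation kappa := (@kappa R k' l' H N).
Local Notation Tword := (@Tword R k' l' H N).
Local Notation max_len := (@max_len k' l').
Local Notation Xop := (@Xop R k' l' H N).
Local Notation Mvec := (@Mvec R k' l' H N).

Fixpoint rotate w c t := if t is t'.+1 then rotate (act w c) (c + 1) t' else w.

(** If every letter is an ascent, [kappa_T] has no diagonal term and the coefficient is just moved
    along the word. *)
Lemma kappa_Tword c t w n : valid w -> increasing w -> (t < k)%N ->
  (forall s : nat, (s < t)%N -> lev w (c - 1) < lev w (c + s%:Z)) ->
  [/\ kappa (Tword c t n) w = kappa n (rotate w c t), ell (rotate w c t) = (ell w + t)%N,
      valid (rotate w c t) & increasing (rotate w c t)].
Proof.
elim: t w c => [|t IH] w c hw inc tk h; first by rewrite addn0.
have h0 : lev w (c - 1) < lev w c by have := h 0%N isT; rewrite addr0.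
have inc' : increasing (act w c) by apply: lev_increasing => //; lia.
have [|s st|e1 e2 e3 e4] := IH (act w c) (c + 1) (act_valid c hw) inc'; first by lia.
  rewrite addrK !lev_swap // swap_r swap_out.
  - have -> : c + 1 + s%:Z = c + s.+1%:Z by lia.
    exact: (h s.+1 st).
  - by apply: cong_neq; lia.
  by apply: cong_neq; lia.
split=> //; last by rewrite e2 (lev_up hw h0) addSnnS.
rewrite [Tword _ _ _]/= kappa_T // /eps h0 mul0r addr0.
by rewrite ifF //; apply/negP => /eqP; lia.
Qed.

Lemma rotate_value P w c t i : fundamental k' l' P ->
  (forall s : nat, (s < t)%N -> P (c - 1 + s%:Z) = P (c + s%:Z)) -> P (rotate w c t i) = P (w i).
Proof.
move=> hP; elim: t w c => //= t IH w c h; rewrite IH => [|s st].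
  by rewrite actE (fundamental_swap _ hP) //; have := h 0%N isT; rewrite !addr0.
have := h s.+1 st; have -> : c + 1 - 1 + s%:Z = c - 1 + s.+1%:Z by lia.
by have -> : c + 1 + s%:Z = c + s.+1%:Z by lia.
Qed.

Lemma rotate_cong w c t i : cong (rotate w c t i) (c - 1 + t%:Z) = cong (w i) (c - 1).
Proof.
elim: t w c => [|t IH] w c /=; first by rewrite addr0.
have -> : c - 1 + t.+1%:Z = c + 1 - 1 + t%:Z by lia.
by rewrite IH addrK actE -[X in cong _ X](swap_l k' c) swap_cong.
Qed.

Section Identity.
Variables (P' : int -> int) (j0 : int) (m0 : nat).
Hypothesis hP' : fundamental k' l' P'.
Hypothesis block : forall s : nat, (s <= m0)%N -> P' (j0 - s%:Z) = P' j0.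
Hypothesis block_r : P' (j0 + 1) < P' j0.
Hypothesis block_l : P' j0 < P' (j0 - m0.+1%:Z).
Local Notation lower := (@lower k' P' j0).

Let kb : (m0 < k)%N.
Proof. exact: (@block_bound k' l' P' j0 m0 hP' block block_r block_l). Qed.

Lemma lower_fundamental : fundamental k' l' lower.
Proof.
split=> x; rewrite /lower.
  rewrite hP'.1 (congr_cong (x' := x) (y' := j0)) ?cong_refl //; first by lia.
  by apply/congP; exists 1; lia.
have := hP'.2 x; case: (boolP (cong x j0)) => [/congP[h ->]|_]; last by case: (cong _ _); lia.
have -> : j0 + k%:Z * h + 1 = j0 + 1 + k%:Z * h by lia.
by rewrite !(fundamental_shift _ _ hP'); case: (cong _ _); lia.
Qed.

Lemma block_position x : congl (P' x) (P' j0) -> exists2 s, (s <= m0)%N & cong x (j0 - s%:Z).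
Proof.
move=> /congP[h e]; have e1 : P' (x + k%:Z * h) = P' j0.
  by rewrite (fundamental_shift _ _ hP') e; lia.
have le1 : x + k%:Z * h <= j0.
  rewrite leNgt; apply/negP => lt.
  have : P' (x + k%:Z * h) <= P' (j0 + 1) by apply: (fundamental_le hP'); lia.
  by lia.
have le2 : j0 - m0%:Z <= x + k%:Z * h.
  rewrite leNgt; apply/negP => lt.
  have : P' (j0 - m0.+1%:Z) <= P' (x + k%:Z * h) by apply: (fundamental_le hP'); lia.
  by lia.
exists `|(j0 - (x + k%:Z * h))%R|%N; first by lia.
by apply/congP; exists (- h); lia.
Qed.

Lemma Xop_sum n m : Xop j0 m n = \sum_(s < m.+1) vpow (m%:Z - s%:Z) *: Tword (j0 - s%:Z + 1) s n.
Proof.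
elim: m => [|m IH]; first by rewrite big_ord_recl big_ord0 addr0 subrr vpow0 scale1r.
rewrite [LHS]/= -/(Tword (j0 - m%:Z) m.+1 n) IH scaler_sumr [RHS]big_ord_recr /= subrr vpow0 scale1r.
congr (_ + _).
  apply: eq_bigr => s _; rewrite scalerA -vpowS; congr (vpow _ *: _); lia.
by have -> : j0 - m.+1%:Z + 1 = j0 - m%:Z by lia.
Qed.

Lemma cong_block s s' : (s <= m0)%N -> (s' <= m0)%N ->
  cong (j0 - s%:Z) (j0 - s'%:Z) -> s = s'.
Proof. by move=> hs hs' /cong_small h; have := h ltac:(lia); lia. Qed.

(** At a block minimal window all letters of the symmetrizer are ascents. The word of length s
    rotates the row at position j0 - s to j0, the position where [lower] differs from P'. *)
Lemma kappa_Xop_Mvec y w : decreasing y -> valid w -> increasing w -> block_minimal P' w ->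
  kappa (Xop j0 m0 (Mvec lower y)) w =
  \sum_(s < m0.+1) if `[< forall i, P' (w i) = y i + (cong (w i) (j0 - s%:Z))%:Z >] then
     vpow (m0%:Z - s%:Z + (max_len y)%:Z - (ell w)%:Z - s%:Z) else 0.
Proof.
move=> dy hw inc min; rewrite Xop_sum kappa_sum; apply: eq_bigr => -[s hs] _ /=.
have sm : (s <= m0)%N by [].
have [|t ts|e1 e2 e3 e4] := @kappa_Tword (j0 - s%:Z + 1) s w (Mvec lower y) hw inc.
- by lia.
- rewrite addrK; apply: (block_minimal_lt hP' min); last by lia.
  have -> : j0 - s%:Z + 1 + t%:Z = j0 - (s - t.+1)%N%:Z by lia.
  by rewrite !block //; lia.
rewrite kappaZ e1 kappa_Mvec //; last exact: lower_fundamental.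
have hv i : P' (rotate w (j0 - s%:Z + 1) s i) = P' (w i).
  apply: (rotate_value _ _ hP') => t ts.
  have -> : j0 - s%:Z + 1 - 1 + t%:Z = j0 - (s - t)%N%:Z by lia.
  have -> : j0 - s%:Z + 1 + t%:Z = j0 - (s - t.+1)%N%:Z by lia.
  by rewrite !block //; lia.
have hc i : cong (rotate w (j0 - s%:Z + 1) s i) j0 = cong (w i) (j0 - s%:Z).
  have := rotate_cong w (j0 - s%:Z + 1) s i; rewrite addrK => <-.
  by congr (cong _ _); lia.
have -> : `[< fiber lower y (rotate w (j0 - s%:Z + 1) s) >] =
    `[< forall i, P' (w i) = y i + (cong (w i) (j0 - s%:Z))%:Z >].
  apply/asbool_equiv_eq; split=> [[_ e] i|e].
    by rewrite -e /= /lower hv hc subrK.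
  by split=> //; apply/funext => i /=; rewrite /lower hv hc e addrK.
by case: ifP => _; rewrite ?mulr0 // -vpowD e2; congr vpow; lia.
Qed.

(** Both sides are block invariant for P', so it suffices to compare coefficients at block minimal
    w. Either both vanish, or [P' \o w] is y raised in one row a and both are powers of v; s0 then
    is the distance of row a from the end j0 of the block. *)
Lemma Xop_Mvec C y : congl (P' j0) (C + 1) -> decreasing y ->
  Xop j0 m0 (Mvec lower y) =
  \sum_(a < k | congl (y a) C && `[< decreasing (raise y a) >])
     vpow (bead_exponent l' C y a) *: Mvec P' (raise y a).
Proof.
move=> hC dy; apply/eqP; rewrite -subr_eq0; apply/eqP.
apply: (invariant_eq0 hP').
  apply: invariantD.
    apply: Xop_invariant => //; apply: Mvec_invariant => //; exact: lower_fundamental.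
  rewrite -scaleN1r; apply: invariantZ; apply: invariant_sum => a /andP[_ /asboolP da].
  by apply: invariantZ; exact: Mvec_invariant.
move=> w hw inc min; rewrite kappaD kappaN kappa_sum kappa_Xop_Mvec //; apply/eqP.
rewrite subr_eq0; apply/eqP.
have dw := block_minimal_decreasing hP' hw inc min.
have hf : fiber P' (P' \o w) w by [].
have congC a : (forall i, P' (w i) = raise y a i) -> congl (y a) C = congl (P' (w a)) (P' j0).
  move=> e; rewrite e /raise eqxx; apply/esym.
  rewrite -(congDr l' (y a) C 1); apply: congr_cong => //; exact: cong_refl.
case: (pselect (exists a s, [/\ (s <= m0)%N, cong (w a) (j0 - s%:Z) &
    forall i, P' (w i) = raise y a i])) => [[a [s0 [hs0 ca eP]]]|none]; last first.
  rewrite [LHS]big1 ?[RHS]big1 //.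
    move=> a /andP[ha /asboolP da]; rewrite kappaZ kappa_Mvec //; case: asboolP; rewrite ?mulr0 //.
    move=> [_ ea]; case: none.
    have e i : P' (w i) = raise y a i by rewrite -ea.
    have hq := ha; rewrite (congC a e) in hq; have [s hs hc] := block_position hq.
    by exists a, s.
  move=> [s hs] _ /=; case: asboolP => // e; case: none.
  have [a ha] := row_exists (j0 - s%:Z) hw; exists a, s; split=> // i.
  by rewrite e /raise (cong_row i hw ha).
have er : P' \o w = raise y a by apply/funext => i /=.
have ha : congl (y a) C.
  rewrite congC //; have /congP[h ->] := ca; rewrite (fundamental_shift _ _ hP') block //.
  by apply/congP; exists (- h); lia.
rewrite (bigD1 (Ordinal (hs0 : (s0 < m0.+1)%N))) //= big1 ?addr0; last first.
  move=> [s hs] /= ns; case: asboolP => // e.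
  case/eqP: ns; apply: val_inj => /=; apply: cong_block => //.
  have : cong (w a) (j0 - s%:Z) by have := e a; rewrite eP /raise eqxx; case: (cong _ _) => //; lia.
  by move=> h; apply: cong_trans ca; rewrite cong_sym.
rewrite [RHS](bigD1 a) /=; last by rewrite ha; apply/asboolP; rewrite -er.
rewrite [X in _ = _ + X]big1 ?addr0; last first.
  move=> a' /andP[/andP[_ /asboolP da'] na]; rewrite kappaZ kappa_Mvec //.
  case: asboolP; rewrite ?mulr0 // => -[_ e].
  have := congr1 (fun f => f a) e; rewrite /= eP /raise eqxx [a == a']eq_sym (negPf na).
  by lia.
have dr : decreasing (raise y a) by rewrite -er.
rewrite kappaZ kappa_Mvec // !ifT; [|by apply/asboolP|apply/asboolP => i]; last first.
  by rewrite eP /raise (cong_row i hw ca).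
rewrite -vpowD; congr vpow.
rewrite max_len_raise //.
(* The rows b with [y b] congruent to C + 1 fill the other m0 positions of the block. Block
   minimality orders them: s0 of them precede row a and m0 - s0 follow it. *)
suff key : \sum_(b < k | (a < b)%N) (congl (y b) (C + 1))%:Z = m0%:Z - s0%:Z :> int /\
    \sum_(b < k | (b < a)%N) (congl (y b) (C + 1))%:Z = s0%:Z :> int.
  have [k1 k2] := key.
  pose S : int := \sum_(b < k | (b < a)%N) (congl (y b) C)%:Z.
  have -> : bead_exponent l' C y a = S - s0%:Z by rewrite /bead_exponent sumrB k2.
  have -> : \sum_(b < k | (a < b)%N) (congl (y b) (y a + 1))%:Z = m0%:Z - s0%:Z :> int.
    rewrite -k1; apply: eq_bigr => b _; congr (Posz (nat_of_bool _)).
    by apply: congr_cong; rewrite ?cong_refl // congDr.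
  have -> : \sum_(b < k | (b < a)%N) (congl (y b) (y a))%:Z = S :> int.
    by apply: eq_bigr => b _; congr (Posz (nat_of_bool _)); apply: congr_cong; rewrite ?cong_refl.
  by clearbody S; lia.
have bead b : b != a -> (congl (y b) (C + 1))%:Z = \sum_(s < m0.+1) (cong (w b) (j0 - s%:Z))%:Z :> int.
  move=> nb; have yb : y b = P' (w b) by rewrite eP /raise (negPf nb) addr0.
  have -> : congl (y b) (C + 1) = congl (P' (w b)) (P' j0).
    by rewrite yb; apply: congr_cong; rewrite ?cong_refl // cong_sym.
  case: (boolP (congl _ _)) => [/block_position[s hs hc]|nc].
    rewrite (bigD1 (Ordinal (hs : (s < m0.+1)%N))) //= hc big1 // => -[s' hs'] /= ns.
    case: (boolP (cong _ _)) => // hc'; case/eqP: ns; apply: val_inj => /=.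
    by apply: cong_block => //; apply: cong_trans hc; rewrite cong_sym.
  rewrite big1 // => -[s hs] _ /=; case: (boolP (cong _ _)) => // /congP[h eh].
  by move/negP: nc; case; rewrite eh (fundamental_shift _ _ hP') block //; apply/congP; exists (- h); lia.
have order s b : (s <= m0)%N -> cong (w b) (j0 - s%:Z) ->
    (b < a)%N = (s < s0)%N /\ (a < b)%N = (s0 < s)%N.
  move=> hs hb.
  have e1 := fiber_lev hP' hf hb; have e2 := fiber_lev hP' hf ca.
  rewrite !block // /= in e1 e2.
  have lt i j : (P' (w i) < P' (w j)) = (j < i)%N.
    case: (ltngtP j i) => [/dw//|/dw|/val_inj ->]; last by rewrite ltxx.
    by move=> /= h; apply/negbTE; rewrite -leNgt ltW.
  rewrite -!lt; case: (ltngtP s s0) => c.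
  - have := @block_minimal_lt k' l' P' w (j0 - s0%:Z) (j0 - s%:Z) hP' min.
    by rewrite !block // => /(_ erefl ltac:(lia)); nia.
  - have := @block_minimal_lt k' l' P' w (j0 - s%:Z) (j0 - s0%:Z) hP' min.
    by rewrite !block // => /(_ erefl ltac:(lia)); nia.
  by rewrite c in e1; have -> : b = a by apply: hw.1; apply: (cong_trans hb); rewrite c cong_sym.
have count (Q : pred 'I_k) (q : pred nat) : ~~ Q a ->
    (forall s b, (s <= m0)%N -> cong (w b) (j0 - s%:Z) -> Q b = q s) ->
    \sum_(b < k | Q b) (congl (y b) (C + 1))%:Z = \sum_(s < m0.+1) (q s)%:Z :> int.
  move=> nQa hQ.
  have -> : \sum_(b < k | Q b) (congl (y b) (C + 1))%:Z =
      \sum_(b < k | Q b) \sum_(s < m0.+1) (cong (w b) (j0 - s%:Z))%:Z :> int.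
    by apply: eq_bigr => b Qb; apply: bead; apply: contraNneq nQa => <-.
  rewrite exchange_big /=; apply: eq_bigr => -[s hs] _ /=.
  have [b hb] := row_exists (j0 - s%:Z) hw.
  have eb i : cong (w i) (j0 - s%:Z) = (i == b) by exact: cong_row.
  rewrite -(hQ s b) //; case: (boolP (Q b)) => Qb.
    rewrite (bigD1 b) //= eb eqxx big1 // => i /andP[_ /negPf ni].
    by rewrite eb ni.
  rewrite big1 // => i Qi; rewrite eb; case: eqP => // e.
  by rewrite e (negPf Qb) in Qi.
split.
  rewrite (count _ (fun s => s0 < s)%N) ?ltnn //; last by move=> s b hs /(order s b hs)[].
  have e (m : nat) : \sum_(s < m) (s0 < s)%N%:Z = (m - s0.+1)%N%:Z :> int.
    elim: m => [|m IH]; first by rewrite big_ord0.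
    by rewrite big_ord_recr /= IH; lia.
  by rewrite e; lia.
rewrite (count _ (fun s => s < s0)%N) ?ltnn //; last by move=> s b hs /(order s b hs)[].
have e (m : nat) : \sum_(s < m) (s < s0)%N%:Z = (minn m s0)%:Z :> int.
  elim: m => [|m IH]; first by rewrite big_ord0 min0n.
  by rewrite big_ord_recr /= IH; lia.
by rewrite e; lia.
Qed.

End Identity.
End RaisingIdentity.

(** * Rows, indent nodes and removable nodes of Young diagrams *)

Section YoungDiagrams.
Implicit Types (lam mu : young) (a b i : nat).

Lemma row_len_step lam i : (row_len lam i.+1 <= row_len lam i)%N.
Proof.
have /andP[/(sortedP 0%N) s _] := valP lam.
rewrite /row_len; case: (ltnP i.+1 (size lam)) => h; first exact: s.
by rewrite nth_default.
Qed.

Lemma row_len_le lam i j : (i <= j)%N -> (row_len lam j <= row_len lam i)%N.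
Proof.
move=> /subnK <-; elim: (j - i)%N => // n IH.
by rewrite addSn; apply: leq_trans IH; exact: row_len_step.
Qed.

Lemma row_len_gt0 lam i : (0 < row_len lam i)%N = (i < size lam)%N.
Proof.
rewrite /row_len; case: (ltnP i (size lam)) => h; last by rewrite nth_default.
have /andP[_ n0] := valP lam; rewrite lt0n; apply: contraNneq n0 => <-.
exact: mem_nth.
Qed.

Lemma young_eq lam mu : (forall i, row_len lam i = row_len mu i) -> lam = mu.
Proof.
move=> e; have es : size lam = size mu.
  case: (ltngtP (size lam) (size mu)) => // h.
    by have := row_len_gt0 mu (size lam); rewrite h -e row_len_gt0 ltnn.
  by have := row_len_gt0 lam (size mu); rewrite h e row_len_gt0 ltnn.
by apply/val_inj/(@eq_from_nth _ 0%N) => // i _; exact: e.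
Qed.

Lemma young_intro (s : seq nat) : (forall i, (nth 0 s i.+1 <= nth 0 s i)%N) ->
  (forall i, (i < size s)%N -> (0 < nth 0 s i)%N) -> is_young s.
Proof.
move=> h1 h2; apply/andP; split; first by apply/(sortedP 0%N) => i _; exact: h1.
apply/negP => /(nthP 0%N)[i hi e].
by have := h2 i hi; rewrite e.
Qed.

Definition indentable lam a := (a == 0%N) || (row_len lam a < row_len lam a.-1)%N.

Lemma incr_nth_young lam a : ((a <= size lam)%N && is_young (incr_nth lam a)) = indentable lam a.
Proof.
apply/andP/idP => [[le /andP[/(sortedP 0%N) s _]]|ind].
  rewrite /indentable; case: a le s => // a le s /=.
  have := s a; rewrite !nth_incr_nth eqxx /= [_ == a]gtn_eqF // => h; apply: h.
  by rewrite size_incr_nth; case: ifP => // _; exact: ltnSn.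
have le : (a <= size lam)%N.
  move: ind; rewrite /indentable; case: a => // a /= lt.
  by rewrite -row_len_gt0; lia.
split=> //; apply: young_intro => i; rewrite ?nth_incr_nth.
  rewrite -!/(row_len lam _); have := row_len_step lam i; move: ind; rewrite /indentable.
  case: (eqVneq a i.+1) => [->|na]; last by case: (a == i); lia.
  by rewrite /= [_ == i]gtn_eqF.
rewrite size_incr_nth -/(row_len lam i) => hi; have := row_len_gt0 lam i.
move=> h; rewrite addn_gt0 h; move: hi; case: (ltnP a (size lam)) => hs hi; first by rewrite hi orbT.
case: (eqVneq a i) => //= ne; lia.
Qed.

Lemma row_len_add lam a i : indentable lam a ->
  row_len (add_node lam a) i = ((a == i) + row_len lam i)%N.
Proof.
rewrite -incr_nth_young => /andP[_ h].
by rewrite /row_len /add_node insubdK // nth_incr_nth.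
Qed.

Lemma size_add_node lam a : indentable lam a -> size (add_node lam a) = maxn (size lam) a.+1.
Proof.
move=> ind; have := ind; rewrite -incr_nth_young => /andP[le h].
rewrite /add_node insubdK // size_incr_nth; case: ltnP; lia.
Qed.

Section Residues.
Variable l' : nat.
Local Notation l := (l'.+2).
Local Notation congl := (cong l').
Implicit Types r : 'I_l.

(** The content of the first node after row a. The last node of the row has content one less, which
    explains r + 1 in the description of removable nodes. *)
Definition node_content lam a : int := (row_len lam a)%:Z - a%:Z.

Lemma residueE r (x : int) : ((x %% l%:Z)%Z == r%:Z) = congl x r%:Z.
Proof.
have hr : ((r : nat)%:Z %% l%:Z)%Z = r%:Z by rewrite modz_small //= ltz_nat ltn_ord.
by rewrite -{1}hr eqz_mod_dvd.
Qed.

Lemma indentE r lam a : indent r lam a = congl (node_content lam a) r%:Z && indentable lam a.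
Proof.
by rewrite /indent /has_residue residueE -incr_nth_young andbCA.
Qed.

Lemma removableE r lam a : removable r lam a =
  congl (node_content lam a) (r%:Z + 1) && (row_len lam a.+1 < row_len lam a)%N.
Proof.
rewrite /removable -row_len_gt0 /has_residue residueE.
case: (posnP (row_len lam a)) => [->|pos] /=; first by rewrite andbF.
congr (_ && _).
  by rewrite -(congDr l' _ (r%:Z) 1); congr (congl _ _); rewrite /node_content; lia.
apply/idP/idP => [/(sortedP 0%N) s|lt].
  have ha : (a < size lam)%N by rewrite -row_len_gt0.
  case: (ltnP a.+1 (size lam)) => h; last by rewrite {1}/row_len nth_default.
  have := s a; rewrite size_set_nth !nth_set_nth /= eqxx gtn_eqF // -/(row_len lam _).
  by rewrite (maxn_idPr ha) => /(_ h) /=; lia.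
apply/(sortedP 0%N) => i _; rewrite !nth_set_nth /= -!/(row_len lam _).
have := row_len_step lam i; have := row_len_step lam i.+1.
case: (eqVneq i.+1 a) => [<-|_].
  by rewrite ltn_eqF // => _; apply: leq_trans; exact: leq_pred.
by case: eqP => [->|//] _ _; rewrite -ltnS prednK.
Qed.

Definition content_exponent r lam a : int :=
  \sum_(b < a) ((congl (node_content lam b) r%:Z)%:Z - (congl (node_content lam b) (r%:Z + 1))%:Z).

(* A node of residue [r] covered by the row above cancels against the end of
   that row, so it does not matter that it is no indent node. *)
Lemma N_exponentE r lam a : indent r lam a -> N_exponent r lam a = content_exponent r lam a.
Proof.
rewrite indentE => /andP[_ ind].
pose e b : int := (congl (node_content lam b) r%:Z && ((0 < b)%N && (row_len lam b.-1 == row_len lam b)))%:Z.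
have h b : (indent r lam b)%:Z - (removable r lam b)%:Z =
  ((congl (node_content lam b) r%:Z)%:Z - (congl (node_content lam b) (r%:Z + 1))%:Z) - (e b - e b.+1).
  rewrite indentE removableE /e /indentable /=.
  have s1 := row_len_step lam b.
  have c1 : row_len lam b = row_len lam b.+1 ->
      congl (node_content lam b.+1) r%:Z = congl (node_content lam b) (r%:Z + 1).
    by move=> eq; rewrite -(congDr l' _ r%:Z 1); congr (congl _ _); rewrite /node_content eq; lia.
  have i1 : (b == 0%N) || (row_len lam b < row_len lam b.-1)%N =
      ~~ ((0 < b)%N && (row_len lam b.-1 == row_len lam b)).
    case: b {s1 c1} => //= b; have := row_len_step lam b; lia.
  rewrite i1; case: (eqVneq (row_len lam b) (row_len lam b.+1)) => [eq|ne].
    rewrite c1 // -eq ltnn andbF andbT; move: ((0 < b)%N && _) => B.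
    by case: (congl _ r%:Z); case: B; case: (congl _ _).
  have -> : (row_len lam b.+1 < row_len lam b)%N by rewrite ltn_neqAle eq_sym ne.
  rewrite !andbF !andbT; move: ((0 < b)%N && _) => B.
  by case: (congl _ r%:Z); case: B; case: (congl _ _).
rewrite /N_exponent /content_exponent.
have tele n : \sum_(b < n) (e b - e b.+1) = - e n.
  elim: n => [|n IH]; first by rewrite big_ord0 /e /= andbF oppr0.
  by rewrite big_ord_recr /= IH addrA addNr sub0r.
have ea : e a = 0.
  rewrite /e; move: ind; rewrite /indentable; case: (a) => [_|b /= lt]; first by rewrite andbF.
  by rewrite gtn_eqF // andbF.
rewrite -[X in X - _]natz -[X in _ - X]natz !natr_sum -sumrB.
under eq_bigr do rewrite !natz h.
by rewrite sumrB tele ea oppr0 subr0.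
Qed.

End Residues.
End YoungDiagrams.

(** * Linear functions on the Fock space *)

Section FockLinear.

Definition linear_fun (M : lmodType Qv) (F : fock -> M) :=
  (forall x y, F (x + y) = F x + F y) /\ (forall (a : Qv) x, F (a *: x) = a *: F x).

Lemma scale_diagram (a : Qv) lam : a *: diagram lam = << a *g lam >> :> fock.
Proof.
by apply/eqP/freeg_eqP => mu; rewrite coeffZ !coeffU mul1r.
Qed.

Lemma fock_sum (x : fock) : x = \sum_(lam <- dom x) fock_coeff lam x *: diagram lam.
Proof.
rewrite -[LHS]freeg_sumE; apply: eq_bigr => lam _.
by rewrite scale_diagram.
Qed.

Lemma fock_ind (Q : fock -> Prop) : Q 0 -> (forall x y, Q x -> Q y -> Q (x + y)) ->
  (forall a lam, Q (a *: diagram lam)) -> forall x, Q x.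
Proof.
by move=> Q0 QD Qa x; rewrite (fock_sum x); apply: big_ind.
Qed.

Lemma linear_fun0 (M : lmodType Qv) (F : fock -> M) : linear_fun F -> F 0 = 0.
Proof. by move=> [_ h]; rewrite -[0](scale0r (0 : fock)) h scale0r. Qed.

Lemma linear_fun_sum (M : lmodType Qv) (F : fock -> M) (I : Type) (r : seq I) (Q : pred I) f :
  linear_fun F -> F (\sum_(i <- r | Q i) f i) = \sum_(i <- r | Q i) F (f i).
Proof. by move=> hF; apply: (big_morph F hF.1 (linear_fun0 hF)). Qed.

Lemma fglift_linear (M : lmodType Qv) (f : young -> M) : linear_fun (fglift f : fock -> M).
Proof.
have B x y : fglift f (x - y) = fglift f x - fglift f y := lift_is_additive f x y.
have f0 : fglift f (0 : fock) = 0 by have := B 0 0; rewrite !subrr.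
have D x y : fglift f (x + y) = fglift f x + fglift f y.
  by rewrite -[y in LHS]opprK B -[- y]sub0r B f0 sub0r opprK.
split=> // a x; elim/fock_ind: x => [|x y e1 e2|b lam].
- by rewrite scaler0 f0 scaler0.
- by rewrite scalerDr !D scalerDr e1 e2.
by rewrite scalerA !scale_diagram !liftU scalerA.
Qed.

Lemma fglift_diagram (M : lmodType Qv) (f : young -> M) lam : fglift f (diagram lam) = f lam.
Proof. by rewrite -[diagram lam]scale1r scale_diagram liftU scale1r. Qed.

Lemma linear_fun_ext (M : lmodType Qv) (F F' : fock -> M) : linear_fun F -> linear_fun F' ->
  (forall lam, F (diagram lam) = F' (diagram lam)) -> F =1 F'.
Proof.
move=> hF hF' e x; elim/fock_ind: x => [|x y e1 e2|a lam].
- by rewrite !linear_fun0.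
- by rewrite hF.1 hF'.1 e1 e2.
by rewrite hF.2 hF'.2 e.
Qed.

Lemma fock_coeff_linear lam : linear_fun (fock_coeff lam : fock -> Qv^o).
Proof. by split=> [x y|a x]; [exact: coeffD | exact: coeffZ]. Qed.

Lemma fock_coeff_diagram lam mu : fock_coeff lam (diagram mu) = (mu == lam)%:R.
Proof. by rewrite /fock_coeff coeffU mul1r. Qed.

End FockLinear.

(** * Rational Laurent polynomials and quantum integers *)

Section LaurentQ.

Lemma laurentQ_poly p : laurentQ (ofQX p).
Proof. by exists p, 0%N; rewrite expr0 divr1. Qed.

Lemma laurentQM x y : laurentQ x -> laurentQ y -> laurentQ (x * y).
Proof.
move=> [p [n ->]] [q [m ->]]; exists (p * q), (n + m)%N.
by rewrite rmorphM exprD invfM mulrACA.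
Qed.

Lemma laurentQD x y : laurentQ x -> laurentQ y -> laurentQ (x + y).
Proof.
move=> [p [n ->]] [q [m ->]]; exists (p * 'X^m + q * 'X^n), (n + m)%N.
have vE i : v ^+ i = ofQX 'X^i by rewrite rmorphXn.
have h i : v ^+ i != 0 by rewrite expf_neq0 // v_neq0.
apply/(canRL (mulfK (h _))); rewrite rmorphD !rmorphM -!vE mulrDl exprD.
by rewrite mulrA (divfK (h n)) // [_ ^+ n * _]mulrC mulrA (divfK (h m)).
Qed.

Lemma laurentQ_vX (n : int) : laurentQ (v ^ n).
Proof.
case: n => n; first by rewrite -exprnP -[v ^+ n]rmorphXn; exact: laurentQ_poly.
by exists 1, n.+1; rewrite rmorph1 div1r.
Qed.

Lemma laurentQ0 : laurentQ 0.
Proof. by rewrite -(rmorph0 ofQX); exact: laurentQ_poly. Qed.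

Lemma laurentQ1 : laurentQ 1.
Proof. by rewrite -(rmorph1 ofQX); exact: laurentQ_poly. Qed.

Lemma laurentQN x : laurentQ x -> laurentQ (- x).
Proof.
move=> h; rewrite -mulN1r; apply: laurentQM => //.
by rewrite -(rmorphN1 ofQX); exact: laurentQ_poly.
Qed.

Lemma laurentQ_laurent (a : laurent) : laurentQ (val a).
Proof.
have /asboolP[p [n ->]] := valP a.
by exists (map_poly intr p), n.
Qed.

(** This is v^(1-m) [m], the form in which the quantum integer arises from operators that commute up
    to v^(-2). *)
Definition qsum m : Qv := \sum_(j < m) v ^ (- (2 * j%:Z)).

Lemma v2_neq1 m : (0 < m)%N -> v ^+ m != 1.
Proof.
move=> m0; rewrite -subr_eq0 -(rmorph1 ofQX) -rmorphXn -rmorphB ofQX_eq0.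
rewrite -size_poly_eq0 size_XnsubC //.
Qed.

Lemma v_sub_neq0 : v - v^-1 != 0.
Proof.
have := v2_neq1 (isT : 0 < 2)%N; apply: contraNneq => /eqP.
rewrite subr_eq0 => /eqP e; rewrite expr2 {2}e divff //; exact: v_neq0.
Qed.

Lemma qint_qsum m : qint m.+1 = v ^+ m * qsum m.+1.
Proof.
apply: (mulIf v_sub_neq0); rewrite (divfK v_sub_neq0).
elim: m => [|m IH].
  by rewrite /qsum big_ord1 mulr0 oppr0 expr0z !mulr1 mul1r expr1 .
have e : v ^+ m.+1 * qsum m.+2 = v * (v ^+ m * qsum m.+1) + v ^- m.+1.
  rewrite /qsum [in LHS]big_ord_recr /= mulrDr mulrA -exprS; congr (_ + _).
  rewrite [v ^+ _]exprnP exprnN -(expfzDr _ _ v_neq0); congr (v ^ _); lia.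
rewrite e mulrDl -mulrA -IH mulrBr -exprS.
have e1 : v * v ^- m.+1 = v ^- m.
  by rewrite exprS invfM mulrA (mulfV v_neq0) mul1r.
have e2 : v ^- m.+1 * v^-1 = v ^- m.+2 by rewrite [in RHS]exprS invfM mulrC.
rewrite mulrBr [v ^- m.+1 * v]mulrC e1 e2 addrA subrK.
by [].
Qed.

Lemma qint_neq0 m : qint m.+1 != 0.
Proof.
have vm : v ^+ m.+1 != 0 := expf_neq0 _ v_neq0.
apply: mulf_neq0; last by rewrite invr_eq0; exact: v_sub_neq0.
rewrite subr_eq0; have h : (0 < m.+1 + m.+1)%N by rewrite addSn; exact: ltn0Sn.
have := v2_neq1 h; apply: contraNneq => e.
by rewrite exprD {2}e (divff vm).
Qed.

Lemma qfact0 : qfact 0 = 1. Proof. by rewrite /qfact big_nil. Qed.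

Lemma qfactS m : qfact m.+1 = qfact m * qint m.+1.
Proof. by rewrite /qfact big_nat_recr. Qed.

End LaurentQ.

(** * Divided powers preserve Laurent coefficients *)

Section AddNodes.
Variable l' : nat.
Local Notation l := (l'.+2).
Local Notation congl := (cong l').
Variable r : 'I_l.
Implicit Types (lam mu : young) (a b n : nat) (x y : fock).
Local Notation e := (content_exponent r).

(** The part of f_r that adds a node in row a. These parts q-commute for different rows and have
    square 0, which makes the divided powers of their sum computable. *)
Definition add_diagram a lam : fock :=
  if indent r lam a then v ^ e lam a *: diagram (add_node lam a) else 0.

Definition add_op a : fock -> fock := fglift (add_diagram a).
Definition add_ops n x : fock := \sum_(a < n) add_op a x.

Lemma add_op_linear a : linear_fun (add_op a).
Proof. exact: fglift_linear. Qed.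

Lemma add_opE a lam : add_op a (diagram lam) = add_diagram a lam.
Proof. exact: fglift_diagram. Qed.

Lemma add_ops_linear n : linear_fun (add_ops n).
Proof.
split=> [x y|c x].
  by rewrite -big_split; apply: eq_bigr => a _; rewrite (add_op_linear a).1.
by rewrite scaler_sumr; apply: eq_bigr => a _; rewrite (add_op_linear a).2.
Qed.

Lemma content_add lam a b : indentable lam a ->
  node_content (add_node lam a) b = node_content lam b + (a == b)%:Z.
Proof. by move=> h; rewrite /node_content row_len_add //; lia. Qed.

(** The new node could create an indent node only in the next row, when that row is as long as row a
    was; but then the node in question has residue r - 1. *)
Lemma indent_add_gt lam a b : (a < b)%N -> indent r lam a ->
  indent r (add_node lam a) b = indent r lam b.
Proof.
move=> ab; rewrite !indentE => /andP[ca ia]; rewrite content_add // ltn_eqF // addr0.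
case cb: (congl _ _) => //=; rewrite /indentable !row_len_add //.
rewrite [a == b]ltn_eqF //; case: b ab cb => // b ab cb /=.
case: (eqVneq a b) => // eab; subst b.
suff : row_len lam a.+1 != row_len lam a by have := row_len_step lam a; lia.
apply/eqP => eq; have := cong_sub1 l' (node_content lam a).
rewrite (cong_trans (y := r%:Z)) //; last by rewrite cong_sym.
by move: cb; congr (congl _ _); rewrite /node_content eq; lia.
Qed.

Lemma indent_add_lt lam a b : (a < b)%N -> indent r lam b ->
  indent r (add_node lam b) a = indent r lam a.
Proof.
move=> ab; rewrite !indentE => /andP[cb ib]; rewrite content_add // gtn_eqF // addr0.
congr (_ && _); rewrite /indentable !row_len_add //.
rewrite [b == a]gtn_eqF // [b == a.-1]gtn_eqF //.
by apply: leq_ltn_trans ab; exact: leq_pred.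
Qed.

(** The end of row a passes from residue r, counted +1, to residue r + 1, counted -1. *)
Lemma exponent_add_gt lam a b : (a < b)%N -> indent r lam a ->
  e (add_node lam a) b = e lam b - 2.
Proof.
move=> ab; rewrite indentE => /andP[ca ia]; rewrite /content_exponent.
rewrite (bigD1 (Ordinal ab)) //= [in RHS](bigD1 (Ordinal ab)) //= content_add // eqxx ca.
rewrite (_ : congl (node_content lam a + 1%:Z) r%:Z = false); last first.
  rewrite (congr_cong (x' := r%:Z + 1) (y' := r%:Z)) ?congDr ?cong_refl //.
  exact: cong_add1.
rewrite congDr ca (_ : congl (node_content lam a) (r%:Z + 1) = false); last first.
  rewrite (congr_cong (x' := r%:Z) (y' := r%:Z + 1)) ?cong_refl // cong_sym.
  exact: cong_add1.
rewrite (eq_bigr (fun i : 'I_b => (congl (node_content lam i) r%:Z)%:Z - (congl (node_content lam i) (r%:Z + 1))%:Z)).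
  by move: (\sum_(i < b | _) _) => S /=; lia.
move=> i ni; rewrite content_add // (_ : (a == i) = false) ?addr0 //.
by apply/eqP => h; case/eqP: ni; apply: val_inj.
Qed.

Lemma exponent_add_lt lam a b : (a < b)%N -> indent r lam b ->
  e (add_node lam b) a = e lam a.
Proof.
move=> ab; rewrite indentE => /andP[cb ib]; apply: eq_bigr => i _.
rewrite content_add // gtn_eqF ?addr0 //.
by apply: ltn_trans ab.
Qed.

Lemma add_op_comm a b x : (a < b)%N ->
  add_op b (add_op a x) = v ^ (- 2 : int) *: add_op a (add_op b x).
Proof.
move=> ab; have La := add_op_linear a; have Lb := add_op_linear b; move: x.
apply: linear_fun_ext => [||lam].
- by split=> [x y|c x]; rewrite ?La.1 ?Lb.1 ?La.2 ?Lb.2.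
- split=> [x y|c x]; rewrite ?Lb.1 ?La.1 ?scalerDr //.
  by rewrite Lb.2 La.2 !scalerA mulrC.
rewrite !add_opE /add_diagram; case: (boolP (indent r lam a)) => ia; last first.
  rewrite (linear_fun0 Lb); case: (boolP (indent r lam b)) => ib; last by rewrite (linear_fun0 La) scaler0.
  by rewrite La.2 add_opE /add_diagram indent_add_lt // (negPf ia) !scaler0.
rewrite Lb.2 add_opE /add_diagram indent_add_gt //.
case: (boolP (indent r lam b)) => ib; last by rewrite (linear_fun0 La) !scaler0.
rewrite La.2 add_opE /add_diagram indent_add_lt // ia !scalerA -!expfzDr ?v_neq0 //.
rewrite exponent_add_gt // exponent_add_lt //; congr (v ^ _ *: diagram _); first by lia.
have /andP[_ ja] : congl (node_content lam a) r%:Z && indentable lam a by rewrite -indentE.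
have /andP[_ jb] : congl (node_content lam b) r%:Z && indentable lam b by rewrite -indentE.
have := indent_add_gt ab ia; rewrite ib indentE => /andP[_ jab].
have := indent_add_lt ab ib; rewrite ia indentE => /andP[_ jba].
by apply: young_eq => i; rewrite !row_len_add //; lia.
Qed.

(** The next node of the same row has residue r + 1, which differs from r as l > 1. *)
Lemma add_op_sq a x : add_op a (add_op a x) = 0.
Proof.
have La := add_op_linear a; move: x; apply: linear_fun_ext => [||lam].
- by split=> [x y|c x]; rewrite ?La.1 ?La.2.
- by split=> [x y|c x]; rewrite ?addr0 ?scaler0.
rewrite add_opE /add_diagram; case: ifP => ia; last by rewrite (linear_fun0 La).
rewrite La.2 add_opE /add_diagram indentE content_add; last by move: ia; rewrite indentE => /andP[].
rewrite eqxx (_ : congl _ _ = false) ?scaler0 //.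
move: ia; rewrite indentE => /andP[ca _].
rewrite (congr_cong (x' := r%:Z + 1) (y' := r%:Z)) ?congDr ?cong_refl //.
exact: cong_add1.
Qed.

Lemma add_op_iter a n m x : (n <= a)%N ->
  add_op a (iter m (add_ops n) x) = v ^ (- (2 * m%:Z)) *: iter m (add_ops n) (add_op a x).
Proof.
move=> na; elim: m => [|m IH]; first by rewrite mulr0 oppr0 expr0z scale1r.
rewrite !iterS /add_ops (linear_fun_sum _ _ _ (add_op_linear a)).
rewrite scaler_sumr; apply: eq_bigr => b _.
rewrite add_op_comm; last by apply: leq_trans na.
rewrite IH (add_op_linear b).2 scalerA -expfzDr ?v_neq0 //; congr (v ^ _ *: _); lia.
Qed.

Lemma iter_linear m (F : fock -> fock) : linear_fun F -> linear_fun (iter m F).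
Proof.
move=> hF; elim: m => [|m [IH1 IH2]]; first by split.
by split=> [x y|c x]; rewrite !iterS ?IH1 ?IH2 ?hF.1 ?hF.2.
Qed.

Lemma add_opsS n x : add_ops n.+1 x = add_ops n x + add_op n x.
Proof. by rewrite /add_ops big_ord_recr. Qed.

(* The q-binomial formula for the q-commuting operators [add_ops n] and
   [add_op n]; it has two terms since the square of the latter is 0. *)
Lemma iter_add_opsS n m x : iter m.+1 (add_ops n.+1) x =
  iter m.+1 (add_ops n) x + qsum m.+1 *: iter m (add_ops n) (add_op n x).
Proof.
have Ln := add_op_linear n; have Ls := add_ops_linear n.
elim: m => [|m IH]; first by rewrite /qsum big_ord1 mulr0 oppr0 expr0z scale1r /= add_opsS.
rewrite iterS IH add_opsS Ls.1 Ls.2 Ln.1 Ln.2 add_op_iter // add_op_iter //.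
rewrite add_op_sq (linear_fun0 (iter_linear m Ls)) !scaler0 addr0 -addrA -!iterS; congr (_ + _).
by rewrite /qsum [in RHS]big_ord_recr /= [in RHS]scalerDl.
Qed.

Definition laurent_coeffs x := forall lam, laurentQ (fock_coeff lam x).

Lemma laurent_coeffsD x y : laurent_coeffs x -> laurent_coeffs y -> laurent_coeffs (x + y).
Proof. by move=> hx hy lam; rewrite (fock_coeff_linear lam).1; exact: laurentQD. Qed.

Lemma laurent_coeffsZ c x : laurentQ c -> laurent_coeffs x -> laurent_coeffs (c *: x).
Proof. by move=> hc hx lam; rewrite (fock_coeff_linear lam).2; exact: laurentQM. Qed.

Lemma laurent_coeffs0 : laurent_coeffs 0.
Proof. by move=> lam; rewrite (linear_fun0 (fock_coeff_linear lam)); exact: laurentQ0. Qed.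

Lemma laurent_coeffs_diagram lam : laurent_coeffs (diagram lam).
Proof.
move=> mu; rewrite fock_coeff_diagram; case: eqP => _; [exact: laurentQ1|exact: laurentQ0].
Qed.

Lemma laurent_coeffs_add_op a x : laurent_coeffs x -> laurent_coeffs (add_op a x).
Proof.
move=> hx; have La := add_op_linear a; rewrite (fock_sum x) (linear_fun_sum _ _ _ La).
apply: big_ind; [exact: laurent_coeffs0|exact: laurent_coeffsD|].
move=> lam _; rewrite La.2 add_opE; apply: laurent_coeffsZ; first exact: hx.
rewrite /add_diagram; case: ifP => _; last exact: laurent_coeffs0.
by apply: laurent_coeffsZ; [exact: laurentQ_vX|exact: laurent_coeffs_diagram].
Qed.

(** Induction on the number of rows by the q-binomial formula. Its second term is harmless:
    [qsum m.+1] divided by [m+1] is a power of v, which leaves [m]! as denominator. *)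
Lemma laurent_coeffs_divided n m x : laurent_coeffs x ->
  laurent_coeffs ((qfact m)^-1 *: iter m (add_ops n) x).
Proof.
elim: n m x => [|n IH] [|m] x hx; rewrite ?qfact0 ?invr1 ?scale1r //.
  by rewrite iterS /add_ops big_ord0 scaler0; exact: laurent_coeffs0.
rewrite iter_add_opsS scalerDr; apply: laurent_coeffsD; first exact: IH.
have -> : (qfact m.+1)^-1 *: (qsum m.+1 *: iter m (add_ops n) (add_op n x)) =
    v ^- m *: ((qfact m)^-1 *: iter m (add_ops n) (add_op n x)).
  rewrite !scalerA; congr (_ *: _).
  have q0 := qint_neq0 m; have vm : v ^+ m != 0 := expf_neq0 _ v_neq0.
  have eq : qsum m.+1 = v ^- m * qint m.+1 by rewrite qint_qsum mulrA (mulVf vm) mul1r.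
  rewrite qfactS invfM eq [v ^- m * _]mulrC mulrA -[_ * _^-1 * _]mulrA (mulVf q0) mulr1.
  by rewrite mulrC.
apply: laurent_coeffsZ; first by rewrite exprnN; exact: laurentQ_vX.
by apply: IH; exact: laurent_coeffs_add_op.
Qed.

(** On such x the operator f_r, whose range of rows varies with the diagram, agrees with the fixed
    operator [add_ops n]. *)
Definition size_below n x := forall lam, fock_coeff lam x != 0 -> (size lam < n)%N.

Lemma f_diagramE lam n : (size lam < n)%N -> f_diagram r lam = add_ops n (diagram lam).
Proof.
move=> hn; rewrite /f_diagram /add_ops.
under [RHS]eq_bigr do rewrite add_opE.
rewrite (big_ord_widen_cond n (fun a => indent r lam a)
   (fun a => v ^ N_exponent r lam a *: diagram (add_node lam a))) //.
rewrite big_mkcond /=; apply: eq_bigr => a _; rewrite /add_diagram.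
case: (boolP (indent r lam a)) => ia /=; last by [].
have ha : (a <= size lam)%N by move: ia; rewrite /indent => /and3P[].
by rewrite ltnS ha N_exponentE.
Qed.

Lemma f_op_linear : linear_fun (f_op r).
Proof. exact: fglift_linear. Qed.

Lemma f_opE lam : f_op r (diagram lam) = f_diagram r lam.
Proof. exact: fglift_diagram. Qed.

Lemma f_op_add_ops n x : size_below n x -> f_op r x = add_ops n x.
Proof.
move=> hx; rewrite (fock_sum x) (linear_fun_sum _ _ _ f_op_linear).
rewrite (linear_fun_sum _ _ _ (add_ops_linear n)) !big_seq; apply: eq_bigr => lam.
by rewrite mem_dom => /hx h; rewrite f_op_linear.2 (add_ops_linear n).2 f_opE (f_diagramE h).
Qed.

Lemma size_belowD n x y : size_below n x -> size_below n y -> size_below n (x + y).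
Proof.
move=> hx hy lam; rewrite (fock_coeff_linear lam).1.
case: (eqVneq (fock_coeff lam x) 0) => [->|/hx //]; rewrite add0r; exact: hy.
Qed.

Lemma size_belowZ n c x : size_below n x -> size_below n (c *: x).
Proof.
move=> hx lam; rewrite (fock_coeff_linear lam).2 => h; apply: hx.
by apply: contraNneq h => ->; rewrite scaler0.
Qed.

Lemma size_below0 n : size_below n 0.
Proof. by move=> lam; rewrite (linear_fun0 (fock_coeff_linear lam)) eqxx. Qed.

Lemma size_below_f_op n x : size_below n x -> size_below n.+1 (f_op r x).
Proof.
move=> hx; rewrite (fock_sum x) (linear_fun_sum _ _ _ f_op_linear) big_seq.
apply: big_ind; [exact: size_below0|exact: size_belowD|].
move=> lam; rewrite mem_dom => /hx h; rewrite f_op_linear.2; apply: size_belowZ.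
rewrite f_opE /f_diagram; apply: big_ind; [exact: size_below0|exact: size_belowD|].
move=> a; rewrite indentE => /andP[_ ia]; apply: size_belowZ => mu.
rewrite fock_coeff_diagram; case: (eqVneq (add_node lam a) mu) => [<- _|_]; last by rewrite mulr0n eqxx.
by rewrite size_add_node //; have := ltn_ord a; lia.
Qed.

Lemma size_below_iter n m x : size_below n x -> size_below (n + m) (iter m (f_op r) x).
Proof.
move=> h; elim: m => [|m IH]; first by rewrite addn0.
by rewrite addnS iterS; exact: size_below_f_op.
Qed.

Lemma size_belowW n m x : (n <= m)%N -> size_below n x -> size_below m x.
Proof. by move=> le h lam /h lt; apply: leq_trans le. Qed.

Lemma iter_f_op n m x : size_below n x -> iter m (f_op r) x = iter m (add_ops (n + m)) x.
Proof.
move=> h; have H j : (j <= m)%N -> iter j (f_op r) x = iter j (add_ops (n + m)) x.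
  elim: j => [//|j IH hj]; rewrite iterS [RHS]iterS -(IH (ltnW hj)); apply: f_op_add_ops.
  have le : (n + j <= n + m)%N by rewrite leq_add2l ltnW.
  exact: (size_belowW le (size_below_iter h)).
exact: H.
Qed.

Lemma size_below_exists x : exists n, size_below n x.
Proof.
exists (\max_(lam <- dom x) (size lam)).+1 => lam hl.
by rewrite ltnS; apply: leq_bigmax_seq; rewrite // mem_dom.
Qed.

Lemma laurent_coeffs_f_div m x : laurent_coeffs x -> laurent_coeffs (f_div (r, m) x).
Proof.
move=> hx; have [n hn] := size_below_exists x.
by rewrite /f_div /= (iter_f_op m hn); exact: laurent_coeffs_divided.
Qed.

End AddNodes.

Lemma laurent_coeffs_M_Q l' x : M_Q l'.+2 x -> laurent_coeffs x.
Proof.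
move=> [c /combination_seq[s [_ _ _ hc ->]]].
apply: big_ind; [exact: laurent_coeffs0|exact: laurent_coeffsD|].
move=> w _; apply: laurent_coeffsZ => //.
elim: w => [|[r m] w IH]; first exact: laurent_coeffs_diagram.
exact: laurent_coeffs_f_div.
Qed.

(** * Diagrams shifted by rho *)

Section ShiftedDiagrams.
Variables (k' l' : nat).
Local Notation k := (k'.+2).
Local Notation l := (l'.+2).
Local Notation congl := (cong l').
Implicit Types (lam mu : young) (i a : 'I_k).

Definition shifted lam (i : 'I_k) : int := (row_len lam i + (k.-1 - i))%N%:Z.

Lemma shiftedE lam i : shifted lam i = node_content lam i + k'.+1%:Z.
Proof. by rewrite /shifted /node_content /=; have := ltn_ord i; lia. Qed.

Lemma rho_shift_int_point (R : realType) lam : rho_shift R k lam = int_point R (shifted lam).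
Proof. by apply/rowP => i; rewrite !mxE. Qed.

Lemma shifted_decreasing lam : decreasing (shifted lam).
Proof.
move=> i j ij; rewrite !shiftedE /node_content.
by have := row_len_le lam (ltnW ij); lia.
Qed.

Lemma shifted_empty : shifted empty_diagram = @rho k'.
Proof. by apply/funext => i; rewrite shiftedE /node_content /row_len nth_nil /rho; lia. Qed.

Lemma row_len_out lam n : (size lam <= n)%N -> row_len lam n = 0%N.
Proof. by move=> h; rewrite /row_len nth_default. Qed.

Lemma shifted_inj lam mu : (size lam <= k)%N -> (size mu <= k)%N ->
  shifted lam = shifted mu -> lam = mu.
Proof.
move=> hl hm e; apply: young_eq => n; case: (ltnP n k) => h; last first.
  by rewrite !row_len_out //; exact: leq_trans h.
by have := congr1 (fun f => f (Ordinal h)) e; rewrite /shifted /=; lia.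
Qed.

Lemma shifted_add lam a : indentable lam a -> shifted (add_node lam a) = raise (shifted lam) a.
Proof.
move=> h; apply/funext => i; rewrite /raise /shifted row_len_add //.
by rewrite [i == a]eq_sym -(inj_eq val_inj) /=; lia.
Qed.

Lemma indentable_raise lam a : indentable lam a = `[< decreasing (raise (shifted lam) a) >].
Proof.
apply/idP/asboolP => [h|h]; first by rewrite -shifted_add //; exact: shifted_decreasing.
rewrite /indentable; case: (posnP a) => //= a0.
have lt : (a.-1 < k)%N by apply: leq_ltn_trans (ltn_ord a); exact: leq_pred.
have /(h _ a) : (Ordinal lt < a)%N by rewrite /=; lia.
rewrite /raise eqxx (_ : (Ordinal lt == a) = false) /shifted /=; last first.
  by rewrite -(inj_eq val_inj) /=; lia.
have := ltn_ord a; lia.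
Qed.

Lemma congl_shifted (r : int) lam i :
  congl (shifted lam i) (r + k'.+1%:Z) = congl (node_content lam i) r.
Proof. by rewrite shiftedE congDr. Qed.

Lemma bead_exponent_shifted (r : 'I_l) lam a :
  bead_exponent l' (r%:Z + k'.+1%:Z) (shifted lam) a = content_exponent r lam a.
Proof.
have e (i : 'I_k) : (congl (shifted lam i) (r%:Z + k'.+1%:Z))%:Z - (congl (shifted lam i) (r%:Z + k'.+1%:Z + 1))%:Z
   = (congl (node_content lam i) r%:Z)%:Z - (congl (node_content lam i) (r%:Z + 1))%:Z.
  by rewrite congl_shifted addrAC congl_shifted.
rewrite /bead_exponent /content_exponent.
under eq_bigr do rewrite e.
by rewrite (big_ord_widen k (fun i : nat => (congl (node_content lam i) r%:Z)%:Z - (congl (node_content lam i) (r%:Z + 1))%:Z) (ltnW (ltn_ord a))).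
Qed.

End ShiftedDiagrams.

(** * From the Fock space to the antispherical module *)

Section FockToHecke.
Variables (R : realType) (k' l' : nat).
Local Notation k := (k'.+2).
Local Notation l := (l'.+2).
Local Notation congl := (cong l').
Variables (H : hecke R k l) (N : antispherical H).
Implicit Types (lam : young) (n : N) (g : N -> laurent) (x y : fock) (r : 'I_l).
Local Notation Mvec := (@Mvec R k' l' H N).
Local Notation block_invariant := (@block_invariant R k' l' H N).
Local Notation Xop := (@Xop R k' l' H N).
Local Notation Tword := (@Tword R k' l' H N).
Local Notation shifted := (@shifted k').

Definition laurent_linear g :=
  (forall n n', g (n + n') = g n + g n') /\ (forall (a : laurent) n, g (a *: n) = a * g n).

Lemma laurent_linear0 g : laurent_linear g -> g 0 = 0.
Proof. by move=> [_ h]; rewrite -[0](scale0r (0 : N)) h mul0r. Qed.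

Lemma laurent_linear_sum g (I : Type) (s : seq I) (Q : pred I) (f : I -> N) :
  laurent_linear g -> g (\sum_(i <- s | Q i) f i) = \sum_(i <- s | Q i) g (f i).
Proof. by move=> hg; apply: (big_morph g hg.1 (laurent_linear0 hg)). Qed.

(** The linear form g applied to the image of a Fock space vector, extended linearly from Z[v, v^-1]
    to Q(v). *)
Definition hecke_value g P : fock -> Qv^o :=
  fglift (fun lam => if (size lam <= k)%N then val (g (Mvec P (shifted lam))) : Qv^o else 0).

Lemma hecke_value_linear g P : linear_fun (hecke_value g P).
Proof. exact: fglift_linear. Qed.

Lemma hecke_value_diagram g P lam : hecke_value g P (diagram lam) =
  if (size lam <= k)%N then val (g (Mvec P (shifted lam))) else 0.
Proof. exact: fglift_diagram. Qed.

Lemma val_laurent_sum (I : Type) (s : seq I) (Q : pred I) (f : I -> laurent) :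
  val (\sum_(i <- s | Q i) f i) = \sum_(i <- s | Q i) val (f i).
Proof. by apply: (big_morph val) => [x y|]; [exact: rmorphD|exact: rmorph0]. Qed.

(** Adding a node in one of the rows 0, ..., k - 1 raises an entry of lam + rho. A node in row k
    would give k + 1 rows and contributes 0. *)
Lemma hecke_value_f_diagram g P r lam : laurent_linear g -> (size lam <= k)%N ->
  hecke_value g P (f_diagram r lam) = val (g (\sum_(a < k |
      congl (shifted lam a) (r%:Z + k'.+1%:Z) && `[< decreasing (raise (shifted lam) a) >])
    vpow (bead_exponent l' (r%:Z + k'.+1%:Z) (shifted lam) a) *: Mvec P (raise (shifted lam) a))).
Proof.
move=> hg hs; have hv := hecke_value_linear g P.
rewrite (@f_diagramE l' r lam k.+1) // /add_ops (linear_fun_sum _ _ _ hv) big_ord_recr /=.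
rewrite (laurent_linear_sum _ _ _ hg) val_laurent_sum /= [X in _ + X](_ : _ = 0) ?addr0.
  rewrite [RHS]big_mkcond /=; apply: eq_bigr => a _.
  rewrite add_opE /add_diagram indentE congl_shifted -indentable_raise.
  case: ifP => [/andP[_ ia]|_]; last by rewrite (linear_fun0 hv).
  rewrite hv.2 hecke_value_diagram size_add_node // geq_max hs ltn_ord.
  by rewrite shifted_add // bead_exponent_shifted hg.2 -[RHS]/(val (_ * _)) rmorphM.
rewrite add_opE /add_diagram indentE; case: ifP => [/andP[_ ia]|_]; last by rewrite (linear_fun0 hv).
by rewrite hv.2 hecke_value_diagram size_add_node // geq_max ltnn andbF scaler0.
Qed.

Lemma hecke_value_f_diagram_out g P r lam : (k < size lam)%N ->
  hecke_value g P (f_diagram r lam) = 0.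
Proof.
move=> hs; have hv := hecke_value_linear g P.
rewrite (@f_diagramE l' r lam (size lam).+1) // /add_ops (linear_fun_sum _ _ _ hv) big1 // => a _.
rewrite add_opE /add_diagram indentE; case: ifP => [/andP[_ ia]|_]; last by rewrite (linear_fun0 hv).
by rewrite hv.2 hecke_value_diagram size_add_node // geq_max [(_ <= k)%N]leqNgt hs /= scaler0.
Qed.

Lemma TwordD c t n n' : Tword c t (n + n') = Tword c t n + Tword c t n'.
Proof. by elim: t c => //= t IH c; rewrite IH TD. Qed.

Lemma Xop_linear j0 m : (forall n n', Xop j0 m (n + n') = Xop j0 m n + Xop j0 m n') /\
  (forall a n, Xop j0 m (a *: n) = a *: Xop j0 m n).
Proof.
elim: m => [|m [IH1 IH2]] /=; first by split.
split=> [n n'|a n].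
  by rewrite IH1 scalerDr addrACA -!/(Tword _ _.+1 _) TwordD.
by rewrite IH2 -!/(Tword _ _.+1 _) Tword_Z scalerDr !scalerA mulrC.
Qed.

(** The drop of P' by l over each period bounds the block of x on both sides. *)
Lemma block_exists (P' : int -> int) (x : int) : fundamental k' l' P' -> exists j0 m0,
  [/\ P' j0 = P' x, forall s : nat, (s <= m0)%N -> P' (j0 - s%:Z) = P' j0,
   P' (j0 + 1) < P' j0 & P' j0 < P' (j0 - m0.+1%:Z)].
Proof.
move=> hP'.
have ex : exists t, P' (x + t%:Z) < P' x.
  by exists k; have := fundamental_shift x 1 hP'; rewrite mulr1 => ->; lia.
have [t ht mint] := ex_minnP ex.
have t0 : (0 < t)%N by case: t ht {mint} => //; rewrite addr0 ltxx.
pose j0 := x + t%:Z - 1.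
have ej : P' j0 = P' x.
  apply/eqP; rewrite eq_le (fundamental_le hP') /=; last by rewrite /j0; lia.
  rewrite leNgt; apply/negP => lt; have := mint t.-1.
  have -> : x + t.-1%:Z = j0 by rewrite /j0; lia.
  by move=> /(_ lt); lia.
have ex' : exists s : nat, P' j0 < P' (j0 - s%:Z).
  by exists k; have := fundamental_shift j0 (- 1) hP'; rewrite mulrN1 => ->; lia.
have [s hs mins] := ex_minnP ex'.
have s0 : (0 < s)%N by case: s hs {mins} => //; rewrite subr0 ltxx.
exists j0, s.-1; split; rewrite ?prednK //.
- move=> i hi; apply/eqP; rewrite eq_le [X in _ && X](fundamental_le hP') ?andbT; last by lia.
  by rewrite leNgt; apply/negP => /mins; lia.
by rewrite ej /j0 subrK.
Qed.

(* The operator [X] lifts [f_r]: it is a quantum symmetrization over the block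
   of [P'] reached by adding a node of residue [r], and 0 if there is none. *)
Lemma f_op_lift P' r : fundamental k' l' P' -> exists P X, [/\ fundamental k' l' P,
  forall n, block_invariant P n -> nbar N n = n -> block_invariant P' (X n) /\ nbar N (X n) = X n,
  forall g, laurent_linear g -> laurent_linear (g \o X) &
  forall g lam, laurent_linear g ->
    hecke_value g P' (f_diagram r lam) = hecke_value (g \o X) P (diagram lam)].
Proof.
move=> hP'; pose C : int := r%:Z + k'.+1%:Z.
case: (pselect (exists x : int, congl (P' x) (C + 1))) => [[x hx]|none]; last first.
  exists P', (fun _ => 0); split=> //.
  - by move=> n _ _; split; [exact: invariant0|exact: raddf0].
  - by move=> g hg; split=> [n n'|a n] /=; rewrite (laurent_linear0 hg) ?addr0 ?mulr0.
  move=> g lam hg; rewrite hecke_value_diagram; case: leqP => hs; last exact: hecke_value_f_diagram_out.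
  rewrite hecke_value_f_diagram // big1 // => a /andP[ca _].
  suff -> : Mvec P' (raise (shifted lam) a) = 0 by rewrite scaler0.
  have [s [_ hs' ->]] := Mvec_seq N (raise (shifted lam) a) hP'.
  rewrite big_seq big1 // => u /hs' /fiber_row hu; case: none; exists (u a).
  by rewrite hu /raise eqxx congDr.
have [j0 [m0 [ej block block_r block_l]]] := block_exists x hP'.
have [XD XZ] := Xop_linear j0 m0.
exists (lower k' P' j0), (Xop j0 m0); split.
- exact: (lower_fundamental hP' block block_r block_l).
- move=> n inv bn; split; first exact: (Xop_invariant hP' block block_r block_l inv).
  exact: (nbar_Xop hP' block block_r block_l inv bn (leqnn m0)).
- by move=> g hg; split=> [n n'|a n] /=; rewrite ?XD ?XZ ?hg.1 ?hg.2.
move=> g lam hg; rewrite hecke_value_diagram; case: leqP => hs; last exact: hecke_value_f_diagram_out.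
rewrite hecke_value_f_diagram // -(Xop_Mvec N hP' block block_r block_l) //.
  by rewrite ej.
exact: shifted_decreasing.
Qed.

(** P and g are general in the induction: peeling off the outermost operator replaces P by another
    fundamental point and g by its composite with X. *)
Lemma f_word_lift (w : seq 'I_l) P : fundamental k' l' P -> exists n,
  [/\ block_invariant P n, nbar N n = n &
   forall g, laurent_linear g -> hecke_value g P (f_word w) = val (g n)].
Proof.
elim: w P => [|r w IH] P hP.
  exists (Mvec P (@rho k')); split.
  - by apply: Mvec_invariant => //; exact: rho_decreasing.
  - exact: nbar_Mvec_rho.
  by move=> g hg; rewrite hecke_value_diagram /= shifted_empty.
have [P1 [X [hP1 hX hXg hv]]] := f_op_lift r hP.
have [n [in1 bn en]] := IH P1 hP1.
have [i1 b1] := hX n in1 bn.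
exists (X n); split=> // g hg; rewrite -[RHS]/(val ((g \o X) n)) -(en _ (hXg g hg)).
have hr := f_op_linear r.
rewrite -[f_word (r :: w)]/(f_op r (f_word w)); move: (f_word w).
apply: linear_fun_ext; last by move=> lam; rewrite f_opE hv.
  have h := hecke_value_linear g P.
  by split=> [y z|a y]; rewrite ?hr.1 ?h.1 ?hr.2 ?h.2.
exact: hecke_value_linear.
Qed.

End FockToHecke.

(** * Polynomials in v and regularity at v = 0 *)

Section PolynomialParts.

Lemma combination_sum (A : pzRingType) (M : lmodType A) (I : choiceType) (S : set A)
    (D : set I) (b : I -> M) (c : I -> A) (m : M) (s : seq I) :
  combination S D b c m -> uniq s -> (forall i, i \notin s -> c i = 0) ->
  m = \sum_(i <- s) c i *: b i.
Proof.
move=> /combination_seq[r [ur _ r0 _ ->]] us s0.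
have e (q : seq I) : \sum_(i <- q) c i *: b i = \sum_(i <- q | c i != 0) c i *: b i.
  rewrite (bigID (fun i => c i != 0)) /= [X in _ + X]big1 ?addr0 // => i.
  by rewrite negbK => /eqP ->; rewrite scale0r.
rewrite e [RHS]e -big_filter -[RHS]big_filter; apply: perm_big; apply: uniq_perm; rewrite ?filter_uniq //.
move=> i; rewrite !mem_filter; case: eqP => //= nz.
by rewrite (contrapT (fun h => nz (r0 i (introN idP h)))) (contrapT (fun h => nz (s0 i (introN idP h)))).
Qed.

Definition polynomialL (a : laurent) := exists p : {poly int}, val a = ofZX p.

Lemma polynomialLD a b : polynomialL a -> polynomialL b -> polynomialL (a + b).
Proof. by move=> [p ep] [q eq]; exists (p + q); rewrite [RHS]rmorphD -ep -eq; exact: rmorphD. Qed.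

Lemma polynomialL_nat n : polynomialL n%:R.
Proof. by exists n%:R; rewrite !rmorph_nat. Qed.

Lemma vZvD a b : vZv a -> vZv b -> vZv (a + b).
Proof. by move=> [p ep] [q eq]; exists (p + q); rewrite [in RHS]rmorphD mulrDr -ep -eq; exact: rmorphD. Qed.

Lemma vZvN a : vZv a -> vZv (- a).
Proof. by move=> [p ep]; exists (- p); rewrite [in RHS]rmorphN mulrN -ep; exact: rmorphN. Qed.

Lemma vZvM a b : vZv a -> polynomialL b -> vZv (a * b).
Proof. by move=> [p ep] [q eq]; exists (p * q); rewrite [in RHS]rmorphM mulrA -ep -eq; exact: rmorphM. Qed.

Lemma vZv0 : vZv 0.
Proof. by exists 0; rewrite !rmorph0 mulr0. Qed.

Lemma vZv_polynomialL a : vZv a -> polynomialL a.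
Proof. by move=> [p ep]; exists ('X * p); rewrite ep; rewrite rmorphM /ofZX /= map_polyX. Qed.

Lemma vZv_vpow n : (0 < n)%N -> vZv (vpow n%:Z).
Proof.
case: n => // n _; exists 'X^n.
by rewrite /= /ofZX /= map_polyXn rmorphXn -exprS.
Qed.

Lemma regular_at0_poly p : regular_at0 (ofQX p).
Proof. by exists p, 1; rewrite hornerC oner_neq0 rmorph1 divr1. Qed.

Lemma regular_at0D x y : regular_at0 x -> regular_at0 y -> regular_at0 (x + y).
Proof.
move=> [a [b [b0 ->]]] [c [d [d0 ->]]]; exists (a * d + c * b), (b * d).
rewrite hornerM mulf_neq0 // rmorphD !rmorphM addf_div //.
  by rewrite ofQX_eq0; apply: contraNneq b0 => ->; rewrite horner0.
by rewrite ofQX_eq0; apply: contraNneq d0 => ->; rewrite horner0.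
Qed.

Lemma regular_at0M x y : regular_at0 x -> regular_at0 y -> regular_at0 (x * y).
Proof.
move=> [a [b [b0 ->]]] [c [d [d0 ->]]]; exists (a * c), (b * d).
by rewrite hornerM mulf_neq0 // !rmorphM mulf_div.
Qed.

Lemma regular_at0_polynomialL a : polynomialL a -> regular_at0 (val a).
Proof. by move=> [p ->]; exact: regular_at0_poly. Qed.

End PolynomialParts.

(** * Kazhdan-Lusztig coordinates of the global crystal basis *)

Section KazhdanLusztigCoordinates.
Variables (R : realType) (k' l' : nat).
Local Notation k := (k'.+2).
Local Notation l := (l'.+2).
Local Notation V := 'rV[R]_k.
Local Notation aff := (@aff R k' l').
Variables (H : hecke R k l) (N : antispherical H) (uN : (V -> V) -> N).
Hypothesis huN : kazhdan_lusztig_basis uN.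
Implicit Types (lam mu : young) (n : N) (x : V -> V) (u w : 'I_k -> int) (P : int -> int).
Local Notation Mvec := (@Mvec R k' l' H N).
Local Notation Nstd := (@Nstd R k' l' H N).
Local Notation kappa := (@kappa R k' l' H N).
Local Notation shifted := (@shifted k').
Local Notation hecke_value := (@hecke_value R k' l' H N).
Local Notation max_len := (@max_len k' l').

Definition kl_coord x n : laurent := coordinates (minW l) uN n x.

Lemma kl_coord_linear x : laurent_linear (kl_coord x).
Proof. by split=> *; [exact: (coordinatesD huN.1)|exact: (coordinatesZ huN.1)]. Qed.

Lemma kl_coord_nbar x n : kl_coord x (nbar N n) = barL (kl_coord x n).
Proof.
have [cD cZ] := kl_coord_linear x.
elim/(basis_ind huN.1): n => [|n n' e e'|a i hi].
- by rewrite raddf0 (laurent_linear0 (kl_coord_linear x)) barL0.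
- by rewrite raddfD !cD barLD e e'.
have [e _] := huN.2 i hi.
rewrite nbarZ e !cZ barLM /kl_coord (coordinates_basis huN.1) //.
by case: eqP => _; rewrite ?barL1 ?barL0.
Qed.

(** Induction on length: N_u differs from its Kazhdan-Lusztig element by a combination, with
    coefficients in v Z[v], of elements that are lower in the Bruhat order and hence shorter. *)
Lemma kl_coord_Nstd_aux x m u : (ell u < m)%N -> valid u -> increasing u ->
  vZv (kl_coord x (Nstd u) - (aff u == x)%:R).
Proof.
have hx := kl_coord_linear x.
elim: m u => // m IH u hm hu inc.
have mu : minW l (aff u) by exact/minW_aff.
have [_ [c hc]] := huN.2 _ mu.
have [s [_ hs _ hcs es]] := combination_seq hc.
have -> : Nstd u = uN (aff u) + (-1) *: \sum_(i <- s) c i *: nstd N i.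
  by rewrite -es scaleN1r opprB addrCA subrr addr0.
rewrite hx.1 hx.2 mulN1r (laurent_linear_sum _ _ _ hx).
rewrite {1}/kl_coord (coordinates_basis huN.1) // addrC addrA addNr add0r; apply: vZvN.
rewrite big_seq; apply: big_ind; [exact: vZv0|exact: vZvD|].
move=> i /hs[mi [bi ni]]; rewrite hx.2; apply: vZvM; first exact: hcs.
have /minWP[w [hw incw ew]] := mi.
have lt : (ell w < ell u)%N.
  by case: (bruhat_len bi) => [/ni//|]; rewrite ew !len_aff.
have h : vZv (kl_coord x (Nstd w) - (aff w == x)%:R) by apply: IH => //; lia.
rewrite ew -/(Nstd w) -[X in polynomialL X](subrK (aff w == x)%:R).
by apply: polynomialLD; [exact: vZv_polynomialL|exact: polynomialL_nat].
Qed.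

Lemma kl_coord_Nstd x u : valid u -> increasing u ->
  vZv (kl_coord x (Nstd u) - (aff u == x)%:R).
Proof. exact: (kl_coord_Nstd_aux x (ltnSn _)). Qed.

Lemma kl_coord_Nstd_polynomial x u : valid u -> increasing u -> polynomialL (kl_coord x (Nstd u)).
Proof.
move=> hu inc; rewrite -[X in polynomialL X](subrK (aff u == x)%:R).
by apply: polynomialLD; [apply: vZv_polynomialL; exact: kl_coord_Nstd|exact: polynomialL_nat].
Qed.

Section MaximalFiber.
Variables (y u : 'I_k -> int).
Hypothesis dy : decreasing y.
Hypothesis hu : valid u.
Hypothesis fl : maximal l' y u.

(** If the maximal window u lies in the fiber, its weight is 1. Every other window of the fiber is
    shorter than [max_len y], so its weight is a positive power of v. *)
Lemma kl_coord_Mvec P x : fundamental k' l' P ->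
  vZv (kl_coord x (Mvec P y) - (`[< fiber P y u >] && (aff u == x))%:R).
Proof.
move=> hP; have hx := kl_coord_linear x; have [s [us hs ->]] := Mvec_seq N y hP.
rewrite (laurent_linear_sum _ _ _ hx).
have term w : w \in s -> w != u -> vZv (kl_coord x (vpow ((max_len y)%:Z - (ell w)%:Z) *: Nstd w)).
  move=> /hs hw nw; rewrite hx.2; apply: vZvM; last first.
    by apply: kl_coord_Nstd_polynomial; [exact: hw.1|exact: (fiber_increasing hP dy hw)].
  have le := fiber_ell hP dy hw.
  have lt : (ell w < max_len y)%N.
    rewrite ltn_neqAle le andbT; apply: contraNneq nw => e; apply/eqP.
    apply: (floors_inj hw.1 hu) => i j ij.
    by rewrite (fiber_ell_eq hP dy hw e ij) fl.
  have -> : (max_len y)%:Z - (ell w)%:Z = (max_len y - ell w)%N%:Z by lia.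
  by apply: vZv_vpow; rewrite subn_gt0.
case: asboolP => [hf|nf] /=; last first.
  rewrite subr0 big_seq; apply: big_ind; [exact: vZv0|exact: vZvD|].
  by move=> w hw; apply: term => //; apply: contra_notN nf => /eqP <-; exact/hs.
have us' : u \in s by exact/hs.
rewrite (bigD1_seq u) //= addrAC; apply: vZvD.
  rewrite (max_len_floors dy fl) subrr vpow0 scale1r.
  by apply: kl_coord_Nstd => //; exact: (fiber_increasing hP dy hf).
by rewrite big_seq_cond; apply: big_ind; [exact: vZv0|exact: vZvD|move=> w /andP[hw nw]; exact: term].
Qed.

End MaximalFiber.

Lemma kl_coord_Mvec_polynomial P y x : fundamental k' l' P -> decreasing y ->
  polynomialL (kl_coord x (Mvec P y)).
Proof.
move=> hP dy; have [P0 [u [hP0 hu fl]]] := exists_maximal_fiber l' dy.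
rewrite -[X in polynomialL X](subrK (`[< fiber P y u >] && (aff u == x))%:R).
apply: polynomialLD; last exact: polynomialL_nat.
by apply: vZv_polynomialL; apply: kl_coord_Mvec => //; exact: hu.1.
Qed.

Lemma hecke_value_lattice P x y : fundamental k' l' P -> lattice y ->
  regular_at0 (hecke_value (kl_coord x) P y).
Proof.
move=> hP [c /combination_seq[s [_ _ _ hc ->]]]; have hv := hecke_value_linear (kl_coord x) P.
rewrite (linear_fun_sum _ _ _ hv); apply: big_ind.
- by rewrite -(rmorph0 ofQX); exact: regular_at0_poly.
- exact: regular_at0D.
move=> lam _; rewrite hv.2; apply: regular_at0M; first exact: hc.
rewrite hecke_value_diagram; case: ifP => _; last by rewrite -(rmorph0 ofQX); exact: regular_at0_poly.
by apply: regular_at0_polynomialL; apply: kl_coord_Mvec_polynomial => //; exact: shifted_decreasing.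
Qed.

Lemma hecke_value_laurentQ g P y : laurent_coeffs y -> laurentQ (hecke_value g P y).
Proof.
move=> hy; have hv := hecke_value_linear g P.
rewrite (fock_sum y) (linear_fun_sum _ _ _ hv); apply: big_ind; [exact: laurentQ0|exact: laurentQD|].
move=> lam _; rewrite hv.2; apply: laurentQM; first exact: hy.
by rewrite hecke_value_diagram; case: ifP => _; [exact: laurentQ_laurent|exact: laurentQ0].
Qed.

(** Self-duality expands y over the same words with coefficients c and with their bar conjugates,
    while [f_word_lift] sends each word to a bar invariant element. *)
Lemma hecke_value_self_dual P x y : fundamental k' l' P -> self_dual l y ->
  barQ (hecke_value (kl_coord x) P y) = hecke_value (kl_coord x) P y.
Proof.
move=> hP [c [hc hc']]; have hv := hecke_value_linear (kl_coord x) P.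
have [s [us _ s0 _ _]] := combination_seq hc.
rewrite {1}(combination_sum hc us s0) (combination_sum hc' us); last first.
  by move=> i /s0 /= ->; rewrite barQ0.
rewrite !(linear_fun_sum _ _ _ hv) (big_morph barQ barQD barQ0); apply: eq_bigr => w _.
rewrite !hv.2 barQM; congr (_ * _).
have [n [_ bn ->]] := f_word_lift N w hP; last exact: kl_coord_linear.
by rewrite -val_barL -kl_coord_nbar bn.
Qed.

(** [bar_invariant_eq0] applies to the difference of the two sides: membership in M_Q makes it a
    Laurent polynomial, self-duality makes it bar invariant, and the congruence of G(mu) with mu
    makes it divisible by v at v = 0. *)
Lemma hecke_value_global_basis (G : young -> fock) mu P u x : lower_global_basis l G ->
  l_regular l mu -> (size mu <= k)%N -> fundamental k' l' P -> valid u ->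
  maximal l' (shifted mu) u ->
  hecke_value (kl_coord x) P (G mu) = (`[< fiber P (shifted mu) u >] && (aff u == x))%:R.
Proof.
move=> [[hMQ _] hG] hreg hs hP hu fl; have [[y hy eG] sd] := hG mu hreg.
have hv := hecke_value_linear (kl_coord x) P.
set d := (_ && _); apply/eqP; rewrite -subr_eq0; apply/eqP; apply: bar_invariant_eq0.
- apply: laurentQD; last by apply: laurentQN; rewrite -(rmorph_nat ofQX); exact: laurentQ_poly.
  apply: hecke_value_laurentQ; apply: (@laurent_coeffs_M_Q l'); rewrite -hMQ.
  exists (fun nu => (nu == mu)%:R); rewrite -[G mu]scale1r.
  have := @seq_combination _ _ _ laurentQ [set nu | l_regular l nu] G
    (fun nu => (nu == mu)%:R) [:: mu].
  rewrite big_seq1 eqxx; apply=> //.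
  + by move=> nu; rewrite inE => /eqP ->.
  + by move=> nu; rewrite inE => /negPf ->.
  by move=> nu; case: eqP => _; [exact: laurentQ1|exact: laurentQ0].
- by rewrite barQD barQN barQ_natr hecke_value_self_dual.
have [p ep] := kl_coord_Mvec (@shifted_decreasing k' mu) hu fl x hP.
exists (ofZX p + hecke_value (kl_coord x) P y).
  apply: regular_at0D; last exact: hecke_value_lattice.
  exact: regular_at0_poly.
rewrite -[G mu](subrK (diagram mu)) eG hv.1 hv.2 hecke_value_diagram hs mulrDr -ep.
by rewrite rmorphB rmorph_nat -/d -addrA [LHS]addrC.
Qed.

(** The expansion of a vector of N in the Kazhdan-Lusztig basis, carried to the Fock space. Each
    diagram has its own finite support; allowing any list s' that contains s lets these supports be
    merged. *)
Lemma hecke_value_kappa P u y : fundamental k' l' P -> exists s : seq (V -> V),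
  forall s', uniq s' -> {subset s <= s'} ->
  hecke_value (kappa^~ u) P y =
    \sum_(x <- s') hecke_value (kl_coord x) P y * val (kappa (uN x) u).
Proof.
move=> hP; have hv (g : N -> laurent) := hecke_value_linear g P.
elim/fock_ind: y => [|y z [s hs] [t ht]|a lam].
- exists [::] => s' _ _; rewrite (linear_fun0 (hv _)) big1 // => x _.
  by rewrite (linear_fun0 (hv _)) mul0r.
- exists (s ++ t) => s' us' sub; rewrite (hv _).1 (hs s') // => [|i hi]; last by rewrite sub // mem_cat hi.
  rewrite (ht s') // => [|i hi]; last by rewrite sub // mem_cat hi orbT.
  by rewrite -big_split; apply: eq_bigr => x _; rewrite (hv _).1 mulrDl.
have [s [_ _ s0 _]] := coordinates_seq huN.1 (Mvec P (shifted lam)).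
exists s => s' us' sub.
under eq_bigr do rewrite (hv _).2 -[_ *: _]/(_ * _) -mulrA.
rewrite -mulr_sumr (hv _).2; congr (_ * _).
rewrite hecke_value_diagram.
under eq_bigr do rewrite hecke_value_diagram.
case: ifP => _; last by rewrite big1 // => x _; rewrite mul0r.
rewrite {1}(combination_sum (coordinatesP huN.1 (Mvec P (shifted lam))) us'); last first.
  by move=> i hi; apply: s0; apply: contraNN hi; exact: sub.
rewrite kappa_sum val_laurent_sum; apply: eq_bigr => x _.
by rewrite kappaZ rmorphM.
Qed.

(** P and u determine the point [P \o u], so N_u occurs in the image of lam and of no other diagram
    with at most k rows, and by maximality of u with weight 1. *)
Lemma hecke_value_fock_coeff lam P u y : (size lam <= k)%N -> fundamental k' l' P ->
  fiber P (shifted lam) u ->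
  maximal l' (shifted lam) u ->
  hecke_value (kappa^~ u) P y = fock_coeff lam y.
Proof.
move=> hs hP hu fl; have dl := @shifted_decreasing k' lam.
move: y; apply: linear_fun_ext; [exact: hecke_value_linear|exact: fock_coeff_linear|].
move=> nu; rewrite hecke_value_diagram fock_coeff_diagram.
case: (eqVneq nu lam) => [->|ne].
  rewrite hs kappa_Mvec // ifT; last exact/asboolP.
  by rewrite (max_len_floors dl fl) subrr.
case: ifP => // hn; rewrite kappa_Mvec //; last exact: shifted_decreasing.
rewrite ifF //; apply/asboolP => hf; case/eqP: ne; apply: (shifted_inj hn hs).
by rewrite -hf.2 hu.2.
Qed.

Lemma fock_coeff_kl_poly (G : young -> fock) lam mu : lower_global_basis l G ->
  l_regular l mu -> (size lam <= k)%N -> (size mu <= k)%N ->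
  fock_coeff lam (G mu) = val (kl_poly_point uN (rho_shift R k lam) (rho_shift R k mu)).
Proof.
move=> hG hreg hlam hmu; rewrite !rho_shift_int_point.
have dl := @shifted_decreasing k' lam; have dm := @shifted_decreasing k' mu.
have [P [u [hP hu fl]]] := exists_maximal_fiber l' dl.
have [P' [u' [hP' hu' fl']]] := exists_maximal_fiber l' dm.
rewrite (kl_poly_int_point uN hP hP' dl dm hu hu' fl fl').
rewrite -(hecke_value_fock_coeff _ hlam hP hu fl).
have [s hs] := hecke_value_kappa u (G mu) hP.
(* The element of a^+(mu + rho) is put into the list so that its term, the only one that survives,
   can be split off. *)
rewrite (hs (undup (aff u' :: s))) ?undup_uniq //; last first.
  by move=> x hx; rewrite mem_undup inE hx orbT.
rewrite (bigD1_seq (aff u')) ?undup_uniq ?mem_undup ?mem_head //=.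
have hval x := hecke_value_global_basis x hG hreg hmu hP hu'.1 fl'.
rewrite big1 ?addr0; last first.
  by move=> x nx; rewrite hval [aff u' == x]eq_sym (negPf nx) andbF mul0r.
rewrite hval eqxx andbT.
(* Both conditions say that lam + rho and mu + rho lie in the same affine orbit. *)
have -> : `[< fiber P (shifted mu) u' >] = `[< P = P' >].
  by apply/asbool_equiv_eq; split=> [h|->//]; exact: (fiber_unique hP hP' h hu').
by case: ifP => _; rewrite ?mul1r ?mul0r.
Qed.

End KazhdanLusztigCoordinates.

Theorem theorem5p3 (R : realType) (k l : nat) (hk : (2 <= k)%N) (hl : (2 <= l)%N)
  (G : young -> fock) (hG : lower_global_basis l G)
  (H : hecke R k l) (N : antispherical H)
  (uN : ('rV[R]_k -> 'rV[R]_k) -> N) (huN : kazhdan_lusztig_basis uN)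
  (lam mu : young) (hsize : sumn lam = sumn mu)
  (hlam : (size lam <= k)%N) (hmu : (size mu <= k)%N) (hreg : l_regular l mu) :
  fock_coeff lam (G mu) =
    kl_poly_point uN (rho_shift R k lam) (rho_shift R k mu).
Proof.
move: hk hl G hG H N uN huN lam mu hsize hlam hmu hreg.
case: k => [|[|k']] // _; case: l => [|[|l']] // _ G hG H N uN huN lam mu _ hlam hmu hreg.
exact: fock_coeff_kl_poly.
Qed.
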